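(* Let $a$ and $b$ be distinct elements of $\{6,7,8\}$. Every planar graph $G$ that contains no cycle of length $4$, no cycle of length $a$, no cycle of length $b$, and no cycle of length $9$ is DP-$3$-colorable.
   Context: All graphs are finite, simple and undirected. DP-coloring: Let $G$ be a graph with $n$ vertices and let $L$ be a list assignment giving each vertex $v$ a set $L(v)$ of colors. For each $v\in V(G)$ let $L_v=\{v\}\times L(v)$. For each edge $uv\in E(G)$ let $M_{uv}$ be a (possibly empty) matching between $L_u$ and $L_v$, and let $\mathcal{M}_L=\{M_{uv}: uv\in E(G)\}$ (the matching assignment). Let $G_L$ be the graph with vertex set $\bigcup_{v\in V(G)} L_v$ in which each $L_v$ is a clique, for each edge $uv\in E(G)$ the edges between $L_u$ and $L_v$ are exactly those of $M_{uv}$, and for $uv\notin E(G)$ there are no edges between $L_u$ and $L_v$. $G$ is $\mathcal{M}_L$-colorable if $G_L$ contains an independent set of size $n$. $G$ is DP-$k$-colorable if for every list assignment $L$ with $|L(v)|=k$ for all $v$ and every matching assignment $\mathcal{M}_L$, $G$ is $\mathcal{M}_L$-colorable. *)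

(* Defs.v *)
From mathcomp Require Import all_boot all_order all_algebra.
From mathcomp Require Import all_classical all_reals all_analysis.

Set Implicit Arguments.
Unset Strict Implicit.
Unset Printing Implicit Defensive.

Import Order.TTheory GRing.Theory Num.Theory.
Import numFieldNormedType.Exports.

Local Open Scope classical_set_scope.
Local Open Scope ring_scope.

(* A finite simple undirected graph is a symmetric irreflexive relation E on a
   finType V; symmetry and irreflexivity are assumed where they are needed. *)

(* The bound 2 < k is not redundant: for an edge uv, [:: u; v] is a ucycle. *)
Definition has_cycle (V : finType) (E : rel V) (k : nat) : Prop :=
  (2 < k)%N /\ exists2 c : seq V, size c = k & ucycle E c.

(* The edge uv is drawn as the image of [0, 1] under arc u v; arc v u is the
   same curve traversed backwards. *)
Record plane_drawing (R : realType) (V : finType) (E : rel V)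
    (pos : V -> R * R) (arc : V -> V -> R -> R * R) : Prop := PlaneDrawing {
  drawing_pos_inj : injective pos;
  drawing_arc_continuous : forall u v, E u v ->
    {within `[0, 1], continuous (arc u v)};
  drawing_arc_inj : forall u v, E u v -> {in `[0, 1] &, injective (arc u v)};
  drawing_arc0 : forall u v, E u v -> arc u v 0 = pos u;
  drawing_arc1 : forall u v, E u v -> arc u v 1 = pos v;
  drawing_arc_rev : forall u v, E u v ->
    {in `[0, 1], forall t, arc v u t = arc u v (1 - t)};
  drawing_avoid_vertex : forall u v w, E u v ->
    {in `]0, 1[, forall t, arc u v t <> pos w};
  drawing_no_crossing : forall u v x y, E u v -> E x y ->
    [set u; v]%SET != [set x; y]%SET ->
    {in `]0, 1[ &, forall s t, arc u v s <> arc x y t} }.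

Definition planar (R : realType) (V : finType) (E : rel V) : Prop :=
  exists (pos : V -> R * R) (arc : V -> V -> R -> R * R),
    plane_drawing E pos arc.

(* M u v c d says that the matching M_{uv} contains the edge joining (u, c) and
   (v, d). For symmetric E, the last two conditions make each M_{uv} a
   matching. The values of M on non-edges are irrelevant. *)
Record matching_assignment (V C : finType) (E : rel V) (L : V -> {set C})
    (M : V -> V -> rel C) : Prop := MatchingAssignment {
  matching_in_lists : forall u v c d, E u v -> M u v c d ->
    (c \in L u) /\ (d \in L v);
  matching_sym : forall u v c d, E u v -> M u v c d = M v u d c;
  matching_functional : forall u v c d d', E u v ->
    M u v c d -> M u v c d' -> d = d' }.

Definition cover_vertices (V C : finType) (L : V -> {set C}) : {set V * C} :=
  [set p | p.2 \in L p.1]%SET.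

Definition cover_adj (V C : finType) (E : rel V) (M : V -> V -> rel C) :
    rel (V * C) :=
  fun p q => if p.1 == q.1 then p.2 != q.2
             else E p.1 q.1 && M p.1 q.1 p.2 q.2.

Definition M_colorable (V C : finType) (E : rel V) (L : V -> {set C})
    (M : V -> V -> rel C) : Prop :=
  exists S : {set V * C},
    [/\ S \subset cover_vertices L, #|S| = #|V| &
        {in S &, forall p q, ~~ cover_adj E M p q}].

(* Colours range over an arbitrary finite type: the union of finitely many
   finite lists is finite. *)
Definition DP_colorable (V : finType) (E : rel V) (k : nat) : Prop :=
  forall (C : finType) (L : V -> {set C}) (M : V -> V -> rel C),
    (forall v, #|L v| = k) -> matching_assignment E L M -> M_colorable E L M.

(* Main.v *)
(* Fix the lists and matchings. One proves more: every colouring of a set K of one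
   vertex or two adjacent ones extends to the whole graph. A minimal counterexample
   has degree at least 3 off K, is connected off K, and, by minimality applied to
   both sides of a separation of order at most two, all its faces are chordless
   cycles. With 4-, 9- and two of the 6-, 7- and 8-cycles forbidden, faces have
   length 3, 5, m (the remaining length) or at least 10, and short faces are hardly
   ever adjacent.

   Reducible configurations all come from one colouring trick: delete a set H
   avoiding K, colour the rest by minimality, give a suitable q in H a colour which
   spares its neighbour q' in H, and colour H greedily, q' last. Discharging the charges 2 deg v - 6 on vertices and len f - 6
   on faces, whose sum is -12 by Euler's formula, then gives a contradiction; the
   unit of charge is 1/24, hence the constants 144 = 6 * 24 and 24 * len.

   Euler's formula is used for pairs of permutations of the darts (oriented edges):
   e reverses a dart, r turns to the next dart around its source, and the orbits of
   e * r are the faces. A drawing gives such a pair without the Jordan curve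
   theorem: by compactness it shows the graph as a minor of a large square grid,
   whose map has genus 0 by inspection, and contracting or deleting edges of a map
   does not increase its genus. *)
Require Import Defs.
From mathcomp Require Import all_boot all_order all_fingroup.
From mathcomp Require Import boolp.
From mathcomp Require Import zify.

Set Implicit Arguments.
Unset Strict Implicit.
Unset Printing Implicit Defensive.

(** Precolouring [K] is what carries the induction across separations: once one side is coloured,
    the vertices common to both sides, at most two and adjacent, are the precoloured clique of the
    other side. Two is also the most that the charge allows. Vertices of [K] have no degree bound,
    so each is excused the deficit 144; as the total is at most -288, one excused vertex leaves it
    negative, and two leave it so thanks to the strict slack of [vgift_K_two].

    In DP-colouring, colours of different vertices cannot be compared, so vertices are never
    identified: reductions only delete vertices and count the colours left.

    The tight faces have length 10. Around a face of k vertices of degree 3, every other side may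
    cost 24, and 12 k <= 24 k - 144 needs k >= 12. The exceptions [ex2] and [ex3], the payments
    across [relat] sides and the reductions [reducible_pair] and [reducible_two] exist for the sake
    of 10-faces. *)

Ltac card_lia :=
  intros; repeat match goal with H : is_true (_ <= _) |- _ => move: H
    | H : @eq nat _ _ |- _ => move: H end;
  repeat match goal with |- context [@card ?T ?A] => move: (@card T A) => ? end; lia.

(** * Euler characteristic of a pair of permutations *)

Section EquivClasses.
Variable T : finType.
Implicit Types R : rel T.

Definition nclasses R := #|[set [set y | R x y] | x : T]|.

Lemma classE R : equivalence_rel R -> forall x y,
  ([set z | R x z] == [set z | R y z]) = R x y.
Proof.
move=> eqR x y; apply/eqP/idP => [/setP /(_ y)|Rxy].
  by rewrite !inE => ->; case: (eqR y y y).
by apply/setP=> z; rewrite !inE; case: (eqR x y z) => _; apply.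
Qed.

(** Sending a class of [R] to the union of the [R']-classes of its elements maps the classes of [R]
    onto those of [R']. *)
Lemma nclasses_sub R R' : equivalence_rel R -> equivalence_rel R' ->
  subrel R R' -> nclasses R' <= nclasses R.
Proof.
move=> eqR eqR' sRR'.
pose h (A : {set T}) := \bigcup_(x in A) [set y | R' x y].
have hE x : h [set y | R x y] = [set y | R' x y].
  apply/setP=> z; apply/bigcupP/idP => [[y]|].
    rewrite !inE => /sRR' xy yz; case: (eqR' x y z) => _ /(_ xy) ->; exact: yz.
  by move=> xz; exists x => //; rewrite inE; case: (eqR x x x).
rewrite /nclasses (_ : [set _ | x : T] = h @: [set [set y | R x y] | x : T]).
  exact: leq_imset_card.
apply/setP=> A; apply/imsetP/imsetP=> [[x _ ->]|[B /imsetP[x _ ->] ->]].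
  by exists [set y | R x y]; rewrite ?hE // imset_f.
by exists x; rewrite ?hE.
Qed.

(** [R'] identifies nothing beyond [R] except the classes of [a] and [b]. Apart from the class of
    [b], sending a class of [R] to the [R']-class of one of its elements is therefore injective. *)
Lemma nclasses_add R R' a b : equivalence_rel R -> equivalence_rel R' ->
  (forall x y, R' x y -> [|| R x y, R x a && R b y | R x b && R a y]) ->
  nclasses R <= (nclasses R').+1.
Proof.
move=> eqR eqR' sR'.
have rR x : R x x by case: (eqR x x x).
have sR x y : R x y = R y x.
  apply/idP/idP=> xy; first by case: (eqR x y x) => _ /(_ xy) <-.
  by case: (eqR y x y) => _ /(_ xy) <-.
rewrite /nclasses; set CR := [set _ | x : T]; set CR' := [set _ | x : T].
rewrite (cardsD1 [set y | R b y] CR).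
suff: #|CR :\ [set y | R b y]| <= #|CR'| by case: (_ \in _) => /=; lia.
pose h (A : {set T}) := \bigcup_(x in A) [set y | R' x y].
pose h' (A : {set T}) := if [pick x in A] is Some x then [set y | R' x y] else set0.
rewrite -(card_in_imset (f := h')).
  apply: subset_leq_card; apply/subsetP=> B /imsetP[A].
  rewrite inE => /andP[_ /imsetP[x _ ->]] ->; rewrite /h'.
  case: pickP => [y _|/(_ x)]; first exact: imset_f.
  by rewrite inE rR.
move=> A B; rewrite !inE => /andP[nA /imsetP[x _ EA]] /andP[nB /imsetP[y _ EB]].
rewrite {}EA {}EB in nA nB *; rewrite classE // in nA; rewrite classE // in nB.
rewrite /h'; case: pickP => [x' |/(_ x)]; last by rewrite inE rR.
case: pickP => [y' |/(_ y)]; last by rewrite inE rR.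
rewrite !inE => yy' xx' /eqP; rewrite classE // => /sR' x'y'.
apply/eqP; rewrite classE //.
have Rt u v w : R u v -> R v w -> R u w.
  by move=> uv vw; case: (eqR u v w) => _ /(_ uv) ->.
case/or3P: x'y' => [x'y'|/andP[xa by']|/andP[xb ay']].
- by apply: Rt xx' (Rt _ _ _ x'y' _); rewrite sR.
- by case/negP: nB; rewrite (Rt _ _ _ yy') // sR.
- by case/negP: nA; rewrite (Rt _ _ _ xx').
Qed.

End EquivClasses.

Section Chi.
Local Open Scope group_scope.
Variable T : finType.
Implicit Types e r : {perm T}.

Definition gstep e r : rel T := [rel x y | (y == e x) || (y == r x)].
Definition conn e r : rel T := connect (gstep e r).

Lemma conn0 e r x : conn e r x x.
Proof. exact: connect0. Qed.

Lemma conn_trans e r x y z : conn e r x y -> conn e r y z -> conn e r x z.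
Proof. exact: connect_trans. Qed.

Lemma conn_stepl e r x : conn e r x (e x).
Proof. by apply: connect1; rewrite /gstep /= eqxx. Qed.

Lemma conn_stepr e r x : conn e r x (r x).
Proof. by apply: connect1; rewrite /gstep /= eqxx orbT. Qed.

Lemma conn_porbitl e r x y : y \in porbit e x -> conn e r x y.
Proof.
case/porbitP=> i ->; elim: i => [|i IHi]; first by rewrite perm1 conn0.
by rewrite expgSr permM; apply: conn_trans IHi (conn_stepl _ _ _).
Qed.

Lemma conn_porbitr e r x y : y \in porbit r x -> conn e r x y.
Proof.
case/porbitP=> i ->; elim: i => [|i IHi]; first by rewrite perm1 conn0.
by rewrite expgSr permM; apply: conn_trans IHi (conn_stepr _ _ _).
Qed.

(** The inverse of a permutation of a finite set is one of its powers, so every step can be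
    undone. *)
Lemma conn_sym e r x y : conn e r x y = conn e r y x.
Proof.
suff: forall x y, conn e r x y -> conn e r y x by move=> H; apply/idP/idP; apply: H.
move=> {x y} x _ /connectP[p + ->]; elim: p x => [|y p IHp] x /=; first by rewrite conn0.
case/andP=> xy /IHp; move/conn_trans; apply.
case/orP: xy => /eqP->; [apply: conn_porbitl | apply: conn_porbitr];
  by rewrite porbit_sym (mem_porbit _ 1).
Qed.

Lemma conn_equiv e r : equivalence_rel (conn e r).
Proof.
move=> x y z; split; first exact: conn0.
by move=> xy; apply/idP/idP; apply: conn_trans => //; rewrite conn_sym.
Qed.

Lemma conn_closed e r (P : pred T) x y :
  (forall z, P z -> P (e z)) -> (forall z, P z -> P (r z)) ->
  conn e r x y -> P x -> P y.
Proof.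
move=> Pe Pr /connectP[p + ->]; elim: p x => [//|z p IHp] x /= /andP[xz /IHp Pz] Px.
by apply: Pz; case/orP: xz => /eqP->; auto.
Qed.

Lemma conn_sub e r e' r' : (forall x, conn e' r' x (e x)) ->
  (forall x, conn e' r' x (r x)) -> subrel (conn e r) (conn e' r').
Proof.
move=> He Hr; apply: connect_sub => x y; rewrite /gstep /= => /orP[] /eqP->; first exact: He.
exact: Hr.
Qed.

Definition ncomp e r := nclasses (conn e r).

(* The genus of the map with edge permutation e and vertex permutation r is
   (#|T| + 2 ncomp - (number of orbits of e, r and e * r)) / 2. *)
Definition genus0 e r :=
  #|T| + (ncomp e r).*2 <= #|porbits e| + #|porbits r| + #|porbits (e * r)|.

Lemma porbits_mulr_tperm (s : {perm T}) a b : a != b ->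
  #|porbits (s * tperm a b)| + (a \notin porbit s b).*2 = (#|porbits s|).+1.
Proof.
move=> ab; have := porbits_mul_tperm s^-1 a b; rewrite /= ab porbitV porbitsV addn1.
by rewrite -(porbitsV (s * tperm a b)) invMg tpermV.
Qed.

Lemma porbit_mul_tperm_split (s : {perm T}) a b : a != b ->
  (a \in porbit (s * tperm a b) b) = (a \notin porbit s b).
Proof.
move=> ab; have H1 := porbits_mulr_tperm s ab.
have := porbits_mulr_tperm (s * tperm a b) ab.
rewrite -mulgA tperm2 mulg1.
by case: (a \in porbit _ b) H1 => /=; case: (a \in porbit _ b) => /=; lia.
Qed.

(* Splitting a vertex never increases the genus. *)
Lemma split_chi e r a b : a != b -> a \in porbit r b ->
  #|porbits e| + #|porbits r| + #|porbits (e * r)| + (ncomp e (r * tperm a b)).*2 <=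
  #|porbits e| + #|porbits (r * tperm a b)| + #|porbits (e * (r * tperm a b))|
    + (ncomp e r).*2.
Proof.
move=> ab arb; set r' := r * tperm a b.
have := porbits_mulr_tperm r ab; rewrite arb /= addn0 -/r' => ->.
have := porbits_mulr_tperm (e * r) ab; rewrite -mulgA -/r'.
have subr x : [|| conn e r' x (r x), conn e r' x a && conn e r' b (r x)
    | conn e r' x b && conn e r' a (r x)].
  have : conn e r' x (r' x) by apply: conn_stepr.
  rewrite /r' permM; case: tpermP => [->|->|_ _] H; rewrite -/r' in H *.
  - by rewrite H conn0 !orbT.
  - by rewrite H conn0 !orbT.
  - by rewrite H.
(* If [a] and [b] share a face, it splits along with the vertex, and the two orbits gained pay for
   one more component. *)
case: (boolP (a \in porbit (e * r) b)) => /= [_|nab].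
  suff: ncomp e r' <= (ncomp e r).+1.
    move: #|porbits (e * r')| #|porbits (e * r)| (ncomp e r') (ncomp e r) => *; lia.
  apply: (@nclasses_add _ _ _ a b) => //; try exact: conn_equiv.
  move=> x y /connectP[p + ->]; elim: p x => [|z p IHp] x /=; first by rewrite conn0.
  case/andP=> xz /IHp; set w := last _ _ => zw.
  have tr := @conn_trans e r'.
  have sy := @conn_sym e r'.
  case/orP: xz => /eqP Ez.
    have xz : conn e r' x z by rewrite Ez conn_stepl.
    by case/or3P: zw => [/(tr _ _ _ xz)->|/andP[/(tr _ _ _ xz)-> ->]|/andP[/(tr _ _ _ xz)-> ->]] //; rewrite !orbT.
  have := subr x; rewrite -Ez; case/or3P => [xz|/andP[xa bz]|/andP[xb az]].
  - by case/or3P: zw => [/(tr _ _ _ xz)->|/andP[/(tr _ _ _ xz)-> ->]|/andP[/(tr _ _ _ xz)-> ->]] //; rewrite !orbT.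
  - case/or3P: zw => [/(tr _ _ _ bz) H|/andP[_ bw]|/andP[zb aw]].
    + by rewrite xa (H : conn _ _ _ _) orbT.
    + by rewrite xa bw !orbT.
    + by rewrite (tr _ _ _ xa aw).
  - case/or3P: zw => [/(tr _ _ _ az) H|/andP[za bw]|/andP[_ aw]].
    + by rewrite xb (H : conn _ _ _ _) !orbT.
    + by rewrite (tr _ _ _ xb bw).
    + by rewrite xb aw !orbT.
(* Now two faces merge into one, which balances the new vertex; this face still joins [a] to [b], so
   no component is added. *)
suff: ncomp e r' <= ncomp e r.
  move: #|porbits (e * r')| #|porbits (e * r)| (ncomp e r') (ncomp e r) => *; lia.
apply: nclasses_sub; try exact: conn_equiv.
have : a \in porbit (e * r') b by rewrite /r' mulgA porbit_mul_tperm_split.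
case/porbitP=> i Ei.
have ba : conn e r' b a.
  rewrite Ei {Ei}; elim: i => [|i IHi]; first by rewrite perm1 conn0.
  rewrite expgSr permM; apply: conn_trans IHi _; rewrite permM.
  by apply: conn_trans (conn_stepl _ _ _) (conn_stepr _ _ _).
apply: conn_sub => x; first exact: conn_stepl.
have := subr x; case/or3P => [//|/andP[xa bx]|/andP[xb ax]].
  by apply: conn_trans xa (conn_trans _ bx); rewrite -/(conn _ _ _ _) conn_sym.
by apply: conn_trans xb (conn_trans ba ax).
Qed.

(** The genus is nonnegative: splitting vertices never increases it, and leads down to [r = 1],
    where edges, faces and components are the same orbits. *)
Lemma chi_le e r :
  #|porbits e| + #|porbits r| + #|porbits (e * r)| <= #|T| + (ncomp e r).*2.
Proof.
have le_orb (s : {perm T}) : #|porbits s| <= #|T|.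
  by rewrite /porbits (leq_trans (leq_imset_card _ _)).
have [m] := ubnP (#|T| - #|porbits r|); elim: m r => // m IHm r ltm.
have [-> | r_neq1] := eqVneq r 1.
  rewrite mulg1.
  have -> : #|porbits (1 : {perm T})| = #|T|.
    rewrite /porbits card_imset // => x y; move/eqP; rewrite eq_porbit_mem.
    by rewrite porbit.unlock cycle1 imset_set1 /aperm perm1 inE => /eqP.
  suff: #|porbits e| <= ncomp e 1 by lia.
  rewrite /ncomp /nclasses /porbits.
  rewrite [in X in _ <= X](_ : [set _ | x : T] = porbit e @: T) //.
  apply: eq_imset => x; apply/setP=> y; rewrite inE.
  apply/idP/idP => [xy|]; last exact: conn_porbitl.
  apply: (conn_closed (P := mem (porbit e x)) _ _ xy) (porbit_id e x) => z /=.
    case/porbitP=> i ->; apply/porbitP; exists i.+1; by rewrite expgSr permM.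
  by rewrite perm1.
have [x rx] : exists x, r x != x.
  apply/existsP; apply: contraNT r_neq1; rewrite negb_exists => /forallP H.
  by apply/eqP/permP=> x; rewrite perm1; apply/eqP; have := H x; rewrite negbK.
have xin : r x \in porbit r x by rewrite (mem_porbit _ 1).
have := porbits_mulr_tperm r rx; rewrite xin /= addn0 => E.
have := split_chi e rx xin; have := IHm (r * tperm (r x) x).
have := le_orb (r * tperm (r x) x); rewrite E => lt1 H.
have {}H : #|porbits e| + (#|porbits r|).+1 + #|porbits (e * (r * tperm (r x) x))| <=
   #|T| + (ncomp e (r * tperm (r x) x)).*2 by apply: H; move: lt1 ltm; card_lia.
by move: H; card_lia.
Qed.

Lemma split_genus0 e r a b : a != b -> a \in porbit r b ->
  genus0 e r -> genus0 e (r * tperm a b).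
Proof.
by move=> ab arb; rewrite /genus0; have := split_chi e ab arb; card_lia.
Qed.

Lemma conn_inv e r : conn e^-1 r^-1 =2 conn e r.
Proof.
suff H e1 r1 : subrel (conn e1 r1) (conn e1^-1 r1^-1).
  by move=> x y; apply/idP/idP => [/H|/H]; rewrite ?invgK.
apply: conn_sub => x; rewrite conn_sym.
  by rewrite -{2}[x](permK e1) conn_stepl.
by rewrite -{2}[x](permK r1) conn_stepr.
Qed.

(** Exchanging edges and vertices keeps the faces up to inversion. Vertex splitting thus becomes
    splitting of an orbit of [e], that is, deletion of an edge. *)
Lemma genus0_inv e r : genus0 r^-1 e^-1 = genus0 e r.
Proof.
rewrite /genus0 -invMg !porbitsV (addnC #|porbits r|); congr (_ + _.*2 <= _).
rewrite /ncomp /nclasses; congr #|pred_of_set _|; apply: eq_imset => x.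
apply/setP=> y; rewrite !inE -[in RHS]conn_inv.
by apply: eq_connect => u v; rewrite /gstep /= orbC.
Qed.

Lemma split_genus0l e r a b : a != b -> a \in porbit e b ->
  genus0 e r -> genus0 (tperm a b * e) r.
Proof.
move=> ab aeb; rewrite -!(genus0_inv _ r) invMg tpermV.
by apply: split_genus0 => //; rewrite porbitV.
Qed.

End Chi.

(** * Minors of plane maps *)

Section Minor.
Local Open Scope group_scope.
Variables (T V : finType) (E : rel V) (delta : V -> V -> T) (lab : T -> option V).
Hypothesis lab_delta : forall u v, E u v -> lab (delta u v) = Some u.
Hypothesis E_sym : symmetric E.
Hypothesis E_irr : irreflexive E.
Implicit Types e r : {perm T}.

Let X : {set T} := [set d | [exists u, exists v, E u v && (d == delta u v)]].

Lemma deltaX u v : E u v -> delta u v \in X.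
Proof. by move=> uv; rewrite inE; apply/existsP; exists u; apply/existsP; exists v; rewrite uv /=. Qed.

Lemma XP d : reflect (exists u v, E u v /\ d = delta u v) (d \in X).
Proof.
rewrite inE; apply: (iffP existsP) => [[u /existsP[v /andP[uv /eqP->]]]|[u [v [uv ->]]]].
  by exists u, v.
by exists u; apply/existsP; exists v; rewrite uv /=.
Qed.

Definition labstep e r : rel T := [rel x y | (y == r x) || (y == e x) && (lab x == lab y)].

(** The state of the reduction of a map to a minor: [lab] gives the branch set of a dart and
    [delta u v] the dart that will represent the edge uv. Deleted and contracted darts stay in [T]
    as fixed points of [e]. By the last field each branch set stays connected through its own
    darts. *)
Record submap e r : Prop := Submap {
  submap_inv : involutive e;
  submap_genus : genus0 e r;
  submap_lab : forall x, lab (r x) = lab x;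
  submap_delta : forall u v, E u v -> e (delta u v) = delta v u;
  submap_conn : forall x y, lab x = lab y -> lab x != None -> connect (labstep e r) x y }.

Lemma labstep_porbit e r x y : y \in porbit r x -> connect (labstep e r) x y.
Proof.
case/porbitP=> i ->; elim: i => [|i IHi]; first by rewrite perm1 connect0.
rewrite expgSr permM; apply: connect_trans IHi (connect1 _).
by rewrite /labstep /= eqxx.
Qed.

(** The edge is contracted if its ends are different vertices with the same label, and deleted
    otherwise. Contraction multiplies both [e] and [r] by the transposition of the two darts, which
    leaves the faces [e * r] as they are. Deletion keeps branch sets connected, since the edge is
    then a loop or joins different labels. *)
Lemma submap_reduce e r d : submap e r -> e d != d -> d \notin X ->
  exists e' r', [/\ submap e' r', e' d = d, e' (e d) = e d &
    forall x, x != d -> x != e d -> e' x = e x].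
Proof.
move=> [inv gen labr ed con] moved ndX; set d' := e d in moved *.
have ed' : e d' = d by rewrite /d' inv.
have nd'X : d' \notin X.
  apply: contra ndX => /XP[u [v [uv Ed]]].
  by apply/XP; exists v, u; rewrite E_sym uv -ed -?Ed.
pose tau := tperm d d'.
have tE : tau * e = e * tau.
  apply/permP=> x; rewrite !permM /tau; case: tpermP => [->|->|/eqP xd /eqP xd'].
  - by rewrite ed' tpermR.
  - by rewrite ed' tpermL.
  - rewrite tpermD //; first by rewrite -ed' (inj_eq perm_inj) eq_sym.
    by rewrite (inj_eq perm_inj) eq_sym.
have e'd : (tau * e) d = d by rewrite permM tpermL ed'.
have e'd' : (tau * e) d' = d' by rewrite permM tpermR.
have e'o x : x != d -> x != d' -> (tau * e) x = e x.
  by move=> xd xd'; rewrite permM tpermD // eq_sym.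
have inv' : involutive (tau * e).
  move=> x; have [->|xd] := eqVneq x d; first by rewrite !e'd.
  have [->|xd'] := eqVneq x d'; first by rewrite !e'd'.
  rewrite [X in (tau * e) X]e'o // e'o ?inv //; last by rewrite (inj_eq perm_inj).
  by rewrite -ed' (inj_eq perm_inj).
have dd' : d \in porbit e d' by rewrite -[d in d \in _]ed' (mem_porbit _ 1).
have del' u v : E u v -> (tau * e) (delta u v) = delta v u.
  move=> uv; rewrite e'o ?ed //; first by apply: contraNneq ndX => <-; apply: deltaX.
  by apply/eqP=> Ed; move: nd'X; rewrite -Ed deltaX.
have ddne : d != d' by rewrite eq_sym.
case: (boolP ((lab d == lab d') && (d \notin porbit r d'))) => [/andP[/eqP ll nporb]|nl].
  exists (tau * e), (tau * r); split=> //; split=> //.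
  - move: gen; rewrite /genus0.
    have -> : tau * e * (tau * r) = e * r by rewrite tE -mulgA (mulgA tau) tperm2 mul1g.
    have := porbits_mul_tperm e d d'; rewrite /= dd' ddne -/tau.
    have := porbits_mul_tperm r d d'; rewrite /= nporb ddne -/tau.
    suff: ncomp (tau * e) (tau * r) <= ncomp e r.
      move: (ncomp _ _) (ncomp _ _) => *; card_lia.
    apply: nclasses_sub; try exact: conn_equiv.
    have cdd' : conn (tau * e) (tau * r) d d'.
      apply: conn_porbitr; have := porbits_mul_tperm r d d'.
      rewrite /= nporb ddne -/tau porbit_sym => H1.
      have := porbits_mul_tperm (tau * r) d d'.
      rewrite /= ddne -/tau mulgA tperm2 mul1g.
      by case: (d \in _) => //=; move: H1; card_lia.
    apply: conn_sub => x.
      have [->|xd] := eqVneq x d; first by [].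
      have [->|xd'] := eqVneq x d'; first by rewrite ed' conn_sym.
      by rewrite -e'o // conn_stepl.
    have -> : r x = (tau * r) (tau x) by rewrite permM /tau tpermK.
    apply: conn_trans (conn_stepr _ _ _).
    by rewrite {2}/tau; case: tpermP => [->|->|_ _]; rewrite ?conn0 // conn_sym.
  - by move=> x; rewrite permM labr /tau; case: tpermP => [->|->|].
  - move=> x y lxy lx; have := con _ _ lxy lx; apply: connect_sub => {lxy lx} {}x {}y.
    have cdd' : connect (labstep (tau * e) (tau * r)) d d'.
      apply: labstep_porbit; have := porbits_mul_tperm r d d'.
      rewrite /= nporb ddne -/tau porbit_sym => H1.
      have := porbits_mul_tperm (tau * r) d d'.
      rewrite /= ddne -/tau mulgA tperm2 mul1g.
      by case: (d \in _) => //=; move: H1; card_lia.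
    have cd'd : connect (labstep (tau * e) (tau * r)) d' d.
      apply: labstep_porbit; have := porbits_mul_tperm r d d'.
      rewrite /= nporb ddne -/tau => H1.
      have := porbits_mul_tperm (tau * r) d d'.
      rewrite /= ddne -/tau mulgA tperm2 mul1g.
      by case: (d \in _) => //=; move: H1; card_lia.
    rewrite /labstep /= => /orP[/eqP->|/andP[/eqP-> lx]].
      have -> : r x = (tau * r) (tau x) by rewrite permM /tau tpermK.
      apply: (@connect_trans _ _ (tau x)); last by apply: connect1; rewrite /= eqxx.
      by rewrite {2}/tau; case: tpermP => [->|->|_ _]; rewrite ?connect0.
    have [->|xd] := eqVneq x d; first by [].
    have [->|xd'] := eqVneq x d'; first by rewrite ed'.
    by apply: connect1; rewrite /= e'o // eqxx lx orbT.
exists (tau * e), r; split=> //; split=> //.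
  exact: split_genus0l.
move=> x y lxy lx; have := con _ _ lxy lx; apply: connect_sub => {lxy lx} {}x {}y.
rewrite {1}/labstep /= => /orP[/eqP->|/andP[/eqP-> lx]].
  by apply: connect1; rewrite /labstep /= eqxx.
have [xd|xd] := eqVneq x d.
  rewrite xd in lx *; apply: labstep_porbit; rewrite porbit_sym.
  by move: nl; rewrite -/d' in lx *; rewrite lx /= negbK.
have [xd'|xd'] := eqVneq x d'.
  rewrite xd' ed' in lx *; apply: labstep_porbit.
  by move: nl; rewrite eq_sym lx /= negbK.
by apply: connect1; rewrite /labstep /= e'o // eqxx lx orbT.
Qed.

Lemma submap_contract e r : submap e r ->
  exists e' r', submap e' r' /\ forall x, x \notin X -> e' x = x.
Proof.
have [m] := ubnP #|[set x | (e x != x) && (x \notin X)]|.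
elim: m e r => // m IHm e r ltm sub.
have [d /andP[ed dX]|no] := pickP (fun x => (e x != x) && (x \notin X)); last first.
  exists e, r; split=> // x xX; apply/eqP; have := no x; rewrite xX andbT.
  by move/negbFE.
have [e' [r' [sub' e'd e'ed e'o]]] := submap_reduce sub ed dX.
apply: (IHm e' r') => //; rewrite -ltnS; apply: leq_trans ltm; rewrite !ltnS.
apply: proper_card; apply/properP; split.
  apply/subsetP=> x; rewrite !inE => /andP[e'x ->]; rewrite andbT.
  have xd : x != d by apply: contraNneq e'x => ->; rewrite e'd.
  have xed : x != e d by apply: contraNneq e'x => ->; rewrite e'ed.
  by rewrite -e'o.
by exists d; rewrite inE ?ed ?dX // e'd eqxx.
Qed.

(** Multiplying by [tperm z (r z)] makes the rotation bypass [z]: it fixes [z] and sends the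
    predecessor of [z] to its successor. *)
Lemma porbit_skip r z x y : x != z -> y != z -> y \in porbit r x ->
  y \in porbit (r * tperm z (r z)) x.
Proof.
move=> xz yz yx; pose r' : {perm T} := r * tperm z (r z); rewrite -/r'.
have r'z : r' z = z by rewrite permM tpermR.
have zS w : w \in porbit r' x -> w != z.
  apply: contraTneq => ->; apply/negP; rewrite porbit_sym => /porbitP[i].
  suff -> : (r' ^+ i) z = z by move/eqP; apply/negP.
  by elim: i => [|i IHi]; rewrite ?perm1 // expgSr permM IHi.
have step w : w \in porbit r' x -> r' w \in porbit r' x.
  case/porbitP=> i ->; apply/porbitP; exists i.+1; by rewrite expgSr [RHS]permM.
(* The invariant along the old orbit: the point is in the new orbit, or it is [z] and its
   predecessor is. *)
pose P w := (w \in porbit r' x) || (w == z) && (r^-1 z \in porbit r' x).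
suff: P y by rewrite /P (negPf yz) orbF.
case/porbitP: yx => i ->; elim: i => [|i].
  by rewrite perm1 /P porbit_id.
rewrite expgSr permM; move: (_ x) => w; rewrite /P => /orP[wS|/andP[/eqP-> zz]].
  have [rwz|rwz] := eqVneq (r w) z; first by rewrite /= -rwz permK wS orbT.
  have := step _ wS; rewrite permM tpermD ?[z == _]eq_sym // => [->//|].
  by rewrite (inj_eq perm_inj) eq_sym zS.
by have := step _ zz; rewrite permM permKV tpermL => ->.
Qed.

(** All edges left join different labels, so a branch set connected through its darts is now a
    single orbit of [r]. Bypassing a dart outside [X] splits it off as a vertex of its own, which
    does not increase the genus. *)
Lemma submap_clean e r : submap e r -> (forall x, x \notin X -> e x = x) ->
  exists r', [/\ genus0 e r', forall x, lab (r' x) = lab x,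
    forall x, x \notin X -> r' x = x &
    forall u v w, E u v -> E u w -> delta u w \in porbit r' (delta u v)].
Proof.
case=> inv gen labr ed con fixe.
have orb u v w : E u v -> E u w -> delta u w \in porbit r (delta u v).
  move=> uv uw.
  have: connect (labstep e r) (delta u v) (delta u w) by apply: con; rewrite !lab_delta.
  case/connectP=> p; move: (delta u v) (delta u w); elim: p => [|y p IHp] x z /=.
    by move=> _ ->; exact: porbit_id.
  case/andP=> xy yp /(IHp _ _ yp); suff: y \in porbit r x by rewrite -eq_porbit_mem => /eqP->.
  case/orP: xy => [/eqP->|/andP[/eqP->]]; first by rewrite (mem_porbit _ 1).
  case: (boolP (x \in X)) => [/XP[u1 [v1 [uv1 ->]]]|/fixe->]; last by rewrite porbit_id.
  rewrite ed // !lab_delta // 1?E_sym // => /eqP[uv1'].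
  by rewrite uv1' E_irr in uv1.
have {con ed inv fixe} [m] := ubnP #|[set x | (r x != x) && (x \notin X)]|.
elim: m r gen labr orb => // m IHm r gen labr orb ltm.
have [z /andP[rz zX]|no] := pickP (fun x => (r x != x) && (x \notin X)); last first.
  exists r; split=> // x xX; apply/eqP; have := no x; rewrite xX andbT.
  by move/negbFE.
have r'z : (r * tperm z (r z)) z = z by rewrite permM tpermR.
apply: (IHm (r * tperm z (r z))).
- by apply: split_genus0 gen; rewrite 1?eq_sym // porbit_sym (mem_porbit _ 1).
- move=> x; rewrite permM; have := labr x; have := labr z.
  by case: tpermP => [->|->|] // <-.
- move=> u v w uv uw; apply: porbit_skip; last exact: orb.
    by apply: contraNneq zX => <-; exact: deltaX.
  by apply: contraNneq zX => <-; exact: deltaX.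
rewrite -ltnS; apply: leq_trans ltm; rewrite !ltnS; apply: proper_card; apply/properP; split.
  apply/subsetP=> x; rewrite !inE => /andP[r'x ->]; rewrite andbT.
  have xz : x != z by apply: contraNneq r'x => ->; rewrite r'z.
  apply: contraNneq r'x => rx; rewrite permM rx tpermD // 1?eq_sym //.
  by apply: contraNneq xz => xrz; rewrite xrz; apply/eqP; apply: (@perm_inj _ r); rewrite -xrz rx.
by exists z; rewrite inE ?rz ?zX // r'z eqxx.
Qed.

End Minor.

Lemma porbits_restrict (T D : finType) (iota : D -> T) (p : {perm T}) (q : {perm D}) :
  injective iota -> (forall x, iota (q x) = p (iota x)) ->
  (forall y, y \notin codom iota -> p y = y) ->
  #|porbits p| <= #|porbits q| + #|[set y | y \notin codom iota]|.
Proof.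
move=> inj pq fixp.
have iter_pq i x : (p ^+ i)%g (iota x) = iota ((q ^+ i)%g x).
  by elim: i => [|i IHi]; rewrite ?perm1 // !expgSr !permM IHi pq.
have iter_fix i y : y \notin codom iota -> (p ^+ i)%g y = y.
  by move=> yD; elim: i => [|i IHi]; rewrite ?perm1 // expgSr permM IHi fixp.
set U := [set y | _].
apply: (@leq_trans #|((fun A : {set D} => iota @: A) @: porbits q) :|: (set1 @: U)|); last first.
  apply: leq_trans (leq_card_setU _ _) _.
  by apply: leq_add; exact: leq_imset_card.
apply: subset_leq_card; apply/subsetP=> _ /imsetP[y _ ->]; rewrite inE.
case: (boolP (y \in codom iota)) => [/codomP[x ->]|yD]; apply/orP; [left|right].
  apply/imsetP; exists (porbit q x); first exact: imset_f.
  apply/setP=> z; apply/porbitP/imsetP => [[i ->]|[w /porbitP[i ->] ->]].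
    by exists ((q ^+ i)%g x); rewrite ?mem_porbit ?iter_pq.
  by exists i; rewrite iter_pq.
apply/imsetP; exists y; rewrite ?inE //; apply/setP=> z; rewrite !inE.
apply/porbitP/eqP=> [[i ->]|->]; first exact: iter_fix.
by exists 0; rewrite perm1.
Qed.

(** Components enter the genus with the opposite sign, hence the inequality opposite to
    [porbits_restrict]. *)
Lemma ncomp_restrict (T D : finType) (iota : D -> T) (p p' : {perm T}) (q q' : {perm D}) :
  injective iota -> (forall x, iota (q x) = p (iota x)) ->
  (forall x, iota (q' x) = p' (iota x)) ->
  (forall y, y \notin codom iota -> p y = y) ->
  (forall y, y \notin codom iota -> p' y = y) ->
  ncomp q q' + #|[set y | y \notin codom iota]| <= ncomp p p'.
Proof.
move=> inj pq pq' fixp fixp'.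
have cl x y : conn p p' (iota x) y = [exists z, (y == iota z) && conn q q' x z].
  apply/idP/existsP => [xy|[z /andP[/eqP-> xz]]].
    pose P y := [exists z, (y == iota z) && conn q q' x z].
    suff: P y by move/existsP.
    apply: (conn_closed (P := P) _ _ xy).
    - move=> w /existsP[z /andP[/eqP-> xz]]; apply/existsP; exists (q z).
      by rewrite pq eqxx (conn_trans xz (conn_stepl _ _ _)).
    - move=> w /existsP[z /andP[/eqP-> xz]]; apply/existsP; exists (q' z).
      by rewrite pq' eqxx (conn_trans xz (conn_stepr _ _ _)).
    by apply/existsP; exists x; rewrite eqxx conn0.
  apply: (conn_closed (P := fun w => conn p p' (iota x) (iota w)) _ _ xz) (conn0 _ _ _).
    by move=> w H; apply: conn_trans H _; rewrite pq conn_stepl.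
  by move=> w H; apply: conn_trans H _; rewrite pq' conn_stepr.
have cl' y z : y \notin codom iota -> conn p p' y z = (z == y).
  move=> yD; apply/idP/eqP=> [yz|->]; last exact: conn0.
  by apply/eqP; apply: (conn_closed (P := pred1 y) _ _ yz) (eqxx _) => w /eqP->;
     rewrite /= ?fixp ?fixp'.
rewrite /ncomp /nclasses; set C := [set _ | x in D]; set U := [set y | _].
rewrite -(card_imset (mem C) (imset_inj inj)) -(card_imset (mem U) set1_inj).
rewrite -cardsUI (_ : _ :&: _ = set0).
  rewrite cards0 addn0; apply: subset_leq_card; apply/subsetP=> A; rewrite inE.
  case/orP=> [/imsetP[B /imsetP[x _ ->] ->]|/imsetP[y]].
    apply/imsetP; exists (iota x) => //; apply/setP=> y; rewrite inE cl.
    apply/imsetP/existsP=> [[z]|[z /andP[/eqP-> xz]]].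
      by rewrite inE => xz ->; exists z; rewrite eqxx.
    by exists z; rewrite ?inE.
  rewrite inE => yD ->; apply/imsetP; exists y => //.
  by apply/setP=> z; rewrite !inE cl'.
apply/setP=> A; rewrite !inE; apply/negP=> /andP[/imsetP[B _ ->] /imsetP[y]].
rewrite inE => yD BE; have: y \in iota @: B by rewrite BE set11.
by case/imsetP=> x _ yx; rewrite yx codom_f in yD.
Qed.

Definition darts (V : finType) (E : rel V) : finType := {p : V * V | E p.1 p.2}.

Record plane_map (V : finType) (E : rel V) (e r : {perm darts E}) : Prop := PlaneMap {
  plane_rev : forall d, val (e d) = ((val d).2, (val d).1);
  plane_src : forall d, (val (r d)).1 = (val d).1;
  plane_rot : forall d d', (val d).1 = (val d').1 -> d' \in porbit r d;
  plane_genus : genus0 e r }.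

Lemma plane_map_of_submap (T V : finType) (E : rel V) (delta : V -> V -> T)
    (lab : T -> option V) (e r : {perm T}) :
  symmetric E -> irreflexive E ->
  (forall u v, E u v -> lab (delta u v) = Some u) ->
  submap E delta lab e r ->
  exists e' r', @plane_map V E e' r'.
Proof.
move=> E_sym E_irr lab_delta sub0.
have [e1 [r1 [sub1 fixe]]] := submap_contract E_sym sub0.
have [r2 [gen labr fixr orb]] := submap_clean lab_delta E_sym E_irr sub1 fixe.
have [inv _ _ ed _] := sub1.
pose iota (d : darts E) : T := delta (val d).1 (val d).2.
have iotaX d : iota d \in [set d | [exists u, exists v, E u v && (d == delta u v)]].
  by apply: deltaX; exact: (valP d).
have inj : injective iota.
  move=> [[u v] /= uv] [[u' v'] /= uv']; rewrite /iota /= => eq_d; apply: val_inj => /=.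
  have := congr1 lab eq_d; rewrite !lab_delta // => -[->].
  by have := congr1 (fun d => lab (e1 d)) eq_d; rewrite !ed // !lab_delta 1?E_sym // => -[->].
have iotaP y : (y \in codom iota) = (y \in [set d | [exists u, exists v, E u v && (d == delta u v)]]).
  apply/codomP/idP=> [[d ->]|/XP[u [v [uv ->]]]] //.
  by exists (exist (fun p : V * V => is_true (E p.1 p.2)) (u, v) uv).
have fe (d : darts E) : E (val d).2 (val d).1 by rewrite E_sym; exact: (valP d).
pose e' (d : darts E) : darts E := exist (fun p : V * V => is_true (E p.1 p.2)) ((val d).2, (val d).1) (fe d).
have e'inj : injective e' by apply: (can_inj (g := e')) => d; apply: val_inj => /=; case: (val d).
have r2X y : y \in codom iota -> r2 y \in codom iota.
  rewrite !iotaP => yX; apply: contraT => ry; have := fixr _ ry.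
  by move/perm_inj => ryy; rewrite ryy yX in ry.
pose r' (d : darts E) : darts E := iinv (r2X _ (codom_f iota d)).
have iota_r' d : iota (r' d) = r2 (iota d) by rewrite /r' f_iinv.
have r'inj : injective r' by move=> d d' /(congr1 iota); rewrite !iota_r' => /perm_inj/inj.
have iota_e' d : iota (e' d) = e1 (iota d) by rewrite /iota /= ed //; exact: (valP d).
have Qe x : iota (perm e'inj x) = e1 (iota x) by rewrite permE.
have Qr x : iota (perm r'inj x) = r2 (iota x) by rewrite permE.
have Fe y : y \notin codom iota -> e1 y = y by rewrite iotaP; exact: fixe.
have Fr y : y \notin codom iota -> r2 y = y by rewrite iotaP; exact: fixr.
have labiota d : lab (iota d) = Some (val d).1 by apply: lab_delta; exact: (valP d).
exists (perm e'inj), (perm r'inj); split.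
- by move=> d; rewrite permE.
- by move=> d; have := labr (iota d); rewrite -Qr !labiota => -[].
- move=> d d' dd'.
  have: iota d' \in porbit r2 (iota d).
    by rewrite /iota -dd'; apply: orb; [exact: (valP d)|rewrite dd'; exact: (valP d')].
  case/porbitP=> i Hi; apply/porbitP; exists i; apply: inj; rewrite Hi.
  by elim: i {Hi} => [|i IHi]; rewrite ?perm1 // !expgSr !permM IHi Qr.
have H1 := porbits_restrict inj Qe Fe.
have H2 := porbits_restrict inj Qr Fr.
have H3 : #|porbits (e1 * r2)%g| <= #|porbits (perm e'inj * perm r'inj)%g| + #|[set y | y \notin codom iota]|.
  apply: porbits_restrict inj _ _ => [x|y yN]; first by rewrite !permM Qr Qe.
  by rewrite permM Fe // Fr.
have H4 := ncomp_restrict inj Qe Qr Fe Fr.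
have H5 : #|T| = #|darts E| + #|[set y | y \notin codom iota]|.
  rewrite -(cardC (mem (codom iota))) (card_codom inj); congr (_ + _).
  by apply: eq_card => y; rewrite !inE.
move: gen; rewrite /genus0 H5; move: H1 H2 H3 H4.
move: #|[set y | _]| (ncomp _ _) (ncomp _ _) => *; card_lia.
Qed.

(** An invariant function is constant on orbits, so it has at most as many values as there are
    orbits. *)
Lemma porbits_ge (T X : finType) (p : {perm T}) (phi : T -> X) :
  (forall x, phi (p x) = phi x) -> (forall y, exists x, phi x = y) ->
  #|X| <= #|porbits p|.
Proof.
move=> inv surj; pose g (A : {set T}) := omap phi [pick x in A].
have: [set Some y | y : X] \subset g @: porbits p.
  apply/subsetP=> _ /imsetP[y _ ->]; have [x <-] := surj y.
  apply/imsetP; exists (porbit p x); first exact: imset_f.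
  rewrite /g; case: pickP => [z /porbitP[i ->]|/(_ x)]; last by rewrite porbit_id.
  by congr Some; elim: i => [|i IHi]; rewrite ?perm1 // expgSr permM inv.
move/subset_leq_card; rewrite (@card_imset _ _ (@Some X)); last by move=> ? ? [].
by move/leq_trans; apply; exact: leq_imset_card.
Qed.

(** * Square grids *)

Section Grid.
Variable M : nat.
Let I := 'I_M.+1.
(* A dart is a cell, an axis (true: vertical) and a direction on that axis. *)
Definition gdart : finType := ((I * I) * (bool * bool))%type.

Definition okmv (i : I) (s : bool) := if s then i < M else 0 < i.
Definition mv (i : I) (s : bool) : I := inord (if s then i.+1 else i.-1).

Lemma mvE i s : okmv i s -> mv i s = (if s then i.+1 else i.-1) :> nat.
Proof. by case: s => /= H; rewrite inordK //; have := ltn_ord i; lia. Qed.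

Lemma ok_mv i s : okmv i s -> okmv (mv i s) (~~ s).
Proof. by move=> H; have := mvE H; case: s H => /= H ->; have := ltn_ord i; lia. Qed.

Lemma mvK i s : okmv i s -> mv (mv i s) (~~ s) = i.
Proof.
move=> H; apply: val_inj => /=; rewrite (mvE (ok_mv H)) (mvE H).
by case: s H => /= H; lia.
Qed.

(** Darts that would leave the grid are fixed, so the boundary carries half-edges. *)
Definition gopp (d : gdart) : gdart :=
  let: ((i, j), (ax, s)) := d in
  if ax then if okmv j s then ((i, mv j s), (ax, ~~ s)) else d
  else if okmv i s then ((mv i s, j), (ax, ~~ s)) else d.

Lemma goppK : involutive gopp.
Proof.
move=> [[i j] [[] s]] /=.
  by case: (boolP (okmv j s)) => H; rewrite /= ?(negPf H) // ok_mv // mvK // negbK.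
by case: (boolP (okmv i s)) => H; rewrite /= ?(negPf H) // ok_mv // mvK // negbK.
Qed.

Definition grot (d : gdart) : gdart :=
  let: (c, (ax, s)) := d in (c, if ax then (false, ~~ s) else (true, s)).
Definition grotV (d : gdart) : gdart :=
  let: (c, (ax, s)) := d in (c, if ax then (false, s) else (true, ~~ s)).

Lemma grotK : cancel grot grotV.
Proof. by move=> [c [[] s]] /=; rewrite ?negbK. Qed.

Definition ge := perm (inv_inj goppK).
Definition gr := perm (can_inj grotK).

Lemma geE d : ge d = gopp d. Proof. by rewrite permE. Qed.
Lemma grE d : gr d = grot d. Proof. by rewrite permE. Qed.

Definition vlab (d : gdart) : I * I := d.1.
Definition elab (d : gdart) : bool * 'I_M.+2 * I :=
  let: ((i, j), (ax, s)) := d in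
  if ax then (ax, inord (if s then j.+1 else j : nat), i)
  else (ax, inord (if s then i.+1 else i : nat), j).
(** Faces are named by the interior corners of cells; all corners on the boundary name the outer
    face, [None]. *)
Definition corner (a b : nat) : option ('I_M * 'I_M) :=
  if (insub a.-1, insub b.-1) is (Some x, Some y)
  then if (0 < a) && (0 < b) then Some (x, y) else None else None.
(** The corner on the right of the dart, with [i] growing rightwards and [j] upwards. *)
Definition flab (d : gdart) : option ('I_M * 'I_M) :=
  let: ((i, j), (ax, s)) := d in
  if ax then if s then corner i.+1 j.+1 else corner i j
  else if s then corner i.+1 j else corner i j.+1.

Lemma corner_out a b : ~~ ((0 < a <= M) && (0 < b <= M)) -> corner a b = None.
Proof.
rewrite /corner; case: insubP => [x /= Hx _|//]; case: insubP => [y /= Hy _|//].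
by case: ifP => //; lia.
Qed.

Lemma flab_inv d : flab ((ge * gr)%g d) = flab d.
Proof.
rewrite permM geE grE; case: d => [[i j] [ax s]].
have Hi := ltn_ord i; have Hj := ltn_ord j.
rewrite /gopp; case: ax; case: ifP => H.
- by have := mvE H; case: s H => /= H E; rewrite E ?prednK //.
- by case: s H => /= H; rewrite !corner_out //; lia.
- by have := mvE H; case: s H => /= H E; rewrite E ?prednK //.
- by case: s H => /= H; rewrite !corner_out //; lia.
Qed.

Lemma elab_inv d : elab (ge d) = elab d.
Proof.
rewrite geE; case: d => [[i j] [ax s]]; rewrite /gopp; case: ax; case: ifP => // H /=.
  by congr (_, _, _); apply: val_inj; rewrite (mvE H); case: s H => /= H; rewrite ?prednK.
by congr (_, _, _); apply: val_inj; rewrite (mvE H); case: s H => /= H; rewrite ?prednK.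
Qed.

Lemma gconn_cell d d' : d.1 = d'.1 -> conn ge gr d d'.
Proof.
have H c k : conn ge gr (c, (false, true)) (c, k).
  have H1 : conn ge gr (c, (false, true)) (c, (true, true)).
    by apply: (conn_trans (conn_stepr _ _ _)); rewrite grE /= conn0.
  have H2 : conn ge gr (c, (false, true)) (c, (false, false)).
    by apply: (conn_trans H1); apply: (conn_trans (conn_stepr _ _ _)); rewrite grE /= conn0.
  have H3 : conn ge gr (c, (false, true)) (c, (true, false)).
    by apply: (conn_trans H2); apply: (conn_trans (conn_stepr _ _ _)); rewrite grE /= conn0.
  by case: k => [[] []] //; exact: conn0.
case: d d' => [c k] [c' k'] /= <-.
by apply: conn_trans (H c k'); rewrite conn_sym.
Qed.

Lemma gconn d d' : conn ge gr d d'.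
Proof.
pose d0 : gdart := ((ord0, ord0), (false, true)).
suff H c : conn ge gr d0 (c, (false, true)).
  apply: (@conn_trans _ _ _ _ d0).
    by rewrite conn_sym; apply: conn_trans (H d.1) (gconn_cell _).
  by apply: conn_trans (H d'.1) (gconn_cell _).
case: c => i j.
have H1 (n : nat) (i' : I) : n = i' -> conn ge gr d0 ((i', ord0), (false, true)).
  elim: n i' => [|n IHn] i' Hn; first by rewrite (_ : i' = ord0) ?conn0 //; apply: val_inj.
  have ok : okmv i' false by rewrite /= -Hn.
  have ok' : okmv (mv i' false) true := ok_mv ok.
  have mk : mv (mv i' false) true = i' := mvK ok.
  have := IHn (mv i' false); rewrite (mvE ok) /= => /(_ _)/conn_trans; apply; first by rewrite -Hn.
  apply: (conn_trans (conn_stepl _ _ _)); rewrite geE /gopp ok' mk.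
  exact: gconn_cell.
have H2 (n : nat) (j' : I) : n = j' -> conn ge gr d0 ((i, j'), (true, true)).
  elim: n j' => [|n IHn] j' Hn.
    have -> : j' = ord0 by apply: val_inj.
    by apply: conn_trans (H1 i i erefl) (gconn_cell _).
  have ok : okmv j' false by rewrite /= -Hn.
  have ok' : okmv (mv j' false) true := ok_mv ok.
  have mk : mv (mv j' false) true = j' := mvK ok.
  have := IHn (mv j' false); rewrite (mvE ok) /= => /(_ _)/conn_trans; apply; first by rewrite -Hn.
  apply: (conn_trans (conn_stepl _ _ _)); rewrite geE /gopp ok' mk.
  exact: gconn_cell.
by apply: conn_trans (H2 j j erefl) (gconn_cell _).
Qed.

(** With n = M + 1 there are 4 n^2 darts, n^2 vertices, at least 2 n (n + 1) edges counting
    half-edges, and at least (n - 1)^2 + 1 faces. These orbits add up to 4 n^2 + 2, exactly what one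
    component requires, so lower bounds suffice. *)
Lemma grid_genus0 : genus0 ge gr.
Proof.
rewrite /genus0.
have -> : ncomp ge gr = 1.
  rewrite /ncomp /nclasses (_ : [set _ | _ in _] = [set setT]) ?cards1 //.
  apply/setP=> A; rewrite inE; apply/imsetP/eqP=> [[d _ ->]|->].
    by apply/setP=> d'; rewrite !inE gconn.
  exists ((ord0, ord0), (false, true)) => //.
  by apply/setP=> d'; rewrite !inE gconn.
have Hr : #|((I * I)%type : finType)| <= #|porbits gr|.
  apply: (@porbits_ge _ _ gr vlab) => [[c [ax s]]|c]; first by rewrite grE.
  by exists (c, (true, true)).
have He : #|((bool * 'I_M.+2 * I)%type : finType)| <= #|porbits ge|.
  apply: (porbits_ge elab_inv) => -[[ax a] b].
  pose s := 0 < (a : nat).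
  pose i : I := inord (if s then a.-1 else 0).
  have Ei : (i : nat) = a.-1 by rewrite inordK /s; have := ltn_ord a; case: (ltnP 0 a); lia.
  exists ((if ax then (b, i) else (i, b)), (ax, s)); rewrite /elab.
  case: ax; congr (_, _, _); apply: val_inj; rewrite Ei /s;
    case: (ltnP 0 a) => Ha; rewrite ?prednK //= inordK //; have := ltn_ord a; lia.
have Hf : #|(option ('I_M * 'I_M) : finType)| <= #|porbits (ge * gr)%g|.
  apply: (porbits_ge flab_inv) => -[[x y]|].
    have := ltn_ord x; have := ltn_ord y => Hy Hx.
    exists ((inord x, inord y), (true, true)); rewrite /flab /corner !inordK; try lia.
    by rewrite /= !valK.
  by exists ((ord0, ord0), (true, false)); rewrite /flab corner_out.
move: Hr He Hf; rewrite !card_prod card_option !card_prod card_bool !card_ord /I.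
by move: #|porbits ge| #|porbits gr| #|porbits (ge * gr)%g| => *; nia.
Qed.

End Grid.

(** * Minors from connected pieces joined by paths *)

Section Pieces.
Variables (X V : finType) (x0 : X) (E : rel V) (g : rel X).
Hypotheses (g_sym : symmetric g) (E_sym : symmetric E) (E_irr : irreflexive E).

Definition minor (b : X -> option V) :=
  (forall x y, b x = b y -> b x != None ->
     connect [rel x y | g x y && (b x == b y)] x y) /\
  (forall u v, E u v -> exists x y, [/\ g x y, b x = Some u & b y = Some v]).

(** [q] is the part walked since the last visit to [A]: it starts afresh at each return to [A], and
    the walk stops at the first point of [B]. *)
Lemma path_between (A B : {pred X}) p x q :
  (forall z, z \in A -> z \notin B) ->
  x \in A -> path g x q -> all (fun z => (z \notin A) && (z \notin B)) q ->
  path g (last x q) p -> last (last x q) p \in B ->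
  exists x' q' y, [/\ x' \in A, y \in B, path g x' (rcons q' y),
    all (fun z => (z \notin A) && (z \notin B)) q' & {subset q' <= q ++ p}].
Proof.
move=> AB; elim: p x q => [|y p IHp] x q xA xq outq /=.
  move=> _ lastB; case/lastP: q => [|q z] in xq outq lastB *.
    by have := AB _ xA; rewrite lastB.
  by move: outq; rewrite all_rcons; rewrite last_rcons in lastB; rewrite lastB andbF.
case/andP=> xy yp lastB.
have [yB|yB] := boolP (y \in B).
  exists x, q, y; split=> //; first by rewrite rcons_path xq.
  by move=> z zq; rewrite mem_cat zq.
have [yA|yA] := boolP (y \in A).
  have [x' [q' [y' [H1 H2 H3 H4 H5]]]] := IHp y [::] yA isT isT yp lastB.
  exists x', q', y'; split=> // z /H5 /= zp; by rewrite mem_cat inE zp !orbT.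
have [||||x' [q' [y' [H1 H2 H3 H4 H5]]]] := IHp x (rcons q y) xA.
- by rewrite rcons_path xq.
- by rewrite all_rcons yA yB.
- by rewrite last_rcons.
- by rewrite last_rcons.
by exists x', q', y'; split=> // z /H5; rewrite cat_rcons.
Qed.

Variables (K : V -> {set X}) (J : V -> V -> seq X).
Hypothesis K_conn : forall u x y, x \in K u -> y \in K u ->
  connect [rel x y | [&& g x y, x \in K u & y \in K u]] x y.
Hypothesis K_disj : forall u v x, x \in K u -> x \in K v -> u = v.
Hypothesis J_path : forall u v, E u v -> exists x p,
  [/\ J u v = x :: p, path g x p, x \in K u & last x p \in K v].
Hypothesis JK : forall u v w x, E u v -> x \in J u v -> x \in K w -> w = u \/ w = v.
Hypothesis JJ : forall u v u' v' x, E u v -> E u' v' -> x \in J u v -> x \in J u' v' ->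
  (u = u' /\ v = v') \/ (u = v' /\ v = u').

(** Of [J u v] only a stretch between [K u] and [K v] that avoids every [K w] in its interior is
    kept. Its interior is added to the branch set of the end of smaller rank, so each edge is used
    in one direction only. *)
Lemma minor_of_pieces : exists b, minor b.
Proof.
have seg uv : exists t : X * seq X * X, E uv.1 uv.2 ->
    [/\ t.1.1 \in K uv.1, t.2 \in K uv.2, path g t.1.1 (rcons t.1.2 t.2),
      forall z w, z \in t.1.2 -> z \notin K w & {subset t.1.2 <= J uv.1 uv.2}].
  case: uv => u v /=; case: (boolP (E u v)) => [uv|_]; last first.
    by exists (x0, [::], x0).
  have [x [p [Jp xp xK lK]]] := J_path uv.
  have KK z : z \in K u -> z \notin K v.
    move=> zu; apply/negP=> zv; have := K_disj zu zv => Euv.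
    by rewrite Euv E_irr in uv.
  have [x' [q' [y [H1 H2 H3 H4 H5]]]] := path_between (q := [::]) KK xK isT isT xp lK.
  exists (x', q', y) => _; split=> // z; last by move/H5 => /= zp; rewrite Jp inE zp orbT.
  move=> w zq; have /andP[zu zv] := allP H4 _ zq.
  have zJ : z \in J u v by rewrite Jp inE (H5 _ zq) orbT.
  apply/negP=> zw; case: (JK uv zJ zw) => Ew; by rewrite Ew ?(negPf zu) ?(negPf zv) in zw.
have {seg} [t tP] := choice seg.
pose B u : {set X} := K u :|: [set x | [exists v, [&& E u v, (enum_rank u < enum_rank v)%N & x \in (t (u, v)).1.2]]].
have B_disj u v x : x \in B u -> x \in B v -> u = v.
  rewrite !inE => /orP[xu|/existsP[u' /and3P[uu' ltu xu]]] /orP[xv|/existsP[v' /and3P[vv' ltv xv]]].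
  - exact: K_disj xu xv.
  - have [_ _ _ H _] := tP (v, v') vv'; by have := H _ u xv; rewrite xu.
  - have [_ _ _ H _] := tP (u, u') uu'; by have := H _ v xu; rewrite xv.
  have [_ _ _ _ H1] := tP (u, u') uu'; have [_ _ _ _ H2] := tP (v, v') vv'.
  case: (JJ uu' vv' (H1 _ xu) (H2 _ xv)) => [[]//|[Eu Ev]].
  by move: ltu ltv; rewrite Eu Ev; lia.
pose b x := [pick u | x \in B u].
have bE x u : (b x == Some u) = (x \in B u).
  rewrite /b; case: pickP => [v xv|/(_ u)->]; last by [].
  apply/eqP/idP=> [[<-]//|xu]; congr Some; exact: B_disj xv xu.
exists b.
have bsym : connect_sym [rel x y | g x y && (b x == b y)].
  by apply: sym_connect_sym => x y /=; rewrite g_sym eq_sym.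
have bK u x : x \in K u -> b x = Some u by move=> xu; apply/eqP; rewrite bE inE xu.
have bS u v x : E u v -> (enum_rank u < enum_rank v)%N -> x \in (t (u, v)).1.2 -> b x = Some u.
  by move=> uv lt xt; apply/eqP; rewrite bE !inE; apply/orP; right; apply/existsP; exists v; rewrite uv lt.
have connS u v : E u v -> (enum_rank u < enum_rank v)%N ->
    forall z, z \in (t (u, v)).1.1 :: (t (u, v)).1.2 ->
    connect [rel x y | g x y && (b x == b y)] (t (u, v)).1.1 z.
  move=> uv lt; have [xK _ pth _ _] := tP (u, v) uv.
  apply: path_connect; move: pth; rewrite rcons_path => /andP[pth _].
  have : all (fun z => b z == Some u) (t (u, v)).1.2.
    by apply/allP=> z zt; apply/eqP; apply: bS lt zt.
  have : b (t (u, v)).1.1 == Some u by apply/eqP; apply: bK.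
  elim: (t _).1.2 (t _).1.1 pth => //= y p IHp x /andP[xy yp] bx /andP[by_ bp].
  by rewrite xy (eqP bx) (eqP by_) eqxx IHp.
have connK u x y : x \in K u -> y \in K u -> connect [rel x y | g x y && (b x == b y)] x y.
  move=> xu yu; move: (K_conn xu yu); apply: connect_sub => {xu yu} {}x {}y /= /and3P[xy xu yu].
  by apply: connect1; rewrite /= xy (bK _ _ xu) (bK _ _ yu) eqxx.
have toK u x : x \in B u -> exists2 z, z \in K u & connect [rel x y | g x y && (b x == b y)] x z.
  rewrite !inE => /orP[xu|/existsP[v /and3P[uv lt xt]]]; first by exists x.
  have [xK _ _ _ _] := tP (u, v) uv; exists (t (u, v)).1.1 => //.
  by rewrite bsym; apply: connS; rewrite // inE xt orbT.
split=> [x y bxy bx|u v uv].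
  case Eu: (b x) bx => [u|//] _; have /eqP := Eu; rewrite bE => /toK[z zu xz].
  have /eqP : b y = Some u by rewrite -bxy.
  rewrite bE => /toK[z' z'u yz']; rewrite bsym in yz'.
  exact: connect_trans (connect_trans xz (connK _ _ _ zu z'u)) yz'.
wlog lt : u v uv / (enum_rank u < enum_rank v)%N.
  move=> H; case: (ltngtP (enum_rank u) (enum_rank v)) => lt; first exact: H.
    have vu : E v u by rewrite E_sym.
    have [x [y [xy xv yu]]] := H _ _ vu lt; exists y, x; split=> //; by rewrite g_sym.
  by move/val_inj/enum_rank_inj: lt => Euv; rewrite Euv E_irr in uv.
have [xK yK pth _ _] := tP (u, v) uv.
exists (last (t (u, v)).1.1 (t (u, v)).1.2), (t (u, v)).2; split; last exact: bK.
  by move: pth; rewrite rcons_path => /andP[].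
have : last (t (u, v)).1.1 (t (u, v)).1.2 \in (t (u, v)).1.1 :: (t (u, v)).1.2 by rewrite mem_last.
rewrite inE => /orP[/eqP->|]; [exact: bK | exact: bS].
Qed.

End Pieces.

Section GridMinor.
Variables (M : nat) (V : finType) (E : rel V).
Let I := 'I_M.+1.

Definition cadj (c c' : I * I) :=
  (c.1 == c'.1) && ((c.2.+1 == c'.2 :> nat) || (c'.2.+1 == c.2 :> nat)) ||
  (c.2 == c'.2) && ((c.1.+1 == c'.1 :> nat) || (c'.1.+1 == c.1 :> nat)).

Lemma cadj_sym : symmetric cadj.
Proof.
move=> c c'; rewrite /cadj (eq_sym c.1) (eq_sym c.2).
by rewrite [X in _ && X || _]orbC [X in _ || _ && X]orbC.
Qed.

Lemma cadj_dart c c' : cadj c c' -> exists2 k, (gopp (c, k)).1 = c' & (gopp (c, k)).1 != c.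
Proof.
have mvP (i i' : I) s : (if s then i.+1 == i' :> nat else i'.+1 == i) -> okmv i s /\ mv i s = i'.
  move=> H; have ok : okmv i s by case: s H => /= /eqP H; have := ltn_ord i'; lia.
  by split=> //; apply: ord_inj; rewrite (mvE ok); case: s H {ok} => /eqP H; lia.
case: c c' => [i j] [i' j'] /orP[] /= /andP[/eqP<- H].
  pose s := j.+1 == j' :> nat; have [|ok mvj] := mvP j j' s; first by rewrite /s; case: eqP H.
  exists (true, s); rewrite /= ok mvj //=; apply/eqP => -[Ej]; rewrite Ej in H; lia.
pose s := i.+1 == i' :> nat; have [|ok mvi] := mvP i i' s; first by rewrite /s; case: eqP H.
exists (false, s); rewrite /= ok mvi //=; apply/eqP => -[Ei]; rewrite Ei in H; lia.
Qed.

Lemma plane_map_of_minor (b : I * I -> option V) :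
  symmetric E -> irreflexive E -> minor E cadj b -> exists e r, @plane_map V E e r.
Proof.
move=> E_sym E_irr [bconn badj].
have ch uv : exists d : gdart M, E uv.1 uv.2 -> b d.1 = Some uv.1 /\ b (gopp d).1 = Some uv.2.
  case: uv => u v /=; case: (boolP (E u v)) => [/badj[c [c' [cc' bc bc']]]|_].
    by have [k Ek _] := cadj_dart cc'; exists (c, k); rewrite /= Ek.
  by exists ((ord0, ord0), (true, true)).
have {ch} [dl dlP] := choice ch.
(* The two darts of an edge must be reverses of each other, so only one direction is chosen freely;
   ranks decide which. *)
pose delta u v := if (enum_rank u < enum_rank v)%N then dl (u, v) else gopp (dl (v, u)).
have del_e u v : E u v -> ge M (delta u v) = delta v u.
  move=> uv; rewrite geE /delta; case: (ltngtP (enum_rank u) (enum_rank v)) => [||/val_inj/enum_rank_inj] //.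
    by rewrite goppK.
  by move=> Euv; rewrite Euv E_irr in uv.
have dlab u v : E u v -> b (delta u v).1 = Some u.
  move=> uv; rewrite /delta; case: ifP => _; first by case: (dlP (u, v) uv).
  have vu : E v u by rewrite E_sym.
  by case: (dlP (v, u) vu).
apply: (@plane_map_of_submap _ _ _ delta (fun d => b d.1) (ge M) (gr M)) => //.
split=> //.
- by move=> d; rewrite !geE goppK.
- exact: grid_genus0.
- by move=> [c [ax s]]; rewrite grE.
- have same (d d' : gdart M) : d.1 = d'.1 ->
      connect (labstep (fun d => b d.1) (ge M) (gr M)) d d'.
    move=> dd'; apply: labstep_porbit; case: d d' dd' => [c k] [c' k'] /= <-.
    have P i : (gr M ^+ i)%g (c, k) = iter i (@grot M) (c, k).
      by elim: i => [|i IHi]; rewrite ?perm1 // expgSr permM IHi grE.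
    apply/porbitP; case: k k' P => [[] []] [[] []] P;
      by [exists 0; rewrite P|exists 1; rewrite P|exists 2; rewrite P|exists 3; rewrite P].
  move=> d d' bdd' bd; have /connectP[p] := bconn _ _ bdd' bd.
  have [n lt] := ubnP (size p); elim: n p d d' {bdd' bd} lt => // n IHn [|c p] d d' lt /=.
    by move=> _ /esym; exact: same.
  case/andP=> /andP[dc bdc] cp lastc.
  have [k Ek _] := cadj_dart dc.
  have : connect (labstep (fun d => b d.1) (ge M) (gr M)) (gopp (d.1, k)) d'.
    by apply: (IHn p) => //; rewrite Ek.
  apply: connect_trans; apply: (@connect_trans _ _ (d.1, k)); first exact: same.
  by apply: connect1; rewrite /labstep /= geE Ek eqxx bdc orbT.
Qed.

End GridMinor.

(** * Precoloured cliques and minimal counterexamples *)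

Section Coloring.
Variables (V C : finType) (E : rel V) (L : V -> {set C}) (M : V -> V -> rel C).
Hypotheses (E_sym : symmetric E) (E_irr : irreflexive E).
Hypothesis L3 : forall v, #|L v| = 3.
Hypothesis M_sym : forall u v c d, E u v -> M u v c d = M v u d c.
Hypothesis M_fun : forall u v c d d', E u v -> M u v c d -> M u v c d' -> d = d'.

Definition coloring (A : {set V}) (phi : V -> C) : Prop :=
  (forall x, x \in A -> phi x \in L x) /\
  (forall x y, x \in A -> y \in A -> E x y -> ~~ M x y (phi x) (phi y)).

Definition extendable (A K : {set V}) : Prop :=
  forall phi, coloring K phi -> exists2 psi, coloring A psi & {in K, psi =1 phi}.

Definition small_clique (K : {set V}) : Prop :=
  [/\ 0 < #|K|, #|K| <= 2 & forall x y, x \in K -> y \in K -> x != y -> E x y].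

Lemma coloring_sub (A B : {set V}) phi : A \subset B -> coloring B phi -> coloring A phi.
Proof. by move=> /subsetP sAB [H1 H2]; split=> [x /sAB|x y /sAB xB /sAB yB]; auto. Qed.

Definition blocked (Y : {set V}) (psi : V -> C) x : {set C} :=
  [set c | [exists y in Y, E x y && M x y c (psi y)]].

(** Since [M x y] is a matching, each coloured neighbour [y] forbids at most one colour of [x]. *)
Lemma card_blocked Y psi x : #|blocked Y psi x| <= #|[set y in Y | E x y]|.
Proof.
pose g y := [pick c | M x y c (psi y)].
have : Some @: blocked Y psi x \subset g @: [set y in Y | E x y].
  apply/subsetP=> _ /imsetP[c + ->]; rewrite inE => /existsP[y /and3P[yY xy Mc]].
  apply/imsetP; exists y; first by rewrite inE yY.
  rewrite /g; case: pickP => [c' Mc'|/(_ c)]; last by rewrite Mc.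
  by congr Some; move: Mc Mc'; rewrite !(M_sym _ _ xy); apply: M_fun; rewrite E_sym.
move/subset_leq_card; rewrite card_imset; last by move=> ? ? [].
by move/leq_trans; apply; exact: leq_imset_card.
Qed.

Lemma color_one (A : {set V}) psi x c : x \notin A -> coloring A psi -> c \in L x :\: blocked A psi x ->
  coloring (x |: A) (fun y => if y == x then c else psi y).
Proof.
move=> xA [P1 P2]; rewrite !inE => /andP[nb cL].
have ok y : y \in A -> E x y -> ~~ M x y c (psi y).
  by move=> yA xy; apply: contra nb => H; apply/existsP; exists y; rewrite yA xy.
split=> [y|y z]; rewrite !inE.
  by case: eqP => [->|] //= _; apply: P1.
case: (eqVneq y x) => [->|yx] /= yA; case: (eqVneq z x) => [->|zx] //= zA xy.
- by rewrite E_irr in xy.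
- exact: ok.
- by rewrite M_sym // ok // E_sym.
- exact: P2.
Qed.

(** The vertex found for the whole of [X] is coloured last: its neighbours in [X] then forbid fewer
    colours than [B] has left to it. *)
Lemma greedy_coloring (B X : {set V}) psi : [disjoint B & X] -> coloring B psi ->
  (forall S : {set V}, S \subset X -> S != set0 -> exists2 x, x \in S &
     #|[set y in S | E x y]| < #|L x :\: blocked B psi x|) ->
  exists2 phi, coloring (B :|: X) phi & {in B, phi =1 psi}.
Proof.
have [n] := ubnP #|X|; elim: n X => // n IHn X ltX dis colB deg.
have [->|Xn0] := eqVneq X set0; first by exists psi; rewrite ?setU0.
have [x xX degx] := deg X (subxx _) Xn0.
have xB : x \notin B by rewrite (disjointFl dis xX).
have [|||phi colphi eqphi] := IHn (X :\ x) _ _ colB.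
- by rewrite (cardsD1 x X) xX in ltX.
- by apply: disjointWr dis; exact: subD1set.
- by move=> S sS; apply: deg; apply: subset_trans sS (subD1set _ _).
have xBX : x \notin B :|: X :\ x by rewrite !inE eqxx (negPf xB).
have : 0 < #|L x :\: blocked (B :|: X :\ x) phi x|.
  have sub : L x :\: blocked B psi x :\: blocked (X :\ x) phi x \subset
      L x :\: blocked (B :|: X :\ x) phi x.
    apply/subsetP=> c; rewrite !inE => /and3P[n1 n2 ->]; rewrite andbT.
    apply/existsP=> -[y /and3P[]]; rewrite !inE => /orP[yB|yX] xy Mc.
      by case/existsP: n2; exists y; rewrite yB xy -eqphi.
    by case/existsP: n1; exists y; rewrite !inE yX xy.
  apply: leq_trans (subset_leq_card sub).
  rewrite cardsD; have := card_blocked (X :\ x) phi x.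
  have : #|[set y in X :\ x | E x y]| <= #|[set y in X | E x y]|.
    by apply/subset_leq_card/subsetP=> y; rewrite !inE => /andP[/andP[_ ->] ->].
  have : #|(L x :\: blocked B psi x) :&: blocked (X :\ x) phi x| <= #|blocked (X :\ x) phi x|.
    by apply/subset_leq_card/subsetIr.
  by move: degx; clear; lia.
case/card_gt0P=> c cx.
exists (fun y => if y == x then c else phi y) => [|y yB].
  have -> : B :|: X = x |: (B :|: X :\ x) by rewrite setUCA setD1K.
  exact: color_one.
by case: eqP => [yx|_]; [rewrite -yx yB in xB | exact: eqphi].
Qed.

Variables (A K : {set V}).
Hypothesis minA : forall A' K' : {set V}, A' \proper A -> small_clique K' ->
  K' \subset A' -> extendable A' K'.
Hypotheses (cliqueK : small_clique K) (KA : K \subset A) (notext : ~ extendable A K).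

Definition restr_edge : rel V := fun x y => [&& x \in A, y \in A & E x y].
Local Notation E' := restr_edge.
Local Notation nb x := [set y | E' x y].

Lemma restr_edge_sym : symmetric E'.
Proof. by move=> x y; rewrite /E' E_sym andbCA. Qed.

Lemma restr_edge_irr : irreflexive E'.
Proof. by move=> x; rewrite /E' E_irr !andbF. Qed.

Lemma critical_proper : exists2 x, x \in A & x \notin K.
Proof.
apply/subsetPn/negP=> AK; apply: notext => phi col; exists phi => //.
exact: coloring_sub col.
Qed.

Lemma critical_deg x : x \in A -> x \notin K -> 3 <= #|nb x|.
Proof.
move=> xA xK; rewrite leqNgt; apply/negP=> lt3; apply: notext => phi colphi.
have sK : K \subset A :\ x by rewrite subsetD1 KA.
have [psi colpsi eqpsi] := minA (properD1 xA) cliqueK sK colphi.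
have : 0 < #|L x :\: blocked (A :\ x) psi x|.
  rewrite cardsD L3; have := card_blocked (A :\ x) psi x.
  have : #|[set y in A :\ x | E x y]| <= #|nb x|.
    by apply/subset_leq_card/subsetP=> y; rewrite !inE /E' => /andP[/andP[_ ->] ->]; rewrite xA.
  have : #|L x :&: blocked (A :\ x) psi x| <= #|blocked (A :\ x) psi x|.
    by apply/subset_leq_card/subsetIr.
  by move: lt3; clear; lia.
case/card_gt0P=> c cx.
exists (fun y => if y == x then c else psi y).
  by rewrite -(setD1K xA); apply: color_one => //; rewrite !inE eqxx.
by move=> y yK; case: eqP => [yx|_]; [rewrite -yx yK in xK|exact: eqpsi].
Qed.

(** The colouring is extended from [K] to [A1] and then, by minimality again, from [A1 :&: A2] to
    [A2]. *)
Lemma critical_sep_clique (A1 A2 : {set V}) : A1 :|: A2 = A -> A1 != A -> A2 != A ->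
  small_clique (A1 :&: A2) -> K \subset A1 ->
  (forall x y, E' x y -> x \notin A2 -> y \notin A1 -> False) -> False.
Proof.
move=> A12 nA1 nA2 cl KA1 sep; apply: notext => phi colphi.
have s1 : A1 \subset A by rewrite -A12 subsetUl.
have s2 : A2 \subset A by rewrite -A12 subsetUr.
have p1 : A1 \proper A by rewrite properEneq nA1.
have p2 : A2 \proper A by rewrite properEneq nA2.
have [psi1 col1 eq1] := minA p1 cliqueK KA1 colphi.
have [||psi2 col2 eq2] := minA p2 cl _ (phi := psi1).
- exact: subsetIr.
- by apply: coloring_sub col1; exact: subsetIl.
have eqA2 y : y \in A1 -> y \in A2 -> psi1 y = psi2 y.
  by move=> y1 y2; rewrite eq2 // inE y1.
exists (fun y => if y \in A1 then psi1 y else psi2 y).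
  case: col1 col2 => L1 M1 [L2 M2]; split=> [x|x y]; rewrite -A12 !inE.
    by case: (boolP (x \in A1)) => /= [/L1|_ /L2].
  case: (boolP (x \in A1)) => /= [x1|x1] x2; case: (boolP (y \in A1)) => /= [y1|y1] y2 xy.
  - exact: M1.
  - case: (boolP (x \in A2)) => x2'; first by rewrite eqA2 //; apply: M2.
    by case: (sep x y) => //; rewrite /E' (subsetP s1 _ x1) (subsetP s2 _ y2).
  - case: (boolP (y \in A2)) => y2'; first by rewrite eqA2 //; apply: M2.
    by case: (sep y x) => //; rewrite /E' (subsetP s1 _ y1) (subsetP s2 _ x2) E_sym.
  - exact: M2.
by move=> y yK; rewrite (subsetP KA1) // eq1.
Qed.

(** An empty intersection is made into a single vertex by adding a vertex [x] of [A2] to [A1]. This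
    fails only if [A2] is just [x], which would then be isolated, against [critical_deg]. *)
Lemma critical_sep_aux (A1 A2 : {set V}) : A1 :|: A2 = A -> A1 != A -> A2 != A ->
  (A1 :&: A2 = set0 \/ small_clique (A1 :&: A2)) -> K \subset A1 ->
  (forall x y, E' x y -> x \notin A2 -> y \notin A1 -> False) -> False.
Proof.
move=> A12 nA1 nA2 [I0|cl] KA1 sep; last exact: (critical_sep_clique A12).
have [x xA2] : exists x, x \in A2.
  by apply/set0Pn; apply: contraNneq nA1 => A20; rewrite -A12 A20 setU0.
have xA : x \in A by rewrite -A12 inE xA2 orbT.
have x1 : x \notin A1 by apply/negP=> x1; have /setP/(_ x) := I0; rewrite !inE x1 xA2.
have neqA : x |: A1 != A \/ A2 = [set x].
  case: (eqVneq (x |: A1) A) => [EA|]; [right|by left].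
  apply/setP=> y; rewrite inE; apply/idP/eqP => [y2|->] //.
  have : y \in x |: A1 by rewrite EA -A12 inE y2 orbT.
  by rewrite !inE => /orP[/eqP|y1] //; have /setP/(_ y) := I0; rewrite !inE y1 y2.
have xK : x \notin K by apply: contra x1; exact: (subsetP KA1).
case: neqA => [neqA|A2x]; last first.
  have := critical_deg xA xK; rewrite (eq_card0 _) // => y; rewrite !inE.
  apply/negP=> xy; apply: (sep y x); rewrite 1?restr_edge_sym // A2x inE.
  by apply: contraTneq xy => ->; rewrite restr_edge_irr.
apply: (@critical_sep_clique (x |: A1) A2) => //.
- by rewrite -setUA A12; apply/setUidPr; rewrite sub1set.
- have -> : (x |: A1) :&: A2 = [set x].
    by rewrite setIUl I0 setU0; apply/setIidPl; rewrite sub1set.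
  by split; rewrite ?cards1 // => y z; rewrite !inE => /eqP-> /eqP->; rewrite eqxx.
- by apply: subset_trans KA1 (subsetUr _ _).
- by move=> y z yz y2; rewrite !inE negb_or => /andP[_]; apply: sep yz y2.
Qed.

(** No edge crosses the separation, so the clique [K] lies within one of the sides. *)
Lemma critical_sep (A1 A2 : {set V}) : A1 :|: A2 = A -> A1 != A -> A2 != A ->
  (A1 :&: A2 = set0 \/ small_clique (A1 :&: A2)) ->
  (forall x y, E' x y -> x \notin A2 -> y \notin A1 -> False) -> False.
Proof.
move=> A12 nA1 nA2 cl sep; have [K1|/subsetPn[x xK x1]] := boolP (K \subset A1).
  exact: critical_sep_aux A12 _ _ cl K1 sep.
apply: (@critical_sep_aux A2 A1); rewrite 1?setUC 1?[A2 :&: A1]setIC //; last first.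
  by move=> y z yz y1 z2; apply: (sep z y); rewrite // restr_edge_sym.
apply/subsetP=> y yK; apply: contraT => y2.
have xA := subsetP KA _ xK; have yA := subsetP KA _ yK.
have x2 : x \in A2 by move: xA; rewrite -A12 inE (negPf x1).
case: cliqueK => _ _ /(_ y x yK xK) yx.
case: (sep y x) => //; rewrite /E' xA yA yx //.
by apply: contraNneq y2 => ->.
Qed.

(* Each colour of q' excludes one of the three colours of q. If q' has m neighbours
   in H :\ q, it keeps m + 1 <= 2 colours once A :\: H is coloured, so q can be given
   a colour sparing both; then q' can be coloured last. The last hypothesis is the
   degeneracy needed to colour the rest of H greedily: any set of vertices of H
   containing neither q nor q' has a member with at most two neighbours in it or
   already coloured. *)
Lemma critical_trick (H : {set V}) q q' : H \subset A -> [disjoint H & K] ->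
  q \in H -> q' \in H -> E' q q' -> (forall y, E' q y -> y \in H) ->
  #|nb q'| <= 3 -> (exists2 y, E' q' y & y \notin H) ->
  (forall Q : pred V, Q q' ->
     (forall x, x \in H -> x != q ->
        #|[set y in nb x | [|| y \notin H, y == q | ~~ Q y]]| <= 2 -> Q x) ->
     forall x, x \in H -> x != q -> Q x) -> False.
Proof.
move=> sHA disHK qH q'H qq' NqH degq' [z q'z zH] closure.
have E'E x y : E' x y -> E x y by case/and3P.
have HA x : x \in H -> x \in A by apply: (subsetP sHA).
have qA := HA _ qH; have q'A := HA _ q'H.
pose B := A :\: H.
have KB : K \subset B by rewrite subsetD KA disjoint_sym.
have BpA : B \proper A.
  by apply/properP; split; [exact: subsetDl | exists q; rewrite // inE qH].
apply: notext => phi colphi.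
have [psi colpsi eqpsi] := minA BpA cliqueK KB colphi.
pose avail := L q' :\: blocked B psi q'.
pose m := #|[set y in nb q' | (y \in H) && (y != q)]|.
have q'q : E' q' q by rewrite restr_edge_sym.
have Nout : #|[set y in B | E q' y]| = #|[set y in nb q' | y \notin H]|.
  apply: eq_card => y; rewrite !inE /E' q'A /=.
  by case: (y \in A); case: (y \in H); case: (E q' y).
have Nsplit : #|nb q'| = (m + #|[set y in nb q' | y \notin H]|).+1.
  rewrite (cardsD1 q (nb q')) inE q'q add1n; congr _.+1.
  rewrite -(cardsID H) /m; congr (_ + _); apply: eq_card => y; rewrite !inE.
    by case: (y \in H); case: (y == q); case: (E' q' y).
  by case: (y =P q) => [->|_]; rewrite ?qH ?andbF //= andbC.
have out_gt0 : 0 < #|[set y in nb q' | y \notin H]|.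
  by apply/card_gt0P; exists z; rewrite !inE q'z.
have cardavail : m.+1 <= #|avail|.
  rewrite cardsD L3; have := card_blocked B psi q'; rewrite Nout.
  have : #|L q' :&: blocked B psi q'| <= #|blocked B psi q'| by apply/subset_leq_card/subsetIr.
  by move: Nsplit out_gt0 degq'; clear; lia.
(* [q'] must end up with more colours than its [m] uncoloured neighbours, so [m + 1] of them are
   protected. The neighbour [z] outside [H] gives [m <= 1]: at most two of the three colours of [q]
   are then ruled out. *)
pose P0 := [set c in take m.+1 (enum avail)].
have P0card : #|P0| = m.+1.
  have un : uniq (take m.+1 (enum avail)) by rewrite take_uniq ?enum_uniq.
  rewrite cardsE (card_uniqP un).
  by rewrite size_takel // -cardE.
have P0avail c : c \in P0 -> c \in avail.
  by rewrite inE => /mem_take; rewrite mem_enum.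
have [c cLq cP0] : exists2 c, c \in L q & forall p, p \in P0 -> ~~ M q q' c p.
  pose bad := [set c | [exists p in P0, M q q' c p]].
  have : #|bad| <= #|P0|.
    pose g p := [pick c | M q q' c p].
    have : Some @: bad \subset g @: P0.
      apply/subsetP=> _ /imsetP[c + ->]; rewrite inE => /existsP[p /andP[pP Mc]].
      apply/imsetP; exists p => //; rewrite /g; case: pickP => [c' Mc'|/(_ c)]; last by rewrite Mc.
      by congr Some; move: Mc Mc'; rewrite !(M_sym _ _ (E'E _ _ qq')); apply: M_fun; exact: E'E.
    move/subset_leq_card; rewrite card_imset; last by move=> ? ? [].
    by move/leq_trans; apply; exact: leq_imset_card.
  rewrite P0card => badle.
  have : 0 < #|L q :\: bad|.
    rewrite cardsD L3; have : #|L q :&: bad| <= #|bad| by apply/subset_leq_card/subsetIr.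
    by move: Nsplit out_gt0 degq' badle; clear; lia.
  case/card_gt0P=> c; rewrite !inE => /andP[nb cL]; exists c => // p pP.
  by apply: contra nb => H1; apply/existsP; exists p; rewrite pP.
have qB : q \notin B by rewrite inE qH.
(* The neighbours of [q] all lie in [H], hence are still uncoloured. *)
have colq : coloring (q |: B) (fun y => if y == q then c else psi y).
  apply: color_one => //; rewrite inE cLq andbT inE; apply/existsP=> -[y /and3P[yB qy _]].
  move: yB; rewrite inE => /andP[/negP yH yA]; apply: yH; apply: NqH.
  by rewrite /E' qA yA qy.
have qAH : q |: B :|: H :\ q = A.
  by rewrite setUAC setD1K // -[RHS](setID A H) (setIidPr sHA).
have [||rho colrho eqrho] := greedy_coloring _ colq (X := H :\ q).
- rewrite disjoints_subset; apply/subsetP=> y; rewrite !inE negb_and negbK.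
  by case: eqP => //= _ /andP[/negPf->].
- move=> S sS Sn0; pose psi' y := if y == q then c else psi y; rewrite -/psi'.
  have SH y : y \in S -> (y \in H) && (y != q).
    by move/(subsetP sS); rewrite !inE andbC.
  have [q'S|q'S] := boolP (q' \in S).
    exists q' => //; apply: (@leq_trans m.+1).
      rewrite ltnS; apply/subset_leq_card/subsetP=> y; rewrite !inE => /andP[/SH yH q'y].
      by rewrite yH /E' q'A q'y HA //; case/andP: yH.
    rewrite -P0card; apply/subset_leq_card/subsetP=> p pP.
    have := P0avail _ pP; rewrite !inE => /andP[nb ->]; rewrite andbT.
    apply: contra nb => /existsP[y /and3P[]]; rewrite inE /psi' => yqB q'y.
    case: (eqVneq y q) yqB => [->|yq] /=.
      by move=> _; rewrite (M_sym _ _ (E'E _ _ q'q)) (negPf (cP0 _ pP)).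
    by rewrite !inE (negPf yq) /= => yB Mp; apply/existsP; exists y; rewrite !inE yB q'y.
  have /existsP[x /andP[xS dx]] :
      [exists x, (x \in S) && (#|[set y in nb x | [|| y \notin H, y == q | y \in S]]| <= 2)].
    apply: contraR Sn0; rewrite negb_exists => /forallP noS.
    apply/eqP/setP=> x; rewrite !inE; apply/negbTE/negP=> xS.
    have /andP[xH xq] := SH _ xS.
    suff : x \notin S by rewrite xS.
    (* If no vertex of [S] qualified, the complement of [S] would be closed under the rule, and [S]
       would be empty. *)
    apply: (closure (fun y => y \notin S)) => // y yH yq.
    under eq_finset do rewrite negbK.
    by move=> le2; have := noS y; rewrite le2 andbT.
  exists x => //; have /andP[xH xq] := SH _ xS; have xA := HA _ xH.
  rewrite cardsD L3; have := card_blocked (q |: B) psi' x.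
  have : #|L x :&: blocked (q |: B) psi' x| <= #|blocked (q |: B) psi' x|.
    exact/subset_leq_card/subsetIr.
  suff : #|[set y in q |: B | E x y]| + #|[set y in S | E x y]| <= 2 by clear; lia.
  apply: leq_trans dx; rewrite -cardsUI [X in _ + X](_ : _ = 0) ?addn0.
    apply/subset_leq_card/subsetP=> y; rewrite !inE /E' xA.
    case: (boolP (y \in S)) => [/SH /andP[yH yq]|yS].
      by rewrite yH (negPf yq) /= ?orbT ?andbT HA.
    case: (eqVneq y q) => [->|yq] /=; first by rewrite qA orbT andbT orbF.
    by rewrite orbF; case/andP=> /andP[-> ->] ->.
  apply/eqP; rewrite cards_eq0; apply/eqP/setP=> y; rewrite !inE.
  case: (boolP (y \in S)) => [/SH /andP[-> yq]|]; rewrite ?andbF //.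
  by rewrite (negPf yq).
rewrite qAH in colrho; exists rho => // y yK.
have yB := subsetP KB _ yK; rewrite eqrho; last by rewrite in_setU yB orbT.
by case: eqP => [yq|_]; [rewrite -yq yB in qB | rewrite eqpsi].
Qed.

End Coloring.

Definition src (V : finType) (E : rel V) (d : darts E) : V := (val d).1.
Definition tgt (V : finType) (E : rel V) (d : darts E) : V := (val d).2.

Lemma sum_porbits (T : finType) (p : {perm T}) (g : T -> nat) :
  \sum_x g x = \sum_(A in porbits p) \sum_(x in A) g x.
Proof.
rewrite (partition_big (porbit p) (fun A => A \in porbits p)) => [|x _] /=.
  apply: eq_bigr => _ /imsetP[z _ ->]; apply: eq_bigl => x.
  by rewrite eq_porbit_mem.
exact: imset_f.
Qed.

(** * Plane maps of minimal counterexamples *)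

Section PlaneMap.
Local Open Scope group_scope.
Variables (V : finType) (E : rel V) (e r : {perm darts E}).
Hypotheses (E_sym : symmetric E) (E_irr : irreflexive E) (Hm : plane_map e r).
Local Notation D := (darts E).
Implicit Types d x y : D.

Lemma dart_eq d d' : src d = src d' -> tgt d = tgt d' -> d = d'.
Proof.
case: d d' => [[u v] /= uv] [[u' v'] /= uv']; rewrite /src /tgt /= => ? ?.
by apply: val_inj => /=; congr pair.
Qed.

Lemma dart_edge d : E (src d) (tgt d).
Proof. exact: (valP d). Qed.

Lemma edge_dart u v : E u v -> exists d, src d = u /\ tgt d = v.
Proof. by move=> uv; exists (exist (fun p : V * V => is_true (E p.1 p.2)) (u, v) uv). Qed.

Lemma src_e d : src (e d) = tgt d.
Proof. by rewrite /src (plane_rev Hm). Qed.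
Lemma tgt_e d : tgt (e d) = src d.
Proof. by rewrite /tgt (plane_rev Hm). Qed.
Lemma eK d : e (e d) = d.
Proof. by apply: dart_eq; rewrite ?src_e ?tgt_e ?src_e. Qed.
Lemma src_r d : src (r d) = src d.
Proof. exact: (plane_src Hm). Qed.

Lemma porbit_rP d d' : (d' \in porbit r d) = (src d == src d').
Proof.
apply/idP/eqP => [/porbitP[i ->]|]; last exact: (plane_rot Hm).
by elim: i => [|i IHi]; rewrite ?perm1 // expgSr permM src_r.
Qed.

Lemma faceE d : (e * r) d = r (e d).
Proof. exact: permM. Qed.
Lemma src_f d : src ((e * r) d) = tgt d.
Proof. by rewrite faceE src_r src_e. Qed.
Lemma r_face d : r d = (e * r) (e d).
Proof. by rewrite faceE eK. Qed.

Lemma src_neq_tgt d : src d != tgt d.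
Proof. by apply: contraTneq (dart_edge d) => ->; rewrite E_irr. Qed.

Lemma card_porbit_r d : #|porbit r d| = #|[set y | E (src d) y]|.
Proof.
have inj : {in porbit r d &, injective (@tgt V E)}.
  move=> x y; rewrite !porbit_rP => /eqP dx /eqP dy; apply: dart_eq.
  by rewrite -dx -dy.
rewrite -(card_in_imset inj); apply: eq_card => y; rewrite !inE.
apply/imsetP/idP => [[x]|/edge_dart[x [Ex <-]]].
  by rewrite porbit_rP => /eqP-> ->; exact: dart_edge.
by exists x; rewrite // porbit_rP Ex.
Qed.

Lemma card_porbits_e : (#|porbits e|).*2 = #|D|.
Proof.
have Epe d : porbit e d = [set d; e d].
  apply/setP=> x; rewrite !inE; apply/porbitP/orP => [[i ->]|[/eqP->|/eqP->]].
  - elim: i => [|i [|] /eqP IHi]; first by rewrite perm1 eqxx; left.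
      by rewrite expgSr permM IHi; right.
    by rewrite expgSr permM IHi eK; left.
  - by exists 0%N; rewrite perm1.
  - by exists 1%N; rewrite expg1.
have card2 A : A \in porbits e -> #|A| = 2%N.
  case/imsetP=> d _ ->; rewrite Epe cards2; congr _.+1; case: eqP => // /(congr1 (@src V E)).
  by rewrite src_e => /eqP; rewrite (negPf (src_neq_tgt d)).
rewrite -[#|D|]sum1_card (sum_porbits e) -sum1_card -mul2n big_distrr /=.
by apply: eq_bigr => A /card2 A2; rewrite sum1_card A2.
Qed.

Definition small_set (Z : {set V}) :=
  #|Z| <= 2 /\ forall u v, u \in Z -> v \in Z -> u != v -> E u v.

(** Separations in terms of darts: [O] and its complement are the edges of the two sides, and [Z]
    contains the vertices shared by them. *)
Hypothesis sep : forall (O : {set D}) (Z : {set V}), small_set Z ->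
  (forall d, d \in O -> e d \in O) ->
  (forall d d', d \in O -> d' \notin O -> src d = src d' -> src d \in Z) ->
  (exists2 d, d \in O & src d \notin Z) -> (exists2 d, d \notin O & src d \notin Z) -> False.
Hypothesis big : exists d, 3 <= #|porbit r d|.
Local Notation f := (e * r).

Lemma small_set1 v : small_set [set v].
Proof. by split=> [|x y]; rewrite ?cards1 // !inE => /eqP-> /eqP->; rewrite eqxx. Qed.

(** The only edge at a vertex of degree one would be separated from the rest by its other end. *)
Lemma critical_r_neq d : r d != d.
Proof.
apply/negP=> /eqP rd.
have Od d' : src d = src d' -> d' = d.
  move/eqP; rewrite -porbit_rP => /porbitP[i ->].
  by elim: i => [|i IHi]; rewrite ?perm1 // expgSr permM IHi.
have [d1 big1] := big.
apply: (sep (small_set1 (tgt d)) (O := [set d; e d])).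
- by move=> x; rewrite !inE => /orP[]/eqP->; rewrite ?eK eqxx ?orbT.
- move=> x x'; rewrite !inE => /orP[]/eqP-> xO sx; last by rewrite src_e.
  by rewrite (Od _ sx) eqxx in xO.
- by exists d; rewrite !inE ?eqxx // src_neq_tgt.
have [x xO] : exists x, x \notin [set d; e d].
  suff : exists2 x, x \in porbit r d1 & x \notin [set d; e d] by case=> x _; exists x.
  apply/subsetPn; apply: contraL big1 => /subset_leq_card; rewrite cards2 -ltnNge.
  by case: eqP => _ /=; lia.
have [sx|sx] := eqVneq (src x) (tgt d); last by exists x; rewrite // inE.
exists (e x); last by rewrite inE src_e -sx eq_sym src_neq_tgt.
by move: xO; rewrite !inE !negb_or => /andP[n1 n2]; rewrite !(canF_eq eK) eK n1 n2.
Qed.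

(** If a face visits a vertex twice, splitting the vertex there splits the face too. Since the genus
    cannot become negative, a component must break up, so the vertex separates. *)
Lemma critical_simple a b : a \in porbit f b -> src a = src b -> a = b.
Proof.
move=> afb sab; apply/eqP/negP=> /negP ab.
pose r' := r * tperm a b.
have arb : a \in porbit r b by rewrite porbit_rP sab.
have := porbits_mulr_tperm r ab; rewrite arb /= addn0 -/r' => Er.
have := porbits_mulr_tperm f ab; rewrite afb /= addn0 -mulgA -/r' => Ef.
have := chi_le e r'; have := plane_genus Hm; rewrite /genus0 Er Ef => H1 H2.
have r'E x : src x != src a -> r' x = r x.
  move=> xa; rewrite permM tpermD //; apply: contraNneq xa => /(congr1 (@src V E)).
    by rewrite src_r => ->.
  by rewrite src_r -sab => ->.
have nab : ~~ conn e r' a b.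
  apply/negP=> cab.
  suff : ncomp e r' <= ncomp e r by move: H1 H2; clear; card_lia.
  apply: nclasses_sub; try exact: conn_equiv.
  apply: conn_sub => x; first exact: conn_stepl.
  have := conn_stepr e r' x; rewrite [r' x]permM; case: tpermP => [->|->|//] H.
    by apply: conn_trans H _; rewrite conn_sym.
  exact: conn_trans H _.
apply: (sep (small_set1 (src a)) (O := [set x | conn e r' a x])).
- by move=> x; rewrite !inE => /conn_trans; apply; exact: conn_stepl.
- move=> x x'; rewrite !inE => ax ax' sx; apply: contraR ax' => xa.
  apply: conn_trans ax _; have : x' \in porbit r x by rewrite porbit_rP sx.
  case/porbitP=> i ->; elim: i => [|i IHi]; first by rewrite perm1 conn0.
  rewrite expgSr permM -r'E; first exact: conn_trans IHi (conn_stepr _ _ _).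
  suff -> : src ((r ^+ i) x) = src x by [].
  by apply/eqP; rewrite eq_sym -porbit_rP mem_porbit.
- by exists (e a); rewrite !inE ?conn_stepl // src_e eq_sym src_neq_tgt.
- exists (e b); rewrite inE; last by rewrite src_e sab eq_sym src_neq_tgt.
  by apply: contra nab => /conn_trans; apply; rewrite conn_sym conn_stepl.
Qed.

(** Both ends of the chord are split, between the chord and the face. The first split merges the
    face with one beside the chord and the second splits the result. Two vertices are gained and no
    face is lost, so by [chi_le] a component breaks up: the ends of the chord separate. *)
Lemma critical_chordless x y : y \in porbit f x -> E (src x) (src y) ->
  src y = src (f x) \/ src x = src (f y).
Proof.
move=> yx Exy; case: (eqVneq (src y) (src (f x))) => [|nxy]; first by left.
case: (eqVneq (src x) (src (f y))) => [|nyx]; first by right.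
exfalso; have [b [sb tb]] := edge_dart Exy.
have bC : b \notin porbit f x.
  apply: contra nxy => /critical_simple /(_ sb) bx.
  by rewrite src_f -bx tb.
have xb : x != b by apply: contraNneq bC => <-; exact: porbit_id.
have porbitS (g : {perm D}) z : porbit g (g z) = porbit g z := porbit_perm g 1 z.
have fbC : f b \notin porbit f x.
  by apply: contra bC; rewrite -!eq_porbit_mem porbitS.
have yfb : y != f b by apply: contraNneq fbC => <-.
have sfb : src (f b) = src y by rewrite src_f tb.
have uv := src_neq_tgt b; rewrite sb tb in uv.
pose r1 : {perm D} := r * tperm x b; pose r2 : {perm D} := r1 * tperm y (f b).
have r1E z : src z != src x -> r1 z = r z.
  move=> zx; rewrite permM tpermD //; apply: contraNneq zx => /(congr1 (@src V E)).
    by rewrite src_r => ->.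
  by rewrite src_r sb => ->.
have r2u z : src z != src y -> r2 z = r1 z.
  move=> zy; have sz : src (r1 z) = src z.
    rewrite permM; case: tpermP => [E1|E1|_ _]; last exact: src_r.
      by rewrite sb -E1 src_r.
    by rewrite -sb -E1 src_r.
  rewrite [r2 z]permM tpermD //; apply: contraNneq zy => /(congr1 (@src V E)) => H.
    by rewrite -sz -H.
  by rewrite -sz -H sfb.
have r2E z : src z != src x -> src z != src y -> r2 z = r z.
  by move=> zx zy; rewrite r2u // r1E.
have xrb : x \in porbit r b by rewrite porbit_rP sb.
have := porbits_mulr_tperm r xb; rewrite xrb /= addn0 -/r1 => Er1.
have xfb : x \notin porbit f b by rewrite porbit_sym.
have := porbits_mulr_tperm f xb; rewrite xfb -mulgA -/r1 => Ef1.
have xf1b : x \in porbit (e * r1) b by rewrite mulgA porbit_mul_tperm_split.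
have sub_f1 z w : z = x \/ z = b -> w \in porbit f z -> w \in porbit (e * r1) b.
  move=> Hz /porbitP[i ->]; elim: i => [|i IHi].
    by rewrite perm1; case: Hz => -> //; exact: porbit_id.
  rewrite expgSr permM; set t := (f ^+ i) z in IHi *.
  have : (e * r1) t \in porbit (e * r1) b.
    by rewrite -eq_porbit_mem porbitS eq_porbit_mem.
  by rewrite mulgA [_ t]permM; case: tpermP => [->|->|//] _; rewrite ?porbit_id // -mulgA.
have yf1 : y \in porbit (e * r1) (f b).
  have H1 : y \in porbit (e * r1) b by apply: (sub_f1 x) => //; left.
  have : f b \in porbit (e * r1) b.
    by apply: (sub_f1 b); [right | rewrite -eq_porbit_mem porbitS].
  by rewrite -eq_porbit_mem => /eqP H2; move: H1; rewrite -!eq_porbit_mem H2.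
have yr1 : y \in porbit r1 (f b).
  have : y \in porbit r (f b) by rewrite porbit_rP sfb.
  move: (f b) sfb => w sw.
  case/porbitP=> i ->; elim: i => [|i IHi]; first by rewrite perm1 porbit_id.
  rewrite expgSr permM -r1E; first by rewrite -eq_porbit_mem porbitS eq_porbit_mem.
  have /eqP <- : src w == src ((r ^+ i) w) by rewrite -porbit_rP mem_porbit.
  by rewrite sw eq_sym.
have := porbits_mulr_tperm r1 yfb; rewrite yr1 /= addn0 -/r2 => Er2.
have := porbits_mulr_tperm (e * r1) yfb; rewrite yf1 /= addn0 -mulgA -/r2 => Ef2.
have := chi_le e r2; have := plane_genus Hm; rewrite /genus0 Er2 Er1 Ef2 => H1 H2.
have lt12 : ncomp e r < ncomp e r2 by move: H1 H2 Ef1; clear; card_lia.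
have [d0 [d1 nd]] : exists d0 d1, ~~ conn e r2 d0 d1.
  have : ~~ [forall d0, forall d1, conn e r2 d0 d1].
    apply: contraTN lt12 => /forallP all; rewrite -leqNgt.
    apply: nclasses_sub; try exact: conn_equiv.
    by move=> z w _; have /forallP := all z; apply.
  rewrite negb_forall => /existsP[d0]; rewrite negb_forall => /existsP[d1 nd].
  by exists d0, d1.
have r2b : r2 b != b.
  have -> : r2 b = tperm x b (r b) by rewrite r2u ?sb // permM.
  apply/negP; case: tpermP => [E1 _|E1 _|_ _ /eqP E1]; last 2 first.
  - by have := critical_r_neq b; rewrite E1 eqxx.
  - by have := critical_r_neq b; rewrite E1 eqxx.
  have ebC : e b \in porbit f x.
    by rewrite -E1 r_face porbitS porbit_id.
  have Eye : y = e b.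
    apply: critical_simple; rewrite ?src_e ?tb //.
    by move: ebC yx; rewrite -!eq_porbit_mem => /eqP-> /eqP->.
  by move: nyx; rewrite Eye -r_face E1 eqxx.
(* Each side must contain a vertex other than the two ends. A side with an edge joining them
   contains [b], hence also [r2 b], which starts at the same end but leads elsewhere. *)
have exclusive (P : {set D}) z : z \in P -> (forall d, d \in P -> e d \in P) ->
    (forall d, d \in P -> r2 d \in P) -> exists2 d, d \in P & src d \notin [set src x; src y].
  move=> zP Pe Pr; case: (boolP (src z \in [set src x; src y])) => zxy; last by exists z.
  case: (boolP (tgt z \in [set src x; src y])) => tz; last by exists (e z); rewrite ?src_e ?Pe.
  have bP : b \in P.
    move: zxy tz; rewrite !inE => /orP[]/eqP sz /orP[]/eqP tz.
    - by have := src_neq_tgt z; rewrite sz tz eqxx.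
    - by rewrite (_ : b = z) //; apply: dart_eq; rewrite ?sb ?tb.
    - by rewrite (_ : b = e z) ?Pe //; apply: dart_eq; rewrite ?sb ?tb ?src_e ?tgt_e.
    - by have := src_neq_tgt z; rewrite sz tz eqxx.
  have sr2b : src (r2 b) = src x.
    rewrite r2u ?sb // permM; case: tpermP => // _ _; by rewrite src_r sb.
  exists (e (r2 b)); first by rewrite Pe ?Pr.
  rewrite src_e !inE negb_or -{1}sr2b eq_sym src_neq_tgt /=.
  apply: contra r2b => /eqP t2; apply/eqP/dart_eq; rewrite ?t2 ?tb //.
  by rewrite sr2b sb.
have small_xy : small_set [set src x; src y].
  split; first by rewrite cards2; case: eqP.
  move=> z w; rewrite !inE => /orP[]/eqP-> /orP[]/eqP->; rewrite ?eqxx // => _.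
  by rewrite E_sym.
apply: (sep small_xy (O := [set z | conn e r2 d0 z])).
- by move=> z; rewrite !inE => /conn_trans; apply; exact: conn_stepl.
- move=> z z'; rewrite !inE => dz dz' sz; apply: contraR dz'; rewrite negb_or => /andP[zx zy].
  apply: conn_trans dz _; have : z' \in porbit r z by rewrite porbit_rP sz.
  case/porbitP=> i ->; elim: i => [|i IHi]; first by rewrite perm1 conn0.
  have Es : src ((r ^+ i) z) = src z.
    by apply/eqP; rewrite eq_sym -porbit_rP mem_porbit.
  by rewrite expgSr permM -r2E ?Es //; exact: conn_trans IHi (conn_stepr _ _ _).
- apply: (exclusive _ d0) => [|d|d]; rewrite !inE ?conn0 // => /conn_trans; apply.
    exact: conn_stepl.
  exact: conn_stepr.
- have [|d|d|d dO dZ] := exclusive (~: [set z | conn e r2 d0 z]) d1; rewrite ?inE //.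
  + by apply: contra => /conn_trans; apply; rewrite conn_sym conn_stepl.
  + by apply: contra => /conn_trans; apply; rewrite conn_sym conn_stepr.
  + by exists d => //; rewrite inE in dO.
Qed.

End PlaneMap.

(** All that the discharging needs of a minimal counterexample; lists and matchings no longer
    appear. In [cr_trick] the vertices of [H] must have a neighbour because [E] will be the graph
    induced on the set [A] still considered: having an edge puts them in [A]. *)
Record critical (V : finType) (E : rel V) (K : {set V}) (e r : {perm darts E}) : Prop :=
  Critical {
  cr_sym : symmetric E;
  cr_irr : irreflexive E;
  cr_map : plane_map e r;
  cr_clique : small_clique E K;
  cr_big : exists d : darts E, src d \notin K;
  cr_deg : forall d : darts E, src d \notin K -> 3 <= #|porbit r d|;
  cr_r_neq : forall d, r d != d;
  cr_simple : forall a b, a \in porbit (e * r)%g b -> src a = src b -> a = b;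
  cr_chordless : forall x y, y \in porbit (e * r)%g x -> E (src x) (src y) ->
    src y = src ((e * r)%g x) \/ src x = src ((e * r)%g y);
  cr_conn : forall H : {set V}, [disjoint H & K] -> (exists d : darts E, src d \in H) ->
    (forall x y, x \in H -> E x y -> y \in H) -> False;
  cr_trick : forall (H : {set V}) q q', (forall x, x \in H -> exists y, E x y) ->
    [disjoint H & K] -> q \in H -> q' \in H -> E q q' -> (forall y, E q y -> y \in H) ->
    #|[set y | E q' y]| <= 3 -> (exists2 y, E q' y & y \notin H) ->
    (forall Q : pred V, Q q' ->
     (forall x, x \in H -> x != q ->
        #|[set y in [set y | E x y] | [|| y \notin H, y == q | ~~ Q y]]| <= 2 -> Q x) ->
     forall x, x \in H -> x != q -> Q x) -> False }.

Section Reduction.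
Variables (V C : finType) (E : rel V) (L : V -> {set C}) (M : V -> V -> rel C).
Hypotheses (E_sym : symmetric E) (E_irr : irreflexive E).
Hypothesis L3 : forall v, #|L v| = 3.
Hypothesis M_sym : forall u v c d, E u v -> M u v c d = M v u d c.
Hypothesis M_fun : forall u v c d d', E u v -> M u v c d -> M u v c d' -> d = d'.
Hypothesis E_map : forall E' : rel V, subrel E' E -> symmetric E' -> irreflexive E' ->
  exists e r, @plane_map V E' e r.
Hypothesis no_critical : forall (E' : rel V) K e r, subrel E' E -> ~ @critical V E' K e r.

Lemma all_extendable (A K : {set V}) : small_clique E K -> K \subset A -> extendable E L M A K.
Proof.
have [n] := ubnP #|A|; elim: n A K => // n IHn A K ltA cliqueK KA.
apply: contrapT => notext.
have minA (A' K' : {set V}) : A' \proper A -> small_clique E K' -> K' \subset A' ->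
    extendable E L M A' K'.
  by move=> /proper_card ltA' clK' sK'; apply: IHn => //; move: ltA ltA'; clear; lia.
pose E' := restr_edge E A.
have E'E : subrel E' E by move=> x y /and3P[].
have E'sym : symmetric E' := restr_edge_sym E_sym A.
have E'irr : irreflexive E' := restr_edge_irr E_irr A.
have [e [r Hm]] := E_map E'E E'sym E'irr.
have srcA (d : darts E') : src d \in A by case/and3P: (dart_edge d).
have [z0 z0A z0K] := critical_proper notext.
have deg x : x \in A -> x \notin K -> 3 <= #|[set y | E' x y]|.
  exact: (critical_deg E_sym E_irr L3 M_sym M_fun minA cliqueK KA notext).
have cr_deg d : src d \notin K -> 3 <= #|porbit r d|.
  by move=> dK; rewrite (card_porbit_r Hm) deg.
have cr_big : exists d : darts E', src d \notin K.
  have /card_gt0P[y] : 0 < #|[set y | E' z0 y]| by rewrite (leq_trans _ (deg _ z0A z0K)).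
  by rewrite inE => /edge_dart[d [sd _]]; exists d; rewrite sd.
have sep := critical_sep E_sym E_irr L3 M_sym M_fun minA cliqueK KA notext.
have dsep (O : {set darts E'}) (Z : {set V}) : small_set E' Z ->
  (forall d, d \in O -> e d \in O) ->
  (forall d d', d \in O -> d' \notin O -> src d = src d' -> src d \in Z) ->
  (exists2 d, d \in O & src d \notin Z) -> (exists2 d, d \notin O & src d \notin Z) -> False.
  move=> [Z2 Zc] Oe OZ [d dO dZ] [d' d'O d'Z].
  pose S1 := [set src d | d in O]; pose S2 := [set src d | d in ~: O].
  have s12 v : v \in S1 -> v \in S2 -> v \in Z.
    case/imsetP=> x xO ->; case/imsetP=> y; rewrite inE => yO xy.
    exact: (OZ x y).
  have S1A : S1 \subset A by apply/subsetP=> _ /imsetP[x _ ->].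
  have A12 : S1 :&: (A :\: (S1 :\: S2)) \subset Z.
    apply/subsetP=> v; rewrite !inE negb_and negbK => /and3P[v1 v2 vA].
    by apply: s12 => //; move: v2; rewrite v1 orbF.
  have dS1 : src d \in S1 by exact: imset_f.
  have dS2 : src d \notin S2 by apply: contra dZ; exact: s12.
  have d'S2 : src d' \in S2 by apply: imset_f; rewrite inE.
  have d'S1 : src d' \notin S1 by apply: contra d'Z => H; exact: s12.
  (* The second side is not just [S2]: it must also take the vertices of [A] that have no darts. *)
  apply: (sep S1 (A :\: (S1 :\: S2))).
  - apply/setP=> v; rewrite !inE; case: (boolP (v \in S1)) => [/(subsetP S1A)->|] //=.
    by rewrite andbF.
  - by apply: contraNneq d'S1 => ->.
  - apply/eqP=> /setP /(_ (src d)); rewrite !inE dS1 (negPf dS2) srcA //.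
  - case: (set_0Vmem (S1 :&: (A :\: (S1 :\: S2)))) => [|[v vS]]; first by left.
    right; split.
    + by apply/card_gt0P; exists v.
    + exact: leq_trans (subset_leq_card A12) Z2.
    + by move=> x y /(subsetP A12) xZ /(subsetP A12) yZ xy; apply/E'E/Zc.
  - move=> x y xy; rewrite !inE; have /and3P[-> _ _] := xy.
    rewrite andbT negbK => /andP[x2 /imsetP[b bO Ex]] /negP; apply.
    have [b' [sb' tb']] := edge_dart xy.
    have b'O : b' \in O.
      apply: contraR x2 => b'O; rewrite -sb'; apply: imset_f.
      by rewrite inE.
    by rewrite -tb' -(src_e Hm); apply/imset_f/Oe.
have big3 : exists d, 3 <= #|porbit r d|.
  by have [d /cr_deg] := cr_big; exists d.
apply: (no_critical (K := K) E'E (e := e) (r := r)); split=> //.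
- case: cliqueK => K1 K2 Kc; split=> // x y xK yK xy.
  by rewrite /E' /restr_edge !(subsetP KA) // Kc.
- exact: (critical_r_neq E'irr Hm dsep big3).
- exact: (critical_simple E'irr Hm dsep).
- exact: (critical_chordless E'sym E'irr Hm dsep big3).
- move=> H disHK [d dH] closed.
  apply: (sep (A :&: H) (A :\: H)).
  + exact: setID.
  + apply: contraTneq disHK => /setIidPl AH; apply/pred0Pn.
    case: cliqueK => /card_gt0P[x xK] _ _; exists x => /=.
    by rewrite xK (subsetP AH) // (subsetP KA).
  + by apply/eqP=> /setP /(_ (src d)); rewrite !inE dH srcA.
  + by left; apply/setP=> x; rewrite !inE; case: (x \in H); rewrite ?andbF.
  + move=> x y xy; rewrite !inE; have /and3P[-> -> _] := xy.
    by rewrite !andbT negbK /= => /closed /(_ xy) ->.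
- move=> H q q' HA; apply: (critical_trick E_sym E_irr L3 M_sym M_fun minA cliqueK KA notext).
  by apply/subsetP=> x /HA[y /and3P[]].
Qed.

End Reduction.

Definition cyc (V : finType) (E : rel V) (k : nat) : Prop :=
  exists2 c : seq V, size c = k & ucycle E c.

Ltac split_bool :=
  repeat match goal with
  | H : is_true (_ && _) |- _ => case/andP: H => ? ?
  | H : is_true (~~ (_ || _)) |- _ => rewrite negb_or in H
  | H : is_true (_ \notin _ :: _) |- _ => rewrite inE in H
  | H : is_true (~~ (_ \in _ :: _)) |- _ => rewrite inE in H
  | H : is_true (uniq (_ :: _)) |- _ => rewrite cons_uniq in H
  | |- is_true (_ && _) => apply/andP; split
  | |- is_true (~~ (_ || _)) => rewrite negb_or
  | |- is_true (_ \notin _ :: _) => rewrite inE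
  | |- is_true (uniq (_ :: _)) => rewrite cons_uniq
  end; try done; try (rewrite eq_sym; assumption).

(** * Gifts of vertices and finite checks for long faces *)

Inductive corner_type := TypeH | TypeF | TypeS | TypeO.

Definition nontriv t := match t with TypeH | TypeF => true | _ => false end.
Definition isH t := match t with TypeH => true | _ => false end.
Definition isF t := match t with TypeF => true | _ => false end.
Definition isS t := match t with TypeS => true | _ => false end.

(* What a vertex of degree at least 4 outside the clique gives to a face of type
   t whose two neighbours around the vertex have types a and b. *)
Definition gift (four : bool) (t a b : corner_type) : nat :=
  match t with
  | TypeO => if four then if isH a || isH b then 24 else 12 * (nontriv a + nontriv b)
             else if nontriv a || nontriv b then 12 * (nontriv a + nontriv b).+1 else 0
  | TypeF => 6 * (isF a + isF b) + 12 * (isS a + isS b)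
  | _ => 0
  end.

(** A vertex of degree d has 48 d - 144 units to give: 48 in degree 4, 96 in degree 5. *)
Lemma gift4 a b c d :
  gift true a b d + gift true b c a + gift true c d b + gift true d a c <= 48.
Proof. by case: a; case: b; case: c; case: d. Qed.

Lemma gift5 a b c d x :
  gift false a b x + gift false b c a + gift false c d b + gift false d x c
   + gift false x a d <= 96.
Proof. by case: a; case: b; case: c; case: d; case: x. Qed.

(** From degree 6 on, a gift is divided between the two edges of the corner. Each edge then costs
    the vertex at most 24 in all, and 24 d <= 48 d - 144. *)
Definition half_gift (t a : corner_type) : nat :=
  match t with
  | TypeO => 24 * nontriv a | TypeF => 6 * isF a + 12 * isS a | _ => 0
  end.

Lemma gift_half b t x y : gift b t x y <= half_gift t x + half_gift t y.
Proof. by case: b; case: t; case: x; case: y. Qed.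

Lemma half_gift_sym a b : half_gift a b + half_gift b a <= 24.
Proof. by case: a; case: b. Qed.

Section Words.
Implicit Types (w : seq nat) (a b i : nat).

(* The letters code the sides of a face of 3-vertices: 2 for a triangle, 3 and 4
   for a pentagon paying for a triangle across its third or second side, 1 for
   another pentagon, 0 otherwise. *)
Definition heavy a := 2 <= a.
Definition compat a b := ~~ (heavy a && (0 < b)) && ~~ (heavy b && (0 < a)).

Fixpoint words n : seq (seq nat) :=
  if n is n'.+1 then
    flatten [seq [seq a :: w | a <- iota 0 5 & compat a (head 0 w)] | w <- words n']
  else [:: [::]].

Lemma words_mem w : all (gtn 5) w -> (if w is a :: w' then path compat a w' else true) ->
  w \in words (size w).
Proof.
elim: w => // a w IHw /= /andP[a5 w5] aw.
apply/flattenP; exists [seq b :: w | b <- iota 0 5 & compat b (head 0 w)].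
  by apply/mapP; exists w => //; apply: IHw => //; case: w aw {w5} => //= b w /andP[].
apply/mapP; exists a => //; rewrite mem_filter mem_iota /= a5 andbT.
by case: w aw {w5 IHw} => [|b w /= /andP[]] //; rewrite /compat andbF.
Qed.

(* In units of 1/24; indices are taken modulo 10 around the face. A pentagon gets
   half of its due when the triangle or pentagon two sides further is heavy, and
   bonus is the charge given back by a face relat to this one. *)
Definition cost w i :=
  match nth 0 w i with
  | 1 => 6
  | 2 => 24
  | 3 => if heavy (nth 0 w ((i + 2) %% 10)) then 12 else 24
  | 4 => if heavy (nth 0 w ((i + 8) %% 10)) then 12 else 24
  | _ => 0
  end.
Definition bonus w i :=
  if [&& nth 0 w ((i + 1) %% 10) == 2, nth 0 w ((i + 9) %% 10) == 2
       & nth 0 w ((i + 7) %% 10) == 2] then 6 else 0.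

(** A 10-face has 24 * 10 - 144 = 96 units. Letters 3 and 4 occur only for m = 6 and letter 1 only
    for m = 8, so they never mix. *)
Definition check10 w := compat (last 0 w) (head 0 w) && ~~ (has (leq 3) w && (1 \in w)) ==>
  (sumn [seq cost w i | i <- iota 0 10] <= 96 + sumn [seq bonus w i | i <- iota 0 10]).

(** Here 24 * 11 - 144 = 120, the price of five heavy sides. *)
Definition check11 w := compat (last 0 w) (head 0 w) ==>
  (sumn [seq (if heavy a then 24 else 6 * a) | a <- w] <= 120).

Lemma check10_all : all check10 (words 10).
Proof. by vm_compute. Qed.

Lemma check11_all : all check11 (words 11).
Proof. by vm_compute. Qed.

End Words.

(** * Faces of a critical map *)

Section Critical.
Variables (V : finType) (E : rel V) (K : {set V}) (e r : {perm darts E}).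
Hypothesis Hc : critical K e r.
Local Notation D := (darts E).
Implicit Types d : D.

Definition face : {perm D} := (e * r)%g.
Local Notation f := face.
Definition len d := #|porbit f d|.
Definition fset d := [set src x | x in porbit f d].
Definition is3 (v : V) := (v \notin K) && (#|[set y | E v y]| == 3).
Definition a3 d := [forall x in porbit f d, is3 (src x)].

Let E_sym : symmetric E := cr_sym Hc.
Let E_irr : irreflexive E := cr_irr Hc.
Let Hm : plane_map e r := cr_map Hc.

Lemma c_src_e d : src (e d) = tgt d. Proof. exact: src_e Hm _. Qed.
Lemma c_tgt_e d : tgt (e d) = src d. Proof. exact: tgt_e Hm _. Qed.
Lemma c_eK : involutive e. Proof. exact: eK Hm. Qed.
Lemma c_src_r d : src (r d) = src d. Proof. exact: src_r Hm _. Qed.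
Lemma c_src_f d : src (f d) = tgt d. Proof. exact: src_f Hm _. Qed.
Lemma c_fe d : f (e d) = r d. Proof. by rewrite /face permM c_eK. Qed.
Lemma c_faceE d : f d = r (e d). Proof. by rewrite /face permM. Qed.
Lemma c_simple a b : a \in porbit f b -> src a = src b -> a = b.
Proof. exact: cr_simple Hc _ _. Qed.

Lemma c_fV d : f (face^-1 d)%g = d. Proof. exact: permKV. Qed.
Lemma c_rV d : (r^-1)%g d = e ((face^-1)%g d).
Proof.
by apply: (@perm_inj _ r); rewrite permKV -c_faceE c_fV.
Qed.

Lemma porbitS (g : {perm D}) d : porbit g (g d) = porbit g d.
Proof. exact: (porbit_perm g 1 d). Qed.
Lemma porbitSV (g : {perm D}) d : porbit g (g^-1 d)%g = porbit g d.
Proof. by rewrite -(porbitS g (g^-1 d)%g) permKV. Qed.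

Lemma len_f d : len (f d) = len d. Proof. by rewrite /len porbitS. Qed.
Lemma len_in x d : x \in porbit f d -> len x = len d.
Proof. by rewrite -eq_porbit_mem /len => /eqP->. Qed.
Lemma a3_in x d : x \in porbit f d -> a3 x = a3 d.
Proof. by rewrite -eq_porbit_mem /a3 => /eqP->. Qed.
Lemma fset_in x d : x \in porbit f d -> fset x = fset d.
Proof. by rewrite -eq_porbit_mem /fset => /eqP->. Qed.
Lemma a3P d x : a3 d -> x \in porbit f d -> is3 (src x).
Proof. by move=> /forallP /(_ x) /implyP. Qed.
Lemma a3V d v : a3 d -> v \in fset d -> is3 v.
Proof. by move=> a /imsetP[x xd ->]; exact: a3P xd. Qed.

Lemma fset_src d : src d \in fset d. Proof. by apply: imset_f; exact: porbit_id. Qed.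
Lemma fset_iter d i : src (iter i f d) \in fset d.
Proof. by apply: imset_f; rewrite -permX mem_porbit. Qed.
Lemma fset_tgt d : tgt d \in fset d.
Proof. by rewrite -c_src_f; exact: (fset_iter d 1). Qed.
Lemma fset_prev d : src ((face^-1)%g d) \in fset d.
Proof. by apply: imset_f; rewrite -eq_porbit_mem porbitSV. Qed.

Lemma iter_len d : iter (len d) f d = d. Proof. exact: iter_porbit. Qed.
Lemma iter_lt d i : 0 < i -> i < len d -> iter i f d != d.
Proof.
move=> i0 il; apply/eqP=> H; have := uniq_traject_porbit f d.
rewrite -/(len d) => /(uniqP d) /(_ 0 i); rewrite !inE !size_traject il (leq_trans i0 (ltnW il)).
rewrite !nth_traject // ?(leq_trans i0 (ltnW il)) // => /(_ isT isT); rewrite /= H.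
by move=> /(_ erefl) E0; rewrite -E0 in i0.
Qed.
Lemma in_face x d : x \in porbit f d -> exists2 i, i < len d & x = iter i f d.
Proof. by rewrite porbit_traject => /trajectP[i il ->]; exists i. Qed.
Lemma iter_inj d i j : i < len d -> j < len d -> src (iter i f d) = src (iter j f d) -> i = j.
Proof.
move=> il jl /c_simple H.
have Eij : iter i f d = iter j f d.
  by apply: H; rewrite -!permX -eq_porbit_mem !porbit_perm.
have := uniq_traject_porbit f d; rewrite -/(len d) => /(uniqP d) /(_ i j).
by rewrite !inE !size_traject !nth_traject //; apply.
Qed.

Definition fsrc d := [seq src x | x <- traject f d (len d)].
Lemma fsrc_uniq d : uniq (fsrc d).
Proof.
rewrite map_inj_in_uniq ?uniq_traject_porbit // => x y.
rewrite -!porbit_traject -!eq_porbit_mem => /eqP xd /eqP yd; apply: c_simple.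
by rewrite -eq_porbit_mem xd yd.
Qed.
Lemma fsrc_size d : size (fsrc d) = len d. Proof. by rewrite size_map size_traject. Qed.
Lemma fsrc_mem d v : (v \in fsrc d) = (v \in fset d).
Proof.
apply/mapP/imsetP => -[x xd ->]; exists x => //; first by rewrite porbit_traject.
by rewrite -porbit_traject.
Qed.
Lemma len_gt0 d : 0 < len d.
Proof. by rewrite lt0n card_porbit_neq0. Qed.
Lemma c_edge d : E (src d) (src (f d)).
Proof. by rewrite c_src_f; exact: dart_edge. Qed.
Lemma edge_neq u v : E u v -> u != v.
Proof. by apply: contraTneq => ->; rewrite E_irr. Qed.

Lemma fsrc_cycle d : path.cycle E (fsrc d).
Proof.
rewrite /fsrc; case: (len d) (iter_len d) => // n /= H.
have P m x : path E (src x) [seq src x | x <- traject f (f x) m].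
  by elim: m x => //= m IHm x; rewrite IHm andbT; exact: c_edge.
rewrite rcons_path P /= (last_map (@src V E)) last_traject -[X in E _ (src X)]H.
exact: c_edge.
Qed.

Lemma face_cyc d : cyc E (len d).
Proof. by exists (fsrc d); rewrite ?fsrc_size // /ucycle fsrc_cycle fsrc_uniq. Qed.

Lemma len_ge3 d : 2 < len d.
Proof.
case: (ltngtP (len d) 2) => // H; last first.
  have := iter_len d; rewrite H /= c_faceE => H1.
  have : f d = e d.
    apply: dart_eq; rewrite ?c_src_f ?c_src_e ?c_tgt_e //.
    by rewrite -c_src_f -(iter_len d) H /= -[in RHS](iter_len d) H.
  by rewrite c_faceE => /eqP; rewrite (negPf (cr_r_neq Hc _)).
have := iter_len d; case: (len d) H (len_gt0 d) => [|[|n]] //= _ _ H1.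
by have := edge_neq (c_edge d); rewrite H1 eqxx.
Qed.

Lemma fsrc2 d : fsrc d = [:: src d, src (f d) & drop 2 (fsrc d)].
Proof. by rewrite /fsrc; case: (len d) (len_ge3 d) => [|[|[|n]]]. Qed.

(** Two faces that meet only in a common side form a cycle once that side is removed. *)
Lemma join_cyc d : ~~ has (mem (drop 2 (fsrc d))) (drop 2 (fsrc (e d))) ->
  cyc E (len d + len (e d) - 2).
Proof.
move=> dis; exists (src (f d) :: drop 2 (fsrc d) ++ src d :: drop 2 (fsrc (e d))).
  rewrite /= size_cat /= !size_drop !fsrc_size.
  by have := len_ge3 d; have := len_ge3 (e d); lia.
have := fsrc_cycle d; have := fsrc_cycle (e d); have := fsrc_uniq d; have := fsrc_uniq (e d).
rewrite (fsrc2 (e d)) (fsrc2 d) !c_src_f c_tgt_e c_src_e.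
move: dis; set s1 := drop 2 _; set s2 := drop 2 _ => dis.
rewrite /ucycle /= !rcons_path !cat_path !drop0 last_cat /= mem_cat cat_uniq /= !inE !negb_or.
case/and3P=> /andP[n1 n2] n3 u2 /and3P[/andP[n4 n5] n6 u1] /and3P[E1 p1 E2] /and3P[E3 p2 E4].
by rewrite p2 E4 p1 E2 n5 n6 n1 n2 u1 n3 u2 dis.
Qed.

(** A cycle minus a vertex is connected, so [Q] spreads around the face without passing through [z].
    In the reductions [z] is usually the vertex q, which takes no part in the greedy colouring. *)
Lemma face_prop d (Q : pred V) (z : V) :
  (exists2 y, y \in fset d & y != z /\ Q y) ->
  (forall u v, u \in fset d -> v \in fset d -> u != z -> v != z -> E u v -> Q u -> Q v) ->
  forall v, v \in fset d -> v != z -> Q v.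
Proof.
move=> [y yd [yz Qy]] step v vd vz.
have [/imsetP[c cd Ez]|zd] := boolP (z \in fset d); last first.
  case/imsetP: yd => y0 y0d Ey; move: vd; rewrite -(fset_in y0d) => /imsetP[v0 /in_face[i _ ->] ->].
  have nz j : src (iter j f y0) != z.
    by apply: contraNneq zd => <-; rewrite -(fset_in y0d) fset_iter.
  elim: i => [|i IHi]; first by rewrite -Ey.
  apply: (step (src (iter i f y0))) IHi; rewrite ?nz // -?(fset_in y0d) ?fset_iter //.
  exact: c_edge.
have ecd := fset_in cd; move: yd vd; rewrite -ecd => /imsetP[y0 /in_face[i il ->] Ey].
move=> /imsetP[v0 /in_face[j jl ->] Ev].
have nz k : 0 < k -> k < len c -> src (iter k f c) != z.
  move=> k0 kl; rewrite Ez; apply/negP=> /eqP H.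
  by have := @iter_inj c k 0 kl (len_gt0 c) H => k00; rewrite k00 in k0.
have stepk k : 0 < k -> k.+1 < len c -> Q (src (iter k f c)) = Q (src (iter k.+1 f c)).
  move=> k0 kl; have kl' := ltnW kl.
  have Ek : E (src (iter k f c)) (src (iter k.+1 f c)) by exact: c_edge.
  have nz1 := nz k k0 kl'; have nz2 := nz k.+1 isT kl.
  by apply/idP/idP; apply: step => //; rewrite -?ecd ?fset_iter // E_sym.
have i0 : 0 < i by case: (i) Ey => // Ey; rewrite Ey Ez eqxx in yz.
have j0 : 0 < j by case: (j) Ev => // Ev; rewrite Ev Ez eqxx in vz.
have Q1 k : k.+1 < len c -> Q (src (iter k.+1 f c)) = Q (src (iter 1 f c)).
  by elim: k => // k IHk kl; rewrite -stepk // IHk // ltnW.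
rewrite Ev; rewrite Ey in Qy; case: i i0 il Qy {Ey} => // i _ il; rewrite Q1 // => Q1t.
by case: j j0 jl {Ev} => // j _ jl; rewrite Q1.
Qed.

(** The degeneracy condition as checked below: a 3-vertex is reached from one neighbour in [H] other
    than [q], a vertex of degree 4 from two. *)
Lemma trick (H : {set V}) q q' : (forall x : V, x \in H -> x \notin K) ->
  (forall x : V, x \in H -> exists y, E x y) ->
  q \in H -> q' \in H -> E q q' -> (forall y, E q y -> y \in H) -> is3 q' ->
  (exists2 y, E q' y & y \notin H) ->
  (forall Q : pred V, Q q' ->
    (forall x u : V, x \in H -> x != q -> is3 x -> u \in H -> u != q -> E x u -> Q u -> Q x) ->
    (forall x u w : V, x \in H -> x != q -> #|[set y | E x y]| = 4 -> u \in H -> u != q ->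
       w \in H -> w != q -> u != w -> E x u -> E x w -> Q u -> Q w -> Q x) ->
    forall x : V, x \in H -> x != q -> Q x) -> False.
Proof.
move=> HK HE qH q'H qq' Nq /andP[_ /eqP deg'] out closure.
apply: (cr_trick Hc HE _ qH q'H qq' Nq _ out); rewrite ?deg' //.
  rewrite disjoints_subset; apply/subsetP=> x /HK; by rewrite inE.
move=> Q Qq' rule; apply: closure => // [x u xH xq /andP[_ /eqP x3] uH uq xu Qu|x u w xH xq x4 uH uq wH wq uw xu xw Qu Qw]; apply: rule => //.
  rewrite -ltnS -[X in _ < X]x3 (cardsD1 u [set y | E x y]) inE xu add1n ltnS.
  apply/subset_leq_card/subsetP=> y; rewrite !inE => /andP[-> H1]; rewrite andbT.
  by apply: contraTneq H1 => ->; rewrite uH (negPf uq) Qu.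
rewrite -2!ltnS -[X in _ < X]x4 (cardsD1 u [set y | E x y]) inE xu add1n ltnS.
rewrite (cardsD1 w (_ :\ u)) !inE xw eq_sym uw add1n ltnS.
apply/subset_leq_card/subsetP=> y; rewrite !inE => /andP[-> H1]; rewrite andbT.
by apply/andP; split; apply: contraTneq H1 => ->; rewrite ?uH ?(negPf uq) ?Qu ?wH ?(negPf wq) ?Qw.
Qed.

Lemma deg_card d : #|porbit r d| = #|[set y | E (src d) y]|.
Proof. exact: card_porbit_r (cr_map Hc) d. Qed.

Lemma rr_K d : r (r d) = d -> src d \in K.
Proof.
move=> rrd; apply: contraT => /(cr_deg Hc).
suff sub : porbit r d \subset [set d; r d].
  by have := subset_leq_card sub; rewrite cards2; case: eqP => _ /=; lia.
apply/subsetP=> _ /porbitP[i ->]; elim: i => [|i]; first by rewrite perm1 !inE eqxx.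
by rewrite expgSr permM !inE => /orP[]/eqP->; rewrite ?rrd eqxx ?orbT.
Qed.

Lemma is3_notK v : is3 v -> v \notin K. Proof. by case/andP. Qed.

Lemma is3_r3 d : is3 (src d) -> r (r (r d)) = d.
Proof.
by move=> /andP[_]; rewrite -deg_card => /eqP d3; have := iter_porbit r d; rewrite d3.
Qed.

Lemma is3_rr d : is3 (src d) -> r (r d) = e ((f^-1)%g d).
Proof.
by move=> d3; rewrite -c_rV; apply: (@perm_inj _ r); rewrite permKV is3_r3.
Qed.

Lemma is3_corner d x : is3 (src d) -> src x = src d ->
  [\/ x = d, x = r d | x = e ((f^-1)%g d)].
Proof.
move=> d3 /eqP; rewrite eq_sym -(porbit_rP (cr_map Hc)) porbit_traject.
have /andP[_] := d3; rewrite -deg_card => /eqP->; rewrite /= !inE is3_rr //.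
by case/or3P=> /eqP->; [constructor 1 | constructor 2 | constructor 3].
Qed.

Lemma is3_nbrs d y : is3 (src d) -> E (src d) y ->
  [\/ y = tgt d, y = tgt (r d) | y = src ((f^-1)%g d)].
Proof.
move=> d3 /edge_dart[x [sx <-]]; case: (is3_corner d3 sx) => ->.
- by constructor 1.
- by constructor 2.
- by constructor 3; rewrite c_tgt_e.
Qed.

Lemma other_face d : e d \notin porbit f d.
Proof.
apply/negP=> ed; have := cr_r_neq Hc (e d); rewrite -c_faceE => /eqP; apply.
apply: c_simple; last by rewrite c_src_f c_src_e.
by rewrite -eq_porbit_mem porbitS eq_sym eq_porbit_mem.
Qed.

Lemma edge_in_face d g : src d \in fset g -> tgt d \in fset g ->
  d \in porbit f g \/ e d \in porbit f g.
Proof.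
case/imsetP=> x xg sx /imsetP[y yg ty].
have yx : y \in porbit f x by rewrite -eq_porbit_mem in xg; rewrite (eqP xg).
have := cr_chordless Hc yx; rewrite -sx -ty dart_edge => /(_ isT).
rewrite -[(e * r)%g]/f !c_src_f => -[H|H].
  by left; rewrite (_ : d = x) //; apply: dart_eq.
by right; rewrite (_ : e d = y) //; apply: dart_eq; rewrite ?c_src_e ?c_tgt_e.
Qed.

Lemma porb_eq x g : x \in porbit f g -> porbit f x = porbit f g.
Proof. by rewrite -eq_porbit_mem => /eqP. Qed.

(** Otherwise the side after [d] would also separate the same two faces, and [tgt d] would have
    degree 2, hence belong to [K]. *)
Lemma next_notin d : tgt d \notin K -> src (f (f d)) \notin fset (e d).
Proof.
rewrite c_src_f => yK; apply/negP=> p_in.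
have y_in : src (f d) \in fset (e d) by rewrite c_src_f -c_src_e fset_src.
case: (edge_in_face y_in p_in) => H.
  have /negP := other_face d; apply; rewrite -eq_porbit_mem.
  by rewrite -(porb_eq H) porbitS.
case/negP: yK; rewrite -c_src_e; apply: rr_K; rewrite -c_faceE.
rewrite -(c_fe (f d)); apply: c_simple.
  by rewrite -eq_porbit_mem porbitS eq_porbit_mem.
by rewrite c_src_f c_tgt_e c_src_f c_src_e.
Qed.

Lemma prev_notin d : src d \notin K -> src ((f^-1)%g d) \notin fset (e d).
Proof.
move=> xK; apply/negP=> p_in; set g := (f^-1)%g d in p_in.
have fg : f g = d by rewrite /g c_fV.
have x_in : tgt g \in fset (e d) by rewrite -c_src_f fg -c_tgt_e fset_tgt.
case: (edge_in_face p_in x_in) => H.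
  have /negP := other_face d; apply; rewrite -eq_porbit_mem -(porb_eq H).
  by rewrite -fg porbitS.
case/negP: xK; apply: rr_K.
suff -> : r d = e g by rewrite -c_faceE fg.
rewrite -c_fe; apply: c_simple.
  rewrite -eq_porbit_mem porbitS eq_sym eq_porbit_mem; exact: H.
by rewrite c_src_f c_tgt_e c_src_e -c_src_f fg.
Qed.

Lemma no_chord d i j : i < j -> j < len d -> E (src (iter i f d)) (src (iter j f d)) ->
  j = i.+1 \/ (i = 0 /\ j.+1 = len d).
Proof.
move=> ij jl Eij; have il := ltn_trans ij jl.
have inij : iter j f d \in porbit f (iter i f d).
  by rewrite -!permX -eq_porbit_mem !porbit_perm.
case: (cr_chordless Hc inij Eij) => H; first by left; exact: (@iter_inj d j i.+1 jl (leq_ltn_trans ij jl) H).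
have := leq_trans jl (leqnn _); rewrite leq_eqVlt => /orP[/eqP jl'|jl'].
  right; split => //; move: H; rewrite -[(e * r)%g]/f -[f (iter j f d)]/(iter j.+1 f d) jl' iter_len.
  by move/(@iter_inj d i 0 il (leq_ltn_trans (leq0n _) il)).
by have := @iter_inj d i j.+1 il jl' H; lia.
Qed.

(** Otherwise the face across [d] would share all three sides of the triangle. Its three vertices
    would have degree 2 and lie in [K], which has at most two vertices. *)
Lemma dis3 d : len d = 3 -> src (f (f d)) \notin fset (e d).
Proof.
move=> d3; apply/negP=> z_in.
have fffd : f (f (f d)) = d by have := iter_len d; rewrite d3.
have y_in : src (f d) \in fset (e d) by rewrite c_src_f -c_src_e fset_src.
have x_in : src d \in fset (e d) by rewrite -c_tgt_e fset_tgt.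
have other x : x \in porbit f d -> x \notin porbit f (e d).
  move=> xd; apply: contra (other_face d) => H.
  by rewrite -eq_porbit_mem -(porb_eq H) (porb_eq xd).
have in_d i : iter i f d \in porbit f d by rewrite -permX mem_porbit.
have H1 : e (f d) \in porbit f (e d).
  have t_in : tgt (f d) \in fset (e d) by rewrite -c_src_f.
  by case: (edge_in_face y_in t_in) => // H; have := other _ (in_d 1); rewrite H.
have H2 : e (f (f d)) \in porbit f (e d).
  have t_in : tgt (f (f d)) \in fset (e d) by rewrite -c_src_f fffd.
  by case: (edge_in_face z_in t_in) => // H; have := other _ (in_d 2); rewrite H.
have next a b : a \in porbit f (e d) -> b \in porbit f (e d) -> tgt a = src b -> f a = b.
  rewrite -!eq_porbit_mem => /eqP Ha /eqP Hb ab; apply: c_simple; rewrite ?c_src_f //.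
  by rewrite -eq_porbit_mem porbitS Ha Hb.
have F1 : f (e d) = e (f (f d)).
  by apply: next; rewrite ?porbit_id // c_tgt_e c_src_e -c_src_f fffd.
have F2 : f (e (f (f d))) = e (f d).
  by apply: next; rewrite // c_tgt_e c_src_e -c_src_f.
have F3 : f (e (f d)) = e d.
  by apply: next; rewrite ?porbit_id // c_tgt_e c_src_e -c_src_f.
have xK : src d \in K by apply: rr_K; rewrite -(c_fe d) F1 -c_faceE.
have yK : src (f d) \in K.
  by apply: rr_K; rewrite -(c_fe (f d)) F3 -c_faceE.
have zK : src (f (f d)) \in K.
  by apply: rr_K; rewrite -(c_fe (f (f d))) F2 -c_faceE.
have [_ K2 _] := cr_clique Hc.
have : [set src d; src (f d); src (f (f d))] \subset K.
  by apply/subsetP=> v; rewrite !inE => /orP[/orP[]|]/eqP->.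
move/subset_leq_card; have := fsrc_uniq d; rewrite /fsrc d3 /= !inE !negb_or.
by case/and3P=> /andP[n1 n2] n3 _; rewrite -setUA cardsU1 cards2 !inE n3 (negPf n1) (negPf n2) /=; lia.
Qed.

Lemma face3_cyc d : len d = 3 -> cyc E (len (e d)).+1.
Proof.
move=> d3; have := join_cyc (d := d); rewrite d3.
rewrite (_ : 3 + _ - 2 = (len (e d)).+1); last by have := len_ge3 (e d); lia.
apply; apply/hasPn=> v vs; rewrite /fsrc d3 /= inE.
have := dis3 d3; rewrite -fsrc_mem => H; apply: contra H => /eqP<-.
by move: vs; apply: mem_drop.
Qed.

Lemma is3_edge v : is3 v -> exists y, E v y.
Proof.
move=> /andP[_ /eqP H]; have /card_gt0P[y] : 0 < #|[set y | E v y]| by rewrite H.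
by rewrite inE; exists y.
Qed.

(** * Reducible configurations *)

(** Let [H] be the union of the two faces. All neighbours of [src d] lie in [H]. By [cr_conn] this
    cannot hold throughout [H], so some edge goes from a vertex q with all its neighbours in [H] to
    a vertex q' with one outside. Without q the two faces still share an end of [d], so everything
    is reached from q'. *)
Lemma a3_no_adj d : a3 d -> a3 (e d) -> False.
Proof.
move=> Xa Ya; set X := fset d; set Y := fset (e d).
pose H := X :|: Y.
have Ha v : v \in H -> is3 v by rewrite inE => /orP[/(a3V Xa)|/(a3V Ya)].
have uX : src d \in X := fset_src d.
have vX : tgt d \in X := fset_tgt d.
have uY : src d \in Y by rewrite -c_tgt_e fset_tgt.
have vY : tgt d \in Y by rewrite -c_src_e fset_src.
have uv : src d != tgt d := src_neq_tgt (cr_irr Hc) d.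
pose I := [pred v | [forall y, E v y ==> (y \in H)]].
have Iu : I (src d).
  apply/forallP=> y; apply/implyP=> /(is3_nbrs (a3V Xa uX)) [] ->; rewrite inE.
  - by rewrite vX.
  - by rewrite -c_fe -c_src_f (fset_iter (e d) 2) orbT.
  - by rewrite fset_prev.
case: (boolP [forall q in H, forall q' in H, (E q q' && I q) ==> I q']) => [/forall_inP Iall|].
  have stepI q q' : q \in H -> q' \in H -> E q q' -> I q -> I q'.
    by move=> /Iall /forall_inP /[apply] /implyP + qq' qI; apply; rewrite qq'.
  have IH : forall v, v \in H -> I v.
    have IW g : g = d \/ g = e d -> forall v, v \in fset g -> v != v -> I v.
      by move=> _ v _; rewrite eqxx.
    have [Iv] : I (tgt d) by apply: stepI Iu; rewrite ?inE ?uX ?vX ?dart_edge.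
    have IX v : v \in X -> I v.
      move=> vX'; case: (eqVneq v (src d)) => [->|nv]; first exact: Iu.
      apply: (face_prop (d := d) (Q := I) (z := src d)) => //.
        by exists (tgt d); rewrite // eq_sym uv.
      move=> a b aX bX _ _ ab; apply: stepI; rewrite ?inE ?aX ?bX //.
    have IY v : v \in Y -> I v.
      move=> vY'; case: (eqVneq v (src d)) => [->|nv]; first exact: Iu.
      apply: (face_prop (d := e d) (Q := I) (z := src d)) => //.
        by exists (tgt d); rewrite // eq_sym uv.
      move=> a b aX bX _ _ ab; apply: stepI; rewrite ?inE ?aX ?bX ?orbT //.
    by move=> v; rewrite inE => /orP[/IX|/IY].
  apply: (cr_conn Hc (H := H)).
  - rewrite disjoints_subset; apply/subsetP=> v /Ha /is3_notK; by rewrite inE.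
  - by exists d; rewrite inE uX.
  - by move=> x y /IH /forallP /(_ y) /implyP.
rewrite negb_forall_in => /exists_inP[q qH]; rewrite negb_forall_in => /exists_inP[q' q'H].
rewrite negb_imply => /andP[/andP[qq' /forallP Iq]]; rewrite negb_forall => /existsP[w].
rewrite negb_imply => /andP[q'w wH].
apply: (trick (H := H) (q := q) (q' := q')) => //.
- by move=> x /Ha /is3_notK.
- by move=> x /Ha /is3_edge.
- by move=> y; apply/implyP.
- exact: Ha.
- by exists w.
move=> Q Qq' rule _.
have q'q : q' != q by rewrite eq_sym edge_neq.
have W g : fset g \subset H -> (exists2 y, y \in fset g & y != q /\ Q y) ->
    forall v, v \in fset g -> v != q -> Q v.
  move=> gH ex; apply: (face_prop ex) => a b ag bg aq bq ab Qa.
  by apply: (rule b a); rewrite ?(subsetP gH) ?Ha ?(subsetP gH) // E_sym.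
have XH : X \subset H by exact: subsetUl.
have YH : Y \subset H by exact: subsetUr.
have common g : src d \in fset g -> tgt d \in fset g -> (forall v, v \in fset g -> v != q -> Q v) ->
   exists y, [/\ y \in X, y \in Y, y != q & Q y].
  move=> ug vg all; case: (eqVneq (src d) q) => [Eq|nq].
    by exists (tgt d); rewrite vX vY all // -Eq eq_sym uv.
  by exists (src d); rewrite uX uY all.
have [y [yX yY yq Qy]] : exists y, [/\ y \in X, y \in Y, y != q & Q y].
  move: (q'H); rewrite inE => /orP[q'X|q'Y].
    by apply: (common d) => //; apply: W => //; exists q'.
  by apply: (common (e d)) => //; apply: W => //; exists q'.
by move=> x; rewrite inE => /orP[xX|xY]; [apply: (W d) | apply: (W (e d))] => //; exists y.
Qed.

(* The union of two 3-vertex paths closing up at a 4-vertex p, plus x. *)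
Lemma reducible_pair (b g : D) q rr v1 p x y y2 w :
  a3 b -> q \in fset b -> rr \in fset b -> v1 \in fset b -> rr != q -> v1 != q ->
  (forall u, E q u -> [|| u == rr, u == v1 | u == p]) -> E q v1 ->
  p \in fset g -> p \notin K -> #|[set u | E p u]| = 4 ->
  (forall u, u \in fset g -> u != p -> is3 u) -> q \notin fset g ->
  is3 x -> x != q -> E x rr -> E y x -> y \in fset g -> y2 \in fset g ->
  y != y2 -> E p y -> E p y2 -> E v1 w -> w \notin fset b -> w \notin fset g -> w != x -> False.
Proof.
move=> Ba qB rB v1B rq v1q Nq qv1 pG pK p4 G3 qG x3 xq xr yx yG y2G yy2 py py2 v1w wB wG wx.
pose H := x |: fset b :|: fset g.
have inH v : v \in H = [|| v == x, v \in fset b | v \in fset g] by rewrite !inE orbA.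
have H3 v : v \in H -> v != p -> is3 v.
  by rewrite inH => /or3P[/eqP->|/(a3V Ba)|/G3].
have yp : y != p by rewrite eq_sym edge_neq.
have y2p : y2 != p by rewrite eq_sym edge_neq.
have pq : p != q by apply: contraNneq qG => <-.
have nq v : v \in fset g -> v != q by move=> vG; apply: contraNneq qG => <-.
apply: (trick (H := H) (q := q) (q' := v1)) => //.
- by move=> v vH; case: (eqVneq v p) => [->|/(H3 _ vH)/is3_notK].
- by move=> v vH; case: (eqVneq v p) => [->|/(H3 _ vH)/is3_edge] //; exists y.
- by rewrite inH qB orbT.
- by rewrite inH v1B orbT.
- by move=> u /Nq /or3P[]/eqP->; rewrite inH ?rB ?v1B ?pG ?orbT.
- exact: a3V Ba _.
- by exists w; rewrite // inH !negb_or wB wG wx.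
move=> Q Qv1 rule3 rule4.
have QB : forall v, v \in fset b -> v != q -> Q v.
  apply: face_prop => [|s t sB tB sq tq st Qs]; first by exists v1.
  by apply: (rule3 t s); rewrite ?inH ?sB ?tB ?orbT ?(a3V Ba) // E_sym.
have Qx : Q x by apply: (rule3 x rr); rewrite ?inH ?rB ?eqxx ?orbT ?QB.
have Qy : Q y by apply: (rule3 y x) => //; rewrite ?inH ?yG ?eqxx ?orbT ?G3 //; apply: nq.
have QG : forall v, v \in fset g -> v != p -> Q v.
  apply: face_prop => [|s t sG tG sp tp st Qs]; first by exists y.
  by apply: (rule3 t s); rewrite ?inH ?sG ?tG ?orbT ?G3 ?nq // E_sym.
have Qp : Q p.
  by apply: (rule4 p y y2); rewrite ?inH ?pG ?yG ?y2G ?orbT ?nq ?QG.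
move=> v; rewrite inH => /or3P[/eqP->|/QB|vG] // _.
by case: (eqVneq v p) => [->|/(QG _ vG)].
Qed.

(** A face of 3-vertices together with a face whose only other vertices are [u] and [u'], of degree
    4. From [q'] the first face is reached except [q], then [u] through its neighbours [v] and [a],
    then the second face up to [u'], and finally [u'] through [v'] and [w']. *)
Lemma reducible_two (d g : D) q q' u u' v a v' w' w :
  a3 d -> q \in fset d -> q' \in fset d -> E q q' ->
  (forall y, E q y -> (y \in fset d) || (y == u')) -> E q' w ->
  w \notin fset d -> w \notin fset g ->
  (forall y, y \in fset g -> y != u -> y != u' -> is3 y) ->
  u \in fset g -> u' \in fset g -> u != u' -> u \notin K -> u' \notin K ->
  #|[set y | E u y]| = 4 -> #|[set y | E u' y]| = 4 -> q \notin fset g ->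
  v \in fset d -> v != q -> a \in fset d -> a != q -> v != a -> E u v -> E u a ->
  v' \in fset d -> v' != q -> w' \in fset g -> w' != v' -> E u' v' -> E u' w' -> False.
Proof.
move=> Xa qX q'X qq' Nq q'w wX wG G3 uG u'G uu' uK u'K u4 u'4 qG vX vq aX aq va uv ua
  v'X v'q w'G w'v' u'v' u'w'.
pose H := fset d :|: fset g.
have inH y : y \in H = (y \in fset d) || (y \in fset g) by rewrite inE.
have H3 y : y \in H -> [\/ y = u, y = u' | is3 y].
  rewrite inH => /orP[/(a3V Xa) y3|yG]; first by constructor 3.
  case: (eqVneq y u) => [->|yu]; first by constructor 1.
  case: (eqVneq y u') => [->|yu']; first by constructor 2.
  by constructor 3; apply: G3.
have nq y : y \in fset g -> y != q by move=> yG; apply: contraNneq qG => <-.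
apply: (trick (H := H) (q := q) (q' := q')) => //.
- by move=> y /H3[->|->|/is3_notK].
- by move=> y /H3[->|->|/is3_edge] //; [exists v|exists v'].
- by rewrite inH qX.
- by rewrite inH q'X.
- by move=> y /Nq; rewrite inH => /orP[->//|/eqP->]; rewrite u'G orbT.
- exact: a3V Xa _.
- by exists w; rewrite // inH negb_or wX wG.
move=> Q Qq' rule3 rule4.
have QX : forall y, y \in fset d -> y != q -> Q y.
  apply: face_prop => [|s t sX tX sq tq st Qs].
    by exists q'; rewrite // eq_sym edge_neq.
  by apply: (rule3 t s); rewrite ?inH ?sX ?tX ?orbT ?(a3V Xa) // E_sym.
have Qu : Q u.
  by apply: (rule4 u v a) => //; rewrite ?inH ?uG ?vX ?aX ?orbT ?QX //; apply: nq.
have QG : forall y, y \in fset g -> y != u' -> Q y.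
  apply: face_prop => [|s t sG tG su' tu' st Qs]; first by exists u.
  case: (eqVneq t u) => [->//|tu].
  by apply: (rule3 t s); rewrite ?inH ?sG ?tG ?orbT ?G3 ?nq // E_sym.
have Qw' : Q w' by apply: QG; rewrite // eq_sym edge_neq.
have Qv' : Q v' by apply: QX.
have Qu' : Q u'.
  apply: (rule4 u' v' w') => //; rewrite ?inH ?u'G ?v'X ?w'G ?orbT //; try exact: nq.
  by rewrite eq_sym.
move=> y; rewrite inH => /orP[/QX//|yG] _.
by case: (eqVneq y u') => [->|/(QG _ yG)].
Qed.

(** * Consequences of the forbidden cycle lengths *)

Variable m : nat.
Hypothesis m678 : m \in [:: 6; 7; 8].
Hypothesis nocyc : forall k, k \in [:: 4; 6; 7; 8; 9] -> k != m -> ~ cyc E k.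
Local Notation fV := (face^-1)%g.

(* The faces in need of charge are those of length 3 and 5 avoiding K. *)
Definition noK d := [forall x in porbit f d, src x \notin K].
Definition tT d := (len d == 3) && noK d.
Definition t5 d := (len d == 5) && noK d.

Lemma noK_in x d : x \in porbit f d -> noK x = noK d.
Proof. by rewrite -eq_porbit_mem /noK => /eqP->. Qed.
Lemma tT_in x d : x \in porbit f d -> tT x = tT d.
Proof. by move=> xd; rewrite /tT (len_in xd) (noK_in xd). Qed.
Lemma t5_in x d : x \in porbit f d -> t5 x = t5 d.
Proof. by move=> xd; rewrite /t5 (len_in xd) (noK_in xd). Qed.
Lemma noK_src d x : noK d -> x \in porbit f d -> src x \notin K.
Proof. by move=> /forallP /(_ x) /implyP. Qed.
Lemma face_iter d i : iter i f d \in porbit f d.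
Proof. by rewrite -permX mem_porbit. Qed.
Lemma f_in d : f d \in porbit f d. Proof. exact: (face_iter d 1). Qed.
Lemma fV_in d : fV d \in porbit f d.
Proof. by rewrite -eq_porbit_mem porbitSV. Qed.
Lemma fiter_V d i j : iter i f (iter j fV d) = if j <= i then iter (i - j) f d else iter (j - i) fV d.
Proof.
elim: j i => [|j IHj] i; first by rewrite subn0.
case: i => [|i]; first by [].
rewrite iterSr [iter j.+1 _ _]/= permKV IHj subSS ltnS; by [].
Qed.

Lemma no4 : ~ cyc E 4.
Proof. by apply: nocyc => //; move: m678; rewrite !inE => /or3P[]/eqP->. Qed.
Lemma no9 : ~ cyc E 9.
Proof. by apply: nocyc => //; move: m678; rewrite !inE => /or3P[]/eqP->. Qed.

Lemma cyc4 (a b c d' : V) : E a b -> E b c -> E c d' -> E d' a -> a != c -> b != d' -> False.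
Proof.
move=> ab bc cd da ac bd; apply: no4; exists [:: a; b; c; d'] => //.
rewrite /ucycle /= ab bc cd da /= !inE !negb_or.
by rewrite (edge_neq ab) (edge_neq bc) (edge_neq cd) ac bd (eq_sym a d') (edge_neq da).
Qed.

Lemma e_edge u v : E u v -> E v u.
Proof. by rewrite E_sym. Qed.

Lemma src_iter_neq d i j : i < len d -> j < len d -> i != j -> src (iter i f d) != src (iter j f d).
Proof. by move=> il jl; apply: contraNneq => /(iter_inj il jl) ->. Qed.

Lemma join_cyc2 d : (forall v, v \in fset d -> v \in fset (e d) -> v = src d \/ v = tgt d) ->
  cyc E (len d + len (e d) - 2).
Proof.
move=> H; apply: join_cyc; apply/hasPn=> v v2; apply/negP=> v1.
have := fsrc_uniq d; rewrite fsrc2 /= !inE !negb_or c_src_f.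
have d1 : v \in fset d by rewrite -fsrc_mem; exact: mem_drop v1.
have d2 : v \in fset (e d) by rewrite -fsrc_mem; exact: mem_drop v2.
have {}v1 : v \in drop 2 (fsrc d) := v1.
by case: (H v d1 d2) => Ev; rewrite -Ev v1 /= ?andbF.
Qed.

Lemma len_cases d : [\/ len d = 3, len d = 5, len d = m | 10 <= len d].
Proof.
have [lt10|] := ltnP (len d) 10; last by constructor 4.
have ge3 := len_ge3 d; have cyc_d := face_cyc d.
have [/eqP->|nm] := boolP (len d == m); first by constructor 3.
have nin : len d \notin [:: 4; 6; 7; 8; 9].
  by apply/negP=> H; exact: nocyc H nm cyc_d.
move: nin lt10 ge3; rewrite !inE; case: (len d) => [|[|[|[|[|[|[|[|[|[|n]]]]]]]]]] //= _ _ _.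
  by constructor 1.
by constructor 2.
Qed.

(** The vertices next to the common side are excluded by [next_notin] and [prev_notin]. The opposite
    vertex of the pentagon, if it lay on the other face, would produce a chord of the pentagon or a
    4-cycle. *)
Lemma dis5 d v : len d = 5 -> src d \notin K -> tgt d \notin K ->
  len (e d) = 5 \/ len (e d) = 6 ->
  v \in fset d -> v \in fset (e d) -> v = src d \/ v = tgt d.
Proof.
move=> d5 xK yK l56 /imsetP[x0 /in_face[i il ->] ->] {x0} /imsetP[w /in_face[j jl ->] Ew] {w}.
rewrite d5 in il; have f5 : iter 5 f d = d by rewrite -{1}d5 iter_len.
have fVd : fV d = iter 4 f d by apply: (@perm_inj _ f); rewrite permKV -[LHS]f5.
have F0 : src (iter 0 f (e d)) = src (f d) by rewrite /= c_src_e c_src_f.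
have F1 : src (iter 1 f (e d)) = src d by rewrite /= c_src_f c_tgt_e.
have neq a b : a < 5 -> b < 5 -> a != b -> src (iter a f d) != src (iter b f d).
  by move=> al bl ab; apply: src_iter_neq; rewrite ?d5.
have edge a : E (src (iter a f d)) (src (iter a.+1 f d)) by exact: c_edge.
have edge' a : E (src (iter a f (e d))) (src (iter a.+1 f (e d))) by exact: c_edge.
case: i il Ew => [|[|[|[|[|//]]]]] _ Ew.
- by left.
- by right; rewrite /= c_src_f.
- by have := next_notin yK; rewrite [src _]Ew fset_iter.
- exfalso.
  have nx : ~ E (src d) (src (iter 3 f d)).
    by move=> H; case: (@no_chord d 0 3 isT _ H) => [||[_]]; rewrite ?d5.
  have ny : ~ E (src (iter 1 f d)) (src (iter 3 f d)).
    by move=> H; case: (@no_chord d 1 3 isT _ H) => [||[]]; rewrite ?d5.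
  have j0 : j != 0 by apply: contraTneq (neq 3 1 isT isT isT) => j0; rewrite Ew j0 F0 eqxx.
  have j1 : j != 1 by apply: contraTneq (neq 3 0 isT isT isT) => j1; rewrite Ew j1 F1 eqxx.
  have j2 : j != 2 by apply/eqP=> j2; apply: nx; rewrite Ew j2 -F1.
  have jl' : j.+1 != len (e d).
    apply/eqP=> jE; apply: ny; rewrite E_sym Ew.
    by have := edge' j; rewrite jE iter_len c_src_e -c_src_f.
  have case_p j' : j'.+1 = len (e d) -> src (iter 3 f d) = src (iter j'.-1 f (e d)) -> 0 < j' -> False.
    move=> jl1 Eq j'0.
    have c_in : src (iter j' f (e d)) \in fset (e d) := fset_iter _ _.
    apply: (@cyc4 (src (f d)) (src (iter j' f (e d))) (src (iter 3 f d)) (src (iter 2 f d))).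
    - by have := edge' j'; rewrite jl1 iter_len c_src_e -c_src_f E_sym.
    - by have := edge' j'.-1; rewrite prednK // -Eq E_sym.
    - by rewrite E_sym; exact: edge.
    - by rewrite E_sym; exact: (edge 1).
    - exact: (neq 1 3).
    - by apply: contraTneq c_in => ->; exact: (next_notin yK).
  case: l56 => l5; rewrite l5 in jl jl' case_p.
    case: j jl j0 j1 j2 jl' Ew => [|[|[|[|[|]]]]] // _ _ _ _ _ Ew.
    exact: (case_p 4).
  case: j jl j0 j1 j2 jl' Ew => [|[|[|[|[|[|]]]]]] // _ _ _ _ _ Ew; last exact: (case_p 5).
  apply: (@cyc4 (src d) (src (iter 2 f (e d))) (src (iter 3 f d)) (src (iter 4 f d))).
  + by rewrite -F1; exact: (edge' 1).
  + by rewrite Ew; exact: (edge' 2).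
  + exact: edge.
  + by have := edge 4; rewrite f5.
  + exact: (neq 0 3).
  + have : src (iter 2 f (e d)) \in fset (e d) by exact: fset_iter.
    by apply: contraTneq => ->; rewrite -fVd; exact: (prev_notin xK).
- by have := prev_notin xK; rewrite fVd [src _]Ew fset_iter.
Qed.

Lemma tT_len d : tT d -> len d = 3. Proof. by case/andP=> /eqP. Qed.
Lemma t5_len d : t5 d -> len d = 5. Proof. by case/andP=> /eqP. Qed.
Lemma tT_src d x : tT d -> x \in porbit f d -> src x \notin K.
Proof. by case/andP=> _; exact: noK_src. Qed.
Lemma t5_src d x : t5 d -> x \in porbit f d -> src x \notin K.
Proof. by case/andP=> _; exact: noK_src. Qed.
Lemma t5_ends d : t5 d -> src d \notin K /\ tgt d \notin K.
Proof.
move=> H; split; first exact: t5_src H (porbit_id _ _).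
by rewrite -c_src_f; exact: t5_src H (f_in _).
Qed.

Lemma nocyc_m k : k \in [:: 6; 7; 8; 9] -> cyc E k -> k = m.
Proof.
move=> k4 ck; apply/eqP; apply: contraPT ck; apply: nocyc.
by rewrite inE k4 orbT.
Qed.

Lemma t5_t5 d : t5 d -> len (e d) = 5 -> m = 8.
Proof.
move=> H e5; have d5 := t5_len H; have [xK yK] := t5_ends H.
have := @join_cyc2 d; rewrite d5 e5 => J; apply/esym/nocyc_m => //; apply: J => v.
by apply: (dis5 d5 xK yK); left.
Qed.

(** The two faces would bound a 9-cycle. *)
Lemma t5_6 d : t5 d -> len (e d) = 6 -> False.
Proof.
move=> H e5; have d5 := t5_len H; have [xK yK] := t5_ends H.
have := @join_cyc2 d; rewrite d5 e5 => J; apply: no9; apply: J => v.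
by apply: (dis5 d5 xK yK); right.
Qed.

(** A triangle next to a face of length k gives a cycle of length k + 1. This excludes k = 3 and k =
    m, and for k = 5 it forces m = 6. *)
Lemma side3 d : len d = 3 -> (len (e d) = 5 /\ m = 6) \/ 10 <= len (e d).
Proof.
move=> d3; have := face3_cyc d3; case: (len_cases (e d)) => [->|->|->|]; last by right.
- by move/no4.
- by move/nocyc_m=> <-; [left|].
- move=> cm; have : m.+1 \in [:: 6; 7; 8; 9] by move: m678; rewrite !inE => /or3P[]/eqP->.
  by move/nocyc_m/(_ cm) => /eqP; rewrite eqn_leq ltnn.
Qed.

Lemma side_five d : t5 d -> [\/ len (e d) = 3 /\ m = 6, len (e d) = 5 /\ m = 8,
  (len (e d) = m /\ m != 6) | 10 <= len (e d)].
Proof.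
move=> H; case: (len_cases (e d)) => [H1|H1|H1|H1]; last by constructor 4.
- constructor 1; split=> //; case: (side3 H1); rewrite c_eK ?(t5_len H) //.
  by case.
- by constructor 2; rewrite (t5_t5 H H1).
- by constructor 3; split=> //; apply/eqP=> m6; apply: (t5_6 H); rewrite H1.
Qed.

(** A first triangle forces m = 6; going around both of them lengthens the pentagon to a forbidden
    7-cycle. Up to rotation the second triangle is one or two sides further. *)
Lemma five_two_triangles d i : len d = 5 -> len (e d) = 3 -> 0 < i -> i < 5 ->
  len (e (iter i f d)) = 3 -> False.
Proof.
have base d1 i1 : len d1 = 5 -> len (e d1) = 3 -> i1 = 1 \/ i1 = 2 ->
    len (e (iter i1 f d1)) = 3 -> False.
  move=> d5 T1 Hi T2.
  have m6 : m = 6 by case: (side3 T1); rewrite c_eK d5 // => -[].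
  have f5 : iter 5 f d1 = d1 by rewrite -{1}d5 iter_len.
  have neq a b : a < 5 -> b < 5 -> a != b -> src (iter a f d1) != src (iter b f d1).
    by move=> al bl ab; apply: src_iter_neq; rewrite ?d5.
  have edge a : E (src (iter a f d1)) (src (iter a.+1 f d1)) by exact: c_edge.
  have edge5 : E (src (iter 4 f d1)) (src d1) by have := edge 4; rewrite f5.
  have apex g : len (e g) = 3 -> exists z, [/\ E z (src g), E z (tgt g) & z \notin fset g].
    move=> g3; exists (src (f (f (e g)))); split.
    - rewrite -(c_tgt_e g) -(c_src_f (e g)) E_sym; exact: c_edge.
    - have := c_edge (f (f (e g))); rewrite -(c_src_e g).
      by have /= -> : f (f (f (e g))) = e g by rewrite -[RHS](iter_len (e g)) g3.
    - by have := dis3 g3; rewrite c_eK.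
  have [z [zx zy zn]] := apex _ T1; have [z' [zx' zy' zn']] := apex _ T2.
  rewrite (fset_in (face_iter d1 i1)) in zn'.
  have nz a : z != src (iter a f d1) by apply: contraNneq zn => ->; exact: fset_iter.
  have nz' a : z' != src (iter a f d1) by apply: contraNneq zn' => ->; exact: fset_iter.
  rewrite -c_src_f in zy; rewrite -c_src_f in zy'.
  have Z2 : E z' (src (iter 2 f d1)) by case: Hi zx' zy' => ->.
  have zz' : z != z'.
    apply/eqP=> zz; rewrite -zz in Z2.
    apply: (@cyc4 (src d1) (src (iter 1 f d1)) (src (iter 2 f d1)) z) => //.
    - exact: (edge 0).
    - by rewrite E_sym.
    - exact: (neq 0 2).
    - by rewrite eq_sym nz.
  suff : cyc E 7 by move/nocyc_m=> /(_ isT) m7; rewrite m6 in m7.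
  have n01 := neq 0 1 isT isT isT; have n02 := neq 0 2 isT isT isT.
  have n03 := neq 0 3 isT isT isT; have n04 := neq 0 4 isT isT isT.
  have n12 := neq 1 2 isT isT isT; have n13 := neq 1 3 isT isT isT.
  have n14 := neq 1 4 isT isT isT; have n23 := neq 2 3 isT isT isT.
  have n24 := neq 2 4 isT isT isT; have n34 := neq 3 4 isT isT isT.
  have a0 := nz 0; have a1 := nz 1; have a2 := nz 2; have a3 := nz 3; have a4 := nz 4.
  have b0 := nz' 0; have b1 := nz' 1; have b2 := nz' 2; have b3 := nz' 3; have b4 := nz' 4.
  have e01 := edge 0; have e12 := edge 1; have e23 := edge 2; have e34 := edge 3.
  case: Hi zx' zy' => -> zx' zy'.
    exists [:: src d1; z; src (iter 1 f d1); z'; src (iter 2 f d1); src (iter 3 f d1); src (iter 4 f d1)] => //.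
    rewrite /ucycle; apply/andP; split.
      by rewrite /= (E_sym _ z) zx zy (E_sym _ z') zx' zy' e23 e34 edge5.
    by clear -n01 n02 n03 n04 n12 n13 n14 n23 n24 n34 a0 a1 a2 a3 a4 b0 b1 b2 b3 b4 zz'; split_bool.
  exists [:: src d1; z; src (iter 1 f d1); src (iter 2 f d1); z'; src (iter 3 f d1); src (iter 4 f d1)] => //.
  rewrite /ucycle; apply/andP; split.
    by rewrite /= (E_sym _ z) zx zy (E_sym _ z') zx' zy' e12 e34 edge5.
  by clear -n01 n02 n03 n04 n12 n13 n14 n23 n24 n34 a0 a1 a2 a3 a4 b0 b1 b2 b3 b4 zz'; split_bool.
move=> d5 T1; have f5 : iter 5 f d = d by rewrite -{1}d5 iter_len.
have l5 j : len (iter j f d) = 5 by rewrite (len_in (face_iter d j)).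
case: i => [|[|[|[|[|//]]]]] // _ _ T2.
- by apply: (base d 1) => //; left.
- by apply: (base d 2) => //; right.
- by apply: (base (iter 3 f d) 2) => //; [right | rewrite -iterD /= -/(iter 5 f d) f5].
- by apply: (base (iter 4 f d) 1) => //; [left | rewrite -iterD /= -/(iter 5 f d) f5].
Qed.

(** Three pentagons around a 3-vertex form a disc bounded by a 9-cycle. *)
Lemma three_five d : is3 (src d) -> t5 d -> t5 (e d) -> t5 (e (fV d)) -> False.
Proof.
move=> v3 A B C; apply: no9.
have dA := t5_len A; have dB := t5_len B; have dC := t5_len C.
have inV : fV d \in porbit f d := fV_in d.
have rd_in : r d \in porbit f (e d) by rewrite -c_fe f_in.
have dis1 v : v \in fset d -> v \in fset (e d) -> v = src d \/ v = tgt d.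
  by have [xK yK] := t5_ends A; apply: dis5 => //; left.
have dis2 v : v \in fset d -> v \in fset (e (fV d)) -> v = src d \/ v = src (fV d).
  have A' : t5 (fV d) by rewrite (t5_in inV).
  have [xK yK] := t5_ends A'; rewrite -(fset_in inV) => H1 H2.
  case: (dis5 _ xK yK (or_introl dC) H1 H2) => [|->|->]; first exact: t5_len.
    by right.
  by left; rewrite -c_src_f c_fV.
have rr := is3_rr v3.
have in3 : e (r d) \in porbit f (e (fV d)).
  have : f (e (r d)) = e (fV d) by rewrite c_fe rr.
  by move=> <-; rewrite -eq_porbit_mem porbitS.
have dis3' v : v \in fset (e d) -> v \in fset (e (fV d)) -> v = src d \/ v = tgt (r d).
  have B' : t5 (r d) by rewrite (t5_in rd_in).
  have [xK yK] := t5_ends B'; rewrite -(fset_in rd_in) -(fset_in in3) => H1 H2.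
  have dC' : len (e (r d)) = 5 by rewrite (len_in in3).
  case: (dis5 (t5_len B') xK yK (or_introl dC') H1 H2) => ->; last by right.
  by left; rewrite c_src_r.
have f5 g : len g = 5 -> iter 5 f g = g by move=> <-; exact: iter_len.
have neq g a b : len g = 5 -> a < 5 -> b < 5 -> a != b -> src (iter a f g) != src (iter b f g).
  by move=> g5 al bl ab; apply: src_iter_neq; rewrite ?g5.
have edge a g : E (src (iter a f g)) (src (iter a.+1 f g)) by exact: c_edge.
pose x i := src (iter i f d); pose y i := src (iter i f (e d)).
pose g := e (fV d); pose z i := src (iter i f g).
have y0 : y 0 = x 1 by rewrite /y /x /= c_src_e c_src_f.
have y1 : y 1 = src d by rewrite /y /= c_src_f c_tgt_e.
have z0 : z 0 = src d by rewrite /z /g /= c_src_e -c_src_f c_fV.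
have fVd : fV d = iter 4 f d by apply: (@perm_inj _ f); rewrite permKV -[LHS](f5 _ dA).
have z1 : z 1 = x 4 by rewrite /z /g /= c_src_f c_tgt_e fVd.
have f4g : iter 4 f g = e (r d).
  by apply: (@perm_inj _ f); rewrite c_fe rr; exact: (f5 _ dC).
have z4 : z 4 = y 2 by rewrite /z f4g c_src_e /y /= c_fe c_src_f.
have X i : x i \in fset d by exact: fset_iter.
have Y i : y i \in fset (e d) by exact: fset_iter.
have Z i : z i \in fset g by exact: fset_iter.
exists [:: x 1; x 2; x 3; x 4; z 2; z 3; y 2; y 3; y 4] => //.
have xy i j : i < 5 -> j < 5 -> 1 < i -> 1 < j -> x i != y j.
  move=> i5 j5 i1 j1; apply/eqP=> H; case: (dis1 (x i) (X i)); rewrite ?H ?Y // -H.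
    by apply/eqP; apply: (neq d i 0); rewrite // -lt0n ltnW.
  by rewrite -c_src_f; apply/eqP; apply: (neq d i 1) => //; case: i i1 {i5 H} => [|[]].
have x1y j : j < 5 -> 1 < j -> x 1 != y j.
  by move=> j5 j1; rewrite -y0; apply: (neq (e d) 0 j) => //; case: j j1 {j5} => [|[]].
have xz i j : 0 < i -> i < 4 -> 1 < j -> j < 5 -> x i != z j.
  move=> i0 i4 j1 j5; apply/eqP=> H; case: (dis2 (x i) (X i)); rewrite ?H ?Z // -H.
    by apply/eqP; apply: (neq d i 0 dA (leqW i4)); rewrite // -lt0n.
  by rewrite fVd; apply/eqP; apply: (neq d i 4 dA (leqW i4)); rewrite // neq_ltn i4.
have x4z j : j < 5 -> 1 < j -> x 4 != z j.
  by move=> j5 j1; rewrite -z1; apply: (neq g 1 j) => //; case: j j1 {j5} => [|[]].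
have yz i j : 2 < i -> i < 5 -> 1 < j -> j < 4 -> z j != y i.
  move=> i2 i5 j1 j4; apply/eqP=> H; case: (dis3' (y i) (Y i)); rewrite -?H ?Z // H.
    by rewrite -y1; apply/eqP; apply: (neq (e d) i 1) => //; case: i i2 {i5 H} => [|[]].
  rewrite -c_src_f -(c_fe d); apply/eqP; apply: (neq (e d) i 2) => //.
  by case: i i2 {i5 H} => [|[|[]]].
rewrite /ucycle; apply/andP; split.
  rewrite /=; have := edge 1 d; have := edge 2 d; have := edge 3 d.
  have := edge 1 g; have := edge 2 g; have := edge 3 g.
  have := edge 2 (e d); have := edge 3 (e d); have := edge 4 (e d).
  rewrite -!/(x _) -!/(y _) -!/(z _) z1 z4 [y 5](_ : _ = x 1); last first.
    by rewrite -y0 /y; congr src; exact: f5.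
  by do 9 (move=> ->).
have n1 := neq d 1 2 dA isT isT isT; have n2 := neq d 1 3 dA isT isT isT.
have n3 := neq d 1 4 dA isT isT isT; have n4 := neq d 2 3 dA isT isT isT.
have n5 := neq d 2 4 dA isT isT isT; have n6 := neq d 3 4 dA isT isT isT.
have n7 := neq (e d) 2 3 dB isT isT isT; have n8 := neq (e d) 2 4 dB isT isT isT.
have n9 := neq (e d) 3 4 dB isT isT isT; have m1 := neq g 2 3 dC isT isT isT.
have m2 := neq g 2 4 dC isT isT isT; have m3 := neq g 3 4 dC isT isT isT.
rewrite -/(z 2) -/(z 4) -/(z 3) z4 in m2 m3.
rewrite /= !inE !negb_or !andbT -!andbA.
rewrite n1 n2 n3 n4 n5 n6 n7 n8 n9 m1 m2 m3.
by do ?[apply/andP; split]; first [done | by apply: xz | by apply: x4z | by apply: x1y | by apply: xy | by apply: yz].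
Qed.

Lemma fK4 d : f (fV d) = d. Proof. exact: permKV. Qed.
Lemma fVf d : fV (f d) = d. Proof. exact: permK. Qed.

(** Were the apex a 3-vertex, the triangle and the face of [s] would contradict [a3_no_adj]. *)
Lemma T_apex s : tT (e s) -> a3 s ->
  [/\ ~~ is3 (src (f (f (e s)))), src (f (f (e s))) \notin K, E (src (f (f (e s)))) (src s),
      E (src (f (f (e s)))) (tgt s) & src (f (f (e s))) \notin fset s].
Proof.
move=> T a; have T3 := tT_len T.
have n3 : ~~ is3 (src (f (f (e s)))).
  apply/negP=> w3; apply: (a3_no_adj a); apply/forallP=> x; apply/implyP=> /in_face[i].
  rewrite T3 => il ->; case: i il => [|[|[|//]]] _ //=.
    by rewrite c_src_e; exact: a3V a (fset_tgt s).
  by rewrite c_src_f c_tgt_e; exact: a3V a (fset_src _).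
split => //.
- exact: (tT_src T (face_iter (e s) 2)).
- by rewrite -(c_tgt_e s) -(c_src_f (e s)) E_sym; exact: c_edge.
- have := c_edge (f (f (e s))); rewrite -(c_src_e s).
  by have /= -> : f (f (f (e s))) = e s by rewrite -[RHS](iter_len (e s)) T3.
- by apply: contra n3 => /(a3V a).
Qed.

(* The face of c pays across c to a 10-face of 3-vertices surrounded by triangles
   at three prescribed sides. *)
Definition relat c := [&& len (e c) == 10, a3 (e c), tT (e (f (e c))), tT (e (fV (e c)))
  & tT (e (iter 3 fV (e c)))].

Lemma relatP c : relat c ->
  [/\ is3 (src c), is3 (tgt c), tT (e (fV c)), tT (e (f c)) &
      [/\ ~~ is3 (src (fV c)), src (fV c) \notin K, ~~ is3 (src (f (f c))) &
        src (f (f c)) \notin K]].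
Proof.
case/and5P=> _ a T1 T2 _.
have s3 : is3 (src c) by rewrite -c_tgt_e; exact: a3V a (fset_tgt _).
have t3 : is3 (tgt c) by rewrite -c_src_e; exact: a3V a (fset_src _).
have E1 : f (e (f (e c))) = e (fV c) by rewrite (c_fe c) c_fe is3_rr.
have E2 : f (e (f c)) = e (fV (e c)).
  rewrite c_fe -is3_rr ?c_src_e //; congr (r _).
  by rewrite -c_faceE.
have T1' : tT (e (fV c)) by rewrite -E1 (tT_in (f_in _)).
have T2' : tT (e (f c)) by rewrite -(tT_in (f_in _)) E2.
have a1 : a3 (f (e c)) by rewrite (a3_in (f_in _)).
have a2 : a3 (fV (e c)) by rewrite (a3_in (fV_in _)).
have [n1 k1 _ _ _] := T_apex T1 a1; have [n2 k2 _ _ _] := T_apex T2 a2.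
rewrite E1 c_src_f c_tgt_e in n1 k1.
have E3 : f (f (e (fV (e c)))) = e (f c).
  by rewrite -E2 -[RHS](iter_len (e (f c))) (tT_len T2').
rewrite E3 c_src_e -c_src_f in n2 k2.
by [].
Qed.

(** The [x i] run along the 10-face, with triangles on the edges 0-1, 2-3 and 4-5, of apexes [w],
    [u'] and [u]. In [reducible_two], q is [x 2], whose third neighbour is [u'], and q' is [x 1],
    whose third neighbour [w] must avoid both faces. *)
Lemma relat_reducible c : relat c -> 3 < len c ->
  (forall y, y \in fset c -> y != src (fV c) -> y != src (f (f c)) -> is3 y) ->
  #|[set y | E (src (fV c)) y]| = 4 -> #|[set y | E (src (f (f c))) y]| = 4 -> False.
Proof.
move=> Rc lc G3 u4 u'4; have [s3 t3 _ _ [nu ku nu' ku']] := relatP Rc.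
case/and5P: (Rc) => /eqP l10 a T1 T2 T3.
set h := iter 3 fV (e c) in T3.
have h3 : f (f (f h)) = e c by rewrite /h /= !fK4.
have hin i : iter i f h \in porbit f (e c).
  by rewrite -eq_porbit_mem -h3 -permX porbit_perm !porbitS.
have lh : len h = 10 by rewrite (len_in (hin 0)).
have ah i : a3 (iter i f h) by rewrite (a3_in (hin i)).
have fh i : fset (iter i f h) = fset (e c) by rewrite (fset_in (hin i)).
pose x i := src (iter i f h).
have X i : x i \in fset (e c) by rewrite -(fh 0) fset_iter.
have neq i j : i < 10 -> j < 10 -> i != j -> x i != x j.
  by move=> i10 j10; apply: src_iter_neq; rewrite lh.
have edge i : E (x i) (x i.+1) by exact: c_edge.
have x3 : x 3 = tgt c by rewrite /x /= h3 c_src_e.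
have x4 : x 4 = src c by rewrite /x /= h3 c_src_f c_tgt_e.
have E1 : src (f (f (e (iter 4 f h)))) = src (fV c).
  by rewrite /= h3 (c_fe c) c_fe is3_rr // c_src_f c_tgt_e.
have f2h : iter 2 f h = fV (e c) by rewrite -h3 fVf.
have E2 : src (f (f (e (iter 2 f h)))) = src (f (f c)).
  have EE : f (e (f c)) = e (fV (e c)).
    rewrite c_fe -is3_rr ?c_src_e //; congr (r _).
    by rewrite -c_faceE.
  have T2' : tT (e (f c)) by rewrite -(tT_in (f_in _)) EE.
  rewrite f2h -EE (_ : f _ = e (f c)) ?c_src_e ?c_src_f //.
  by rewrite -[RHS](iter_len (e (f c))) (tT_len T2').
have T1h : tT (e (iter 4 f h)) by rewrite /= h3.
have T2h : tT (e (iter 2 f h)) by rewrite f2h.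
have tgtx i : tgt (iter i f h) = x i.+1 by rewrite /x iterS c_src_f.
have [_ _ ux4 ux5 uX] := T_apex T1h (ah 4); have [_ _ u'x2 u'x3 u'X] := T_apex T2h (ah 2).
have [nw _ wx0 wx1 wX] := T_apex T3 (ah 0).
rewrite E1 fh tgtx -/(x 4) in ux4 ux5 uX; rewrite E2 fh tgtx -/(x 2) in u'x2 u'x3 u'X.
rewrite -[h in fset h]/(iter 0 f h) fh in wX.
rewrite -[h in tgt h]/(iter 0 f h) tgtx -/(x 0) in wx1; rewrite -/(x 0) in wx0.
set w := src (f (f (e h))) in nw wx0 wx1 wX.
set u := src (fV c) in u4 nu ku ux4 ux5 uX G3 *; set u' := src (f (f c)) in u'4 nu' ku' u'x2 u'x3 u'X G3 *.
have uG : u \in fset c by exact: fset_prev.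
have u'G : u' \in fset c by exact: (fset_iter _ 2).
have uu' : u != u'.
  have := @src_iter_neq (fV c) 0 3; rewrite (len_in (fV_in _)) /= fK4.
  by apply => //; apply: leq_trans lc.
have Xn v : v \notin fset (e c) -> forall i, v != x i.
  by move=> vX i; apply: contraNneq vX => ->.
(* If [w = u'] there is a 4-cycle. If [w = u] there are both a 6-cycle and a 7-cycle, but only one
   length can be m. *)
have wG : w \notin fset c.
  apply/negP=> wG; have [wu|wu] := eqVneq w u; last first.
    have [wu'|wu'] := eqVneq w u'; last by case/negP: nw; exact: G3.
    apply: (cyc4 (a := x 1) (b := x 2) (c := x 3) (d' := u')) => //.
    - exact: (e_edge u'x3).
    - by rewrite -wu'.
    - exact: (neq 1 3).
    - by rewrite eq_sym Xn.
  have ux1 : E u (x 1) by rewrite -wu.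
  have a1 := Xn _ uX; have a2 := Xn _ u'X.
  have b1 := a1 1; have b2 := a1 2; have b3 := a1 3; have b4 := a1 4; have b5 := a1 5.
  have c1 := a2 1; have c2 := a2 2; have c3 := a2 3; have c4 := a2 4; have c5 := a2 5.
  have n12 := neq 1 2 isT isT isT; have n13 := neq 1 3 isT isT isT.
  have n14 := neq 1 4 isT isT isT; have n15 := neq 1 5 isT isT isT.
  have n23 := neq 2 3 isT isT isT; have n24 := neq 2 4 isT isT isT.
  have n25 := neq 2 5 isT isT isT; have n34 := neq 3 4 isT isT isT.
  have n35 := neq 3 5 isT isT isT; have n45 := neq 4 5 isT isT isT.
  have e12 := edge 1; have e34 := edge 3; have e45 := edge 4.
  have c6 : cyc E 6.
    exists [:: u; x 4; x 3; u'; x 2; x 1] => //; rewrite /ucycle; apply/andP; split.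
      by rewrite /= ux4 (E_sym (x 4)) e34 (E_sym (x 3)) u'x3 u'x2 (E_sym (x 2)) e12 (E_sym _ u) ux1.
    by clear -uu' b1 b2 b3 b4 b5 c1 c2 c3 c4 c5 n12 n13 n14 n15 n23 n24 n25 n34 n35 n45; split_bool.
  have c7 : cyc E 7.
    exists [:: u; x 5; x 4; x 3; u'; x 2; x 1] => //; rewrite /ucycle; apply/andP; split.
      by rewrite /= ux5 (E_sym (x 5)) e45 (E_sym (x 4)) e34 (E_sym (x 3)) u'x3 u'x2 (E_sym (x 2)) e12 (E_sym _ u) ux1.
    by clear -uu' b1 b2 b3 b4 b5 c1 c2 c3 c4 c5 n12 n13 n14 n15 n23 n24 n25 n34 n35 n45; split_bool.
  have E6 : 6 = m by apply: (nocyc_m _ c6).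
  have E7 : 7 = m by apply: (nocyc_m _ c7).
  by rewrite -E6 in E7.
apply: (reducible_two (d := e c) (g := c) (q := x 2) (q' := x 1) (u := u) (u' := u')
  (v := x 4) (a := x 5) (v' := x 3) (w' := src (iter 3 f c)) (w := w)) => //.
- by rewrite E_sym; exact: (edge 1).
- have q3 : is3 (src (iter 2 f h)) by exact: (a3V a (X 2)).
  have nb y := @is3_nbrs (iter 2 f h) y q3.
  have third : u' = tgt (r (iter 2 f h)).
    case: (nb u' (e_edge u'x2)) => // H; exfalso.
      by case/negP: u'X; rewrite H tgtx X.
    by case/negP: u'X; rewrite H /= fVf -/(x 1) X.
  move=> y /nb [->|->|->]; rewrite ?tgtx ?X ?third ?eqxx ?orbT //.
  by rewrite /= fVf -/(x 1) X.
- exact: (e_edge wx1).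
- have := prev_notin (d := e c); rewrite c_src_e c_eK -f2h; apply.
  exact: is3_notK t3.
- exact: (neq 4 2).
- exact: (neq 5 2).
- exact: (neq 4 5).
- exact: (neq 3 2).
- exact: (fset_iter _ 3).
- rewrite x3 -c_src_f; apply: (@src_iter_neq c 3 1) => //.
  by apply: leq_trans lc.
- exact: c_edge.
Qed.

(* A pentagon d, f d, ... with a triangle across d; a slot of a face of 3-vertices
   is a side to which it may have to give 24 units. *)
Definition P0 d := t5 d && tT (e d).
Definition Pok d := [&& P0 d, is3 (src d) & is3 (tgt d)].
Definition PB c := Pok (iter 2 fV c) || Pok (iter 3 fV c).
Definition slot s := tT (e s) || PB (e s).

Lemma a3_tgt s : a3 s -> is3 (tgt s).
Proof. by move=> a; exact: a3V a (fset_tgt s). Qed.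
Lemma a3_src s : a3 s -> is3 (src s).
Proof. by move=> a; exact: a3V a (fset_src s). Qed.

(** Supplies the neighbour of q' outside [H] in the next two reductions. If it is a 3-vertex, two of
    its faces are a pentagon and a triangle, and the third contains [v]; a long face through it
    therefore contains [v] too. *)
Lemma slot_out s v : a3 s -> slot s -> v = src s \/ v = tgt s ->
  exists w, [/\ E v w, w \notin fset s &
    ~~ is3 w \/ is3 w /\ forall c, src c = w -> 5 < len c -> v \in fset c].
Proof.
move=> a; have s3 := a3_src a; have t3 := a3_tgt a.
have sK := is3_notK s3; have tK := is3_notK t3.
case/orP=> [T|/orP[/and3P[/andP[P5 PT] x3 y3]|/and3P[/andP[P5 PT] x3 y3]]] Hv.
- have [n k E1 E2 nin] := T_apex T a; exists (src (f (f (e s)))); split => //; last by left.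
  by case: Hv => ->; exact: e_edge.
- set Q := iter 2 fV (e s) in P5 PT x3 y3.
  have Q2 : f (f Q) = e s by rewrite /Q /= !fK4.
  have l5 := t5_len P5; have f5 : iter 5 f Q = Q by rewrite -{1}l5 iter_len.
  have w3 : ~~ is3 (src (f (f (f (f Q))))).
    apply/negP=> w3; apply: (a3_no_adj a); apply/forallP=> y; apply/implyP.
    rewrite -Q2 !porbitS => /in_face[i]; rewrite l5 => il ->.
    case: i il => [|[|[|[|[|//]]]]] _ //=.
    + by rewrite c_src_f.
    + by rewrite Q2 c_src_e.
    + by rewrite Q2 c_src_f c_tgt_e.
  case: Hv => ->.
    exists (src (f (f (f (f Q))))); split; last by left.
    - by rewrite -c_tgt_e -Q2 -c_src_f; exact: c_edge.
    - by apply: contra w3 => /(a3V a).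
  exists (src (f Q)); split.
  - by rewrite -c_src_e -Q2 E_sym; exact: c_edge.
  - have := prev_notin (d := e s); rewrite c_src_e c_eK -Q2 fVf; exact.
  right; rewrite c_src_f; split => // c /= sc lc.
  have fQ3 : is3 (src (f Q)) by rewrite c_src_f.
  have c3 : src c = src (f Q) by rewrite c_src_f.
  case: (is3_corner fQ3 c3) => Ec.
  - by move: lc; rewrite Ec len_f l5.
  - rewrite Ec -c_fe (fset_in (f_in _)) -c_src_e -Q2.
    by rewrite (c_src_f (f Q)) -(c_src_e (f Q)) fset_src.
  - by move: lc; rewrite Ec fVf (tT_len PT).
- set Q := iter 3 fV (e s) in P5 PT x3 y3.
  have Q3 : f (f (f Q)) = e s by rewrite /Q /= !fK4.
  have l5 := t5_len P5; have f5 : iter 5 f Q = Q by rewrite -{1}l5 iter_len.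
  have w3 : ~~ is3 (src (f (f Q))).
    apply/negP=> w3; apply: (a3_no_adj a); apply/forallP=> y; apply/implyP.
    rewrite -Q3 !porbitS => /in_face[i]; rewrite l5 => il ->.
    case: i il => [|[|[|[|[|//]]]]] _ //=.
    + by rewrite c_src_f.
    + by rewrite Q3 c_src_e.
    + by rewrite Q3 c_src_f c_tgt_e.
  case: Hv => ->; last first.
    exists (src (f (f Q))); split; last by left.
    - by rewrite -c_src_e -Q3 E_sym; exact: c_edge.
    - by apply: contra w3 => /(a3V a).
  exists (src Q); split.
  - by rewrite -c_tgt_e -Q3 -c_src_f -{2}f5; exact: c_edge.
  - have := next_notin (d := e s); rewrite c_tgt_e c_eK -Q3 -[f (f _)]/(iter 5 f Q) f5; exact.
  right; split => // c /= sc lc.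
  case: (is3_corner x3 sc) => Ec.
  - by move: lc; rewrite Ec l5.
  - by move: lc; rewrite Ec -c_fe len_f (tT_len PT).
  - rewrite Ec -(c_tgt_e s) -Q3 (_ : fV Q = f (f (f (f Q)))).
      by rewrite -c_src_f -c_tgt_e fset_tgt.
    by apply: (@perm_inj _ f); rewrite fK4 -[LHS]f5.
Qed.

Lemma slot_len s : slot s -> len (e s) <= 5.
Proof.
case/orP=> [/tT_len->//|/orP[]] /and3P[/andP[/t5_len l5 _] _ _].
  have := len_in (face_iter (iter 2 fV (e s)) 2).
  by rewrite fiter_V l5 => ->.
have := len_in (face_iter (iter 3 fV (e s)) 3).
by rewrite fiter_V l5 => ->.
Qed.

Section Pentagon.
Variable d : D.
Hypothesis dP : Pok d.
Let x i := src (iter i f d).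

Let P5 : t5 d. Proof. by case/and3P: dP => /andP[]. Qed.
Let PT : tT (e d). Proof. by case/and3P: dP => /andP[]. Qed.
Let x3 : is3 (x 0). Proof. by case/and3P: dP. Qed.
Let y3 : is3 (x 1). Proof. by rewrite /x /= c_src_f; case/and3P: dP. Qed.
Let f5 : iter 5 f d = d. Proof. by rewrite -{1}(t5_len P5) iter_len. Qed.
Let neq i j : i < 5 -> j < 5 -> i != j -> x i != x j.
Proof. by move=> i5 j5; apply: src_iter_neq; rewrite (t5_len P5). Qed.
Let edge i : E (x i) (x i.+1). Proof. exact: c_edge. Qed.
Let edge5 : E (x 4) (x 0). Proof. by have := edge 4; rewrite /x f5. Qed.
Let tgtx i : tgt (iter i f d) = x i.+1. Proof. by rewrite /x iterS c_src_f. Qed.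
Let z := src (f (f (e d))).
Let zx : E z (x 0).
Proof. by rewrite /x /= -(c_tgt_e d) -(c_src_f (e d)) E_sym; exact: c_edge. Qed.
Let zy : E z (x 1).
Proof.
have := c_edge (f (f (e d))); rewrite -(tgtx 0) -c_src_e.
by have /= -> : f (f (f (e d))) = e d by rewrite -[RHS](iter_len (e d)) (tT_len PT).
Qed.

(** Concerns the face across [f d], which pays 12 in the exception [ex3]: [x 2] cannot be its only
    vertex that is not a 3-vertex and have degree 4. In [reducible_pair], q is [x 3] and q' is
    [src s], next to it on the face of [b]; the way from that face to [g] leads through [x 4], [x 0]
    and [x 1]. *)
Lemma slot_reducible3 : let b := e (iter 3 f d) in
  a3 b -> slot (f (f b)) -> 5 < len b -> 5 < len (e (iter 2 f d)) -> 5 < len (e (f d)) ->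
  x 2 \notin K -> #|[set y | E (x 2) y]| = 4 ->
  (forall u, u \in fset (e (f d)) -> u != x 2 -> is3 u) -> False.
Proof.
move=> b Ba sl lb lb' lg pK p4 G3.
set s := f (f b) in sl; set g := e (f d) in lg G3; set b' := e (iter 2 f d) in lb'.
have sin : s \in porbit f b by exact: (face_iter b 2).
have Bs : fset s = fset b by rewrite (fset_in sin).
have as' : a3 s by rewrite (a3_in sin).
have p3 : ~~ is3 (x 2) by rewrite /is3 p4 andbF.
have qb : tgt b = x 3 by rewrite /b c_tgt_e.
have q3 : is3 (x 3) by rewrite -qb a3_tgt.
have rb : src b = x 4 by rewrite /b c_src_e tgtx.
have fb : f b = r (iter 3 f d) by rewrite /b c_fe.
have v1E : src s = tgt (f b) by rewrite /s c_src_f.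
have [w [v1w wb Hw]] := slot_out as' sl (or_introl (erefl _)).
have v13 : is3 (src s) := a3_src as'.
have qv1 : E (x 3) (src s) by rewrite -qb -c_src_f /s; exact: c_edge.
have v1r : src s != x 4.
  rewrite v1E fb; apply/negP=> /eqP H; have := cr_r_neq Hc (iter 3 f d).
  by rewrite (@dart_eq _ _ (r (iter 3 f d)) (iter 3 f d)) ?eqxx ?c_src_r // H tgtx.
have pb : x 2 \notin fset b by apply: contra p3 => /(a3V Ba).
have srcg : src g = x 2 by rewrite /g c_src_e (tgtx 1).
have tgtg : tgt g = x 1 by rewrite /g c_tgt_e.
have gb' : b' \notin porbit f g.
  apply/negP=> H; have Hf : f b' \in porbit f g by rewrite -eq_porbit_mem porbitS eq_porbit_mem.
  have := c_simple Hf; rewrite c_src_f c_tgt_e => /(_ (esym srcg)) Ef.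
  case/negP: pK; apply: (rr_K (d := iter 2 f d)).
  by rewrite -(c_fe (iter 2 f d)) -/b' Ef -c_faceE.
have rrq : r (r (iter 3 f d)) = b' by rewrite is3_rr //= fVf.
have hE : fV b' = e (r (iter 3 f d)).
  apply: (can_inj c_eK); rewrite c_eK; apply: (@perm_inj _ r).
  by rewrite rrq -c_faceE fK4.
have srch : src (fV b') = src s by rewrite hE c_src_e v1E fb.
(* The faces at the 3-vertex [x 3] are the pentagon and those of [b] and [b']; none of them is the
   face of [g]. *)
have corner c : c \in porbit f g -> src c != x 3.
  move=> cg; apply/eqP=> cq; case: (is3_corner q3 cq) => Ec; rewrite Ec in cg.
  - by move: lg; rewrite -(len_in cg) len_f !len_f (t5_len P5).
  - case/negP: pb; rewrite -srcg -(fset_in (f_in b)) fb (fset_in cg); exact: fset_src.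
  - by case/negP: gb'; move: cg; rewrite /= fVf.
have qG : x 3 \notin fset g.
  by apply/negP=> /imsetP[c /corner /negP H /eqP]; rewrite eq_sym.
(* If [w] is not a 3-vertex it must be [x 2], and [src s] to [x 2] is a chord of the face of [b'].
   Otherwise [slot_out] puts [src s] on [g], yet its faces are those of [b] and [b'] and the short
   one across the slot. *)
have wG : w \notin fset g.
  apply/negP=> wG; case: Hw => [nw|[w3 Hw]].
    have Ew : w = x 2 by apply/eqP; apply: contraNT nw; exact: G3.
    have lh : 5 < len (fV b') by rewrite (len_in (fV_in _)).
    have := @no_chord (fV b') 0 2 isT (ltn_trans (isT : 2 < 5) lh).
    rewrite /= fK4 srch c_src_f c_tgt_e -/(x 2) -Ew => /(_ v1w)[//|[_ H]].
    by rewrite -H in lh.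
  case/imsetP: wG => c cg Ew.
  have {Hw} : src s \in fset c by apply: Hw; [exact: esym | rewrite (len_in cg)].
  rewrite (fset_in cg) => /imsetP[c' c'g /esym sc'].
  case: (is3_corner v13 sc') => Ec; rewrite Ec in c'g.
  - by case/negP: pb; rewrite -srcg -Bs (fset_in c'g) fset_src.
  - by move: lg; rewrite -(len_in c'g) -c_fe len_f ltnNge slot_len.
  - case/negP: gb'; move: c'g; rewrite /s fVf fb -hE.
    by rewrite -eq_porbit_mem porbitSV eq_porbit_mem.
have wx : w != x 0.
  apply/eqP=> Ew; rewrite Ew in v1w.
  case: (is3_nbrs x3 (e_edge v1w)) => H.
  - have := @no_chord d 1 3 isT; rewrite (t5_len P5) => /(_ isT) nc.
    by case: nc => [|//|[]//]; rewrite -/(x 1) -/(x 3) -(tgtx 0) -H E_sym.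
  - have Ez : src s = z by rewrite H /z c_fe c_src_f.
    apply: (cyc4 (a := src s) (b := x 3) (c := x 2) (d' := x 1)).
    + exact: (e_edge qv1).
    + by rewrite E_sym; exact: edge.
    + by rewrite E_sym; exact: edge.
    + by rewrite Ez E_sym.
    + by apply: contraNneq p3 => <-.
    + exact: neq.
  - case/eqP: v1r; rewrite H /x; congr src; apply: (@perm_inj _ f); rewrite fK4 -[LHS]f5.
    by [].
apply: (reducible_pair (b := b) (g := g) (q := x 3) (rr := x 4) (v1 := src s) (p := x 2)
  (x := x 0) (y := x 1) (y2 := src (fV g)) (w := w)) => //.
- by rewrite -qb fset_tgt.
- by rewrite -rb fset_src.
- by rewrite -Bs fset_src.
- exact: neq.
- by rewrite eq_sym edge_neq.
- move=> u /(is3_nbrs q3) [->|->|->]; rewrite ?tgtx ?eqxx //.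
    by rewrite v1E fb eqxx orbT.
  by rewrite /= fVf eqxx !orbT.
- by rewrite -srcg fset_src.
- exact: neq.
- by rewrite E_sym.
- by rewrite E_sym; exact: edge.
- by rewrite -tgtg fset_tgt.
- exact: fset_prev.
- rewrite -tgtg -c_src_f; have lg' : 2 < len (fV g).
    by rewrite (len_in (fV_in _)) (ltn_trans _ lg).
  by have := @src_iter_neq (fV g) 2 0 lg' (ltn_trans _ lg') isT; rewrite /= fK4; apply.
- by rewrite E_sym; exact: edge.
- by rewrite -srcg E_sym; have := c_edge (fV g); rewrite fK4.
- by rewrite -Bs.
Qed.

(** The mirror image of [slot_reducible3], for the exception [ex2]. *)
Lemma slot_reducible2 : let b := e (iter 2 f d) in
  a3 b -> slot (fV (fV b)) -> 5 < len b -> 5 < len (e (iter 3 f d)) ->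
  5 < len (e (iter 4 f d)) -> x 4 \notin K -> #|[set y | E (x 4) y]| = 4 ->
  (forall u, u \in fset (e (iter 4 f d)) -> u != x 4 -> is3 u) -> False.
Proof.
move=> b Ba sl lb lb' lg pK p4 G3.
set s := fV (fV b) in sl; set g := e (iter 4 f d) in lg G3; set b' := e (iter 3 f d) in lb'.
have sin : s \in porbit f b by rewrite -eq_porbit_mem !porbitSV.
have Bs : fset s = fset b by rewrite (fset_in sin).
have as' : a3 s by rewrite (a3_in sin).
have p3 : ~~ is3 (x 4) by rewrite /is3 p4 andbF.
have qb : src b = x 3 by rewrite /b c_src_e tgtx.
have q3 : is3 (x 3) by rewrite -qb a3_src.
have rb : tgt b = x 2 by rewrite /b c_tgt_e.
set h := fV b; have fs : f s = h by rewrite /s fK4.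
have v1E : tgt s = src h by rewrite -c_src_f fs.
have [w [v1w wb Hw]] := slot_out as' sl (or_intror (erefl _)).
have v13 : is3 (tgt s) := a3_tgt as'.
have rrq : r (r (iter 3 f d)) = b by rewrite is3_rr //= fVf.
have hE : e h = r (iter 3 f d).
  by apply: (@perm_inj _ r); rewrite rrq -c_faceE /h fK4.
have fb' : f b' = e h by rewrite /b' c_fe hE.
have v1b' : tgt s = src (f (f b')) by rewrite fb' c_src_f c_tgt_e v1E.
have qv1 : E (x 3) (tgt s).
  by rewrite v1E -qb E_sym; have := c_edge h; rewrite fK4.
have v1r : tgt s != x 2.
  rewrite v1E -rb; apply/negP=> /eqP H; have := cr_r_neq Hc (r (iter 3 f d)).
  have Eb : b = r (iter 3 f d).
    by apply: dart_eq; rewrite ?c_src_r ?qb // -hE c_tgt_e H.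
  by rewrite rrq Eb eqxx.
have pb : x 4 \notin fset b by apply: contra p3 => /(a3V Ba).
have srcg : src g = x 0 by rewrite /g c_src_e tgtx /x f5.
have tgtg : tgt g = x 4 by rewrite /g c_tgt_e.
have srcb' : src b' = x 4 by rewrite /b' c_src_e tgtx.
have gb' : b' \notin porbit f g.
  apply/negP=> H; have Hf : b' \in porbit f (f g) by rewrite porbitS.
  have := c_simple Hf; rewrite c_src_f srcb' => /(_ (esym tgtg)) Ef.
  case/negP: pK; apply: (rr_K (d := iter 4 f d)).
  by rewrite -(c_fe (iter 4 f d)) -/g -Ef -c_faceE.
have corner c : c \in porbit f g -> src c != x 3.
  move=> cg; apply/eqP=> cq; case: (is3_corner q3 cq) => Ec; rewrite Ec in cg.
  - by move: lg; rewrite -(len_in cg) len_f !len_f (t5_len P5).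
  - case/negP: gb'; move: cg; rewrite -hE -fb'.
    by rewrite -eq_porbit_mem porbitS eq_porbit_mem.
  - case/negP: pb; rewrite -tgtg; move: cg; rewrite /= fVf -/b => cg.
    by rewrite (fset_in cg) fset_tgt.
have qG : x 3 \notin fset g.
  by apply/negP=> /imsetP[c /corner /negP H /eqP]; rewrite eq_sym.
have wG : w \notin fset g.
  apply/negP=> wG; case: Hw => [nw|[w3 Hw]].
    have Ew : w = x 4 by apply/eqP; apply: contraNT nw; exact: G3.
    have := @no_chord b' 0 2 isT (ltn_trans (isT : 2 < 5) lb').
    rewrite /= -v1b' srcb' -Ew E_sym => /(_ v1w)[//|[_ H]].
    by rewrite -H in lb'.
  case/imsetP: wG => c cg Ew.
  have {Hw} : tgt s \in fset c by apply: Hw; [exact: esym | rewrite (len_in cg)].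
  rewrite (fset_in cg) v1E => /imsetP[c' c'g /esym sc'].
  rewrite v1E in v13; case: (is3_corner v13 sc') => Ec; rewrite Ec in c'g.
  - case/negP: pb; rewrite -tgtg -(fset_in (fV_in b)) -/h (fset_in c'g).
    exact: fset_tgt.
  - case/negP: gb'; move: c'g; rewrite -c_fe -fb'.
    by rewrite -eq_porbit_mem !porbitS eq_porbit_mem.
  - by move: lg; rewrite -(len_in c'g) ltnNge; rewrite slot_len.
have wx : w != x 1.
  apply/eqP=> Ew; rewrite Ew in v1w.
  case: (is3_nbrs y3 (e_edge v1w)) => H.
  - by case/eqP: v1r; rewrite H -(tgtx 1).
  - have Ez : tgt s = z.
      have y3' : is3 (src (e d)) by rewrite c_src_e (tgtx 0).
      have fVe : fV (e d) = f (f (e d)).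
        by apply: (@perm_inj _ f); rewrite fK4 -[LHS](iter_len (e d)) (tT_len PT).
      by rewrite H /= c_faceE (is3_rr y3') c_tgt_e fVe.
    apply: (cyc4 (a := tgt s) (b := x 3) (c := x 4) (d' := x 0)).
    + exact: (e_edge qv1).
    + exact: edge.
    + exact: edge5.
    + by rewrite Ez E_sym.
    + by apply: contraNneq p3 => <-.
    + exact: neq.
  - have := @no_chord d 0 3 isT; rewrite (t5_len P5) => /(_ isT) nc.
    case: nc => [|//|[]//]; rewrite -/(x 0) -/(x 3) E_sym.
    by move: qv1; rewrite H /= fVf.
apply: (reducible_pair (b := b) (g := g) (q := x 3) (rr := x 2) (v1 := tgt s) (p := x 4)
  (x := x 1) (y := x 0) (y2 := src (f (f g))) (w := w)) => //.
- by rewrite -qb fset_src.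
- by rewrite -rb fset_tgt.
- by rewrite -Bs fset_tgt.
- exact: neq.
- by rewrite eq_sym edge_neq.
- move=> u /(is3_nbrs q3) [->|->|->]; rewrite ?tgtx ?eqxx ?orbT //.
    by rewrite v1E -hE c_tgt_e eqxx orbT.
  by rewrite /= fVf eqxx.
- by rewrite -tgtg fset_tgt.
- exact: neq.
- by rewrite -srcg fset_src.
- exact: (fset_iter _ 2).
- rewrite -srcg; have lg' : 2 < len g by rewrite (ltn_trans _ lg).
  by apply: (@src_iter_neq g 0 2 (ltn_trans _ lg') lg').
- by rewrite -tgtg -c_src_f; exact: c_edge.
- by rewrite -Bs.
Qed.

End Pentagon.

(** * Discharging *)

(* Faces in need: triangles (tT), pentagons next to a needy triangle (tP), other
   pentagons (tF). The triangles meeting K are tS, and tO are the faces that pay. *)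
Definition tP d := t5 d && [exists x in porbit f d, tT (e x)].
Definition tF d := t5 d && ~~ tP d.
Definition tS d := (len d == 3) && ~~ noK d.
Definition tO d := ~~ [|| tT d, t5 d | tS d].

Definition ctype d : corner_type :=
  if tT d || tP d then TypeH else if tF d then TypeF else if tS d then TypeS else TypeO.

Lemma tP_in x d : x \in porbit f d -> tP x = tP d.
Proof.
move=> xd; rewrite /tP (t5_in xd); congr (_ && _).
by move: xd; rewrite -eq_porbit_mem => /eqP->.
Qed.
Lemma tF_in x d : x \in porbit f d -> tF x = tF d.
Proof. by move=> xd; rewrite /tF (t5_in xd) (tP_in xd). Qed.
Lemma tS_in x d : x \in porbit f d -> tS x = tS d.
Proof. by move=> xd; rewrite /tS (len_in xd) (noK_in xd). Qed.
Lemma tO_in x d : x \in porbit f d -> tO x = tO d.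
Proof. by move=> xd; rewrite /tO (t5_in xd) (tT_in xd) (tS_in xd). Qed.
Lemma ctype_in x d : x \in porbit f d -> ctype x = ctype d.
Proof. by move=> xd; rewrite /ctype (tT_in xd) (tP_in xd) (tF_in xd) (tS_in xd). Qed.

(* The pentagon d, f d, ... has a triangle across d; A pays across the side
   f^i d the amount given by pent_i. *)
Definition ex3 d := [&& Pok d, a3 (e (iter 3 f d)), len (e (iter 3 f d)) == 10
  & slot (f (f (e (iter 3 f d))))].
Definition ex2 d := [&& Pok d, a3 (e (iter 2 f d)), len (e (iter 2 f d)) == 10
  & slot (fV (fV (e (iter 2 f d))))].
Definition pent1 d := if ~~ is3 (tgt d) then 24 else if ex3 d then 12 else 0.
Definition pent4 d := if ~~ is3 (src d) then 24 else if ex2 d then 12 else 0.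
Definition pent3 d :=
  if is3 (src d) && is3 (tgt d) then if ex3 d then 12 else 24
  else if (is3 (src d) || is3 (tgt d)) && ~~ a3 (e (iter 3 f d)) then 24 else 0.
Definition pent2 d :=
  if is3 (src d) && is3 (tgt d) then if ex2 d then 12 else 24
  else if (is3 (src d) || is3 (tgt d)) && a3 (e (iter 3 f d)) then 24 else 0.
Definition pent c :=
  if tT (e (fV c)) then pent1 (fV c) else if tT (e (iter 2 fV c)) then pent2 (iter 2 fV c)
  else if tT (e (iter 3 fV c)) then pent3 (iter 3 fV c)
  else if tT (e (iter 4 fV c)) then pent4 (iter 4 fV c) else 0.

Definition costF c := if a3 (e c) then 8
  else if is3 (src c) && is3 (tgt c) then if m == 8 then 6 else 0 else 12.

(* What the face of c gives to the face of e c, in units of 1/24. *)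
Definition transfer c : nat :=
  if tT (e c) then 24 else if ~~ tO c then 0 else if tP (e c) then pent (e c)
  else if tF (e c) then costF c else if relat c then 6 else 0.

Definition two d := (#|K| == 2) && (K \subset fset d).
(** Being excused 144, a vertex of [K] can give 48 per face on average. A triangle lacks 72, taken
    from one vertex of [K] or by halves from two. A pentagon with a triangle beside it at this
    vertex gets only 24, which keeps consecutive faces within 96. *)
Definition giftK d := if len d == 3 then if two d then 36 else 72
  else if len d == 5 then
    if [|| two d, len (r d) == 3 | len ((r^-1)%g d) == 3] then 24 else 48
  else 12.

(* What the vertex src d gives to the face of d, in the same units. *)
Definition vgift d : nat :=
  if src d \in K then giftK d else if is3 (src d) then 0
  else gift (#|porbit r d| == 4) (ctype d) (ctype (r d)) (ctype ((r^-1)%g d)).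

Lemma sum_iter (p : {perm D}) (g : D -> nat) d :
  \sum_(x in porbit p d) g x = \sum_(i < #|porbit p d|) g (iter i p d).
Proof.
rewrite (eq_bigl (mem (traject p d #|porbit p d|))); last by move=> x; rewrite /= porbit_traject.
rewrite -big_uniq ?uniq_traject_porbit //= /traject.
transitivity (\sum_(x <- [seq iter i p d | i <- iota 0 #|porbit p d|]) g x).
  congr (\sum_(x <- _) g x); elim: #|_| {1 3}d => // n IHn x.
  rewrite /= IHn; congr cons; rewrite (iotaDl 1 0) -map_comp.
  by apply: eq_map => i /=; rewrite -iterSr.
by rewrite big_map -{1}[#|_|]subn0 -/(index_iota 0 _) big_mkord.
Qed.

Lemma sum_shift (p : {perm D}) (g : D -> nat) d :
  \sum_(x in porbit p d) g (p x) = \sum_(x in porbit p d) g x.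
Proof.
rewrite [RHS](reindex_inj (@perm_inj _ p)) /=; apply: eq_bigl => x.
by rewrite -!eq_porbit_mem porbitS.
Qed.

Lemma sum_shiftV (p : {perm D}) (g : D -> nat) d :
  \sum_(x in porbit p d) g (p^-1 x)%g = \sum_(x in porbit p d) g x.
Proof. by rewrite -sum_shift; apply: eq_bigr => x _; rewrite permK. Qed.

Lemma vgift_vertex d : src d \notin K ->
  \sum_(x in porbit r d) vgift x + 144 <= 48 * #|porbit r d|.
Proof.
move=> dK; have deg3 := cr_deg Hc dK.
have srcx x : x \in porbit r d -> src x = src d.
  by rewrite (porbit_rP (cr_map Hc)) => /eqP.
have degx x : x \in porbit r d -> #|porbit r x| = #|porbit r d|.
  by rewrite -eq_porbit_mem => /eqP->.
have [d3|nd3] := boolP (is3 (src d)).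
  rewrite big1 => [|x /srcx Ex]; last by rewrite /vgift Ex (negPf dK) d3.
  by rewrite add0n; move: deg3; case: #|_| => [|[|[|n]]] // _; rewrite !mulnS; lia.
have vE x : x \in porbit r d ->
    vgift x = gift (#|porbit r d| == 4) (ctype x) (ctype (r x)) (ctype ((r^-1)%g x)).
  by move=> xd; rewrite /vgift (srcx _ xd) (negPf dK) (negPf nd3) degx.
rewrite (eq_bigr _ vE) {vE}.
have n3 : #|porbit r d| != 3.
  by move: nd3; rewrite /is3 dK /= -deg_card.
have rV i : (r^-1)%g (iter i.+1 r d) = iter i r d by rewrite /= permK.
have rV0 n : #|porbit r d| = n.+1 -> (r^-1)%g d = iter n r d.
  move=> Hn; apply: (@perm_inj _ r); rewrite permKV.
  by rewrite -[LHS](iter_porbit r d) Hn.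
have [d4|n4] := eqVneq #|porbit r d| 4.
  rewrite sum_iter d4 !big_ord_recr big_ord0 /= !permK (rV0 3 d4).
  have E4 : r (r (r (r d))) = d by have := iter_porbit r d; rewrite d4.
  rewrite E4 add0n /=.
  have := gift4 (ctype d) (ctype (r d)) (ctype (r (r d))) (ctype (r (r (r d)))).
  by lia.
have [d5|n5] := eqVneq #|porbit r d| 5.
  rewrite sum_iter d5 !big_ord_recr big_ord0 /= !permK (rV0 4 d5).
  have E5 : r (r (r (r (r d)))) = d by have := iter_porbit r d; rewrite d5.
  rewrite E5 add0n /=.
  have := gift5 (ctype d) (ctype (r d)) (ctype (r (r d))) (ctype (r (r (r d)))) (ctype (r (r (r (r d))))).
  by lia.
have ge6 : 6 <= #|porbit r d| by move: deg3 n3 n4 n5; case: #|_| => [|[|[|[|[|[|]]]]]].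
suff : \sum_(x in porbit r d) gift false (ctype x) (ctype (r x)) (ctype ((r^-1)%g x)) <= 24 * #|porbit r d|.
  by move: ge6; lia.
apply: (@leq_trans (\sum_(x in porbit r d) (half_gift (ctype x) (ctype (r x)) +
     half_gift (ctype x) (ctype ((r^-1)%g x))))).
  by apply: leq_sum => x _; exact: gift_half.
rewrite big_split /= -[X in _ + X]sum_shift -big_split /=.
apply: (@leq_trans (\sum_(x in porbit r d) 24)); last by rewrite sum_nat_const mulnC.
by apply: leq_sum => x _; rewrite permK; exact: half_gift_sym.
Qed.

Lemma giftK_pair d : giftK d + giftK (r d) <= 96.
Proof.
have lr : len (r d) = len (e d) by rewrite -c_fe len_f.
rewrite /giftK permK lr.
case: (eqVneq (len d) 3) => [d3|nd3].
  case: (side3 d3) => [[-> _]|l10]; first by rewrite /= !orbT; case: two.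
  by case: (len (e d)) l10 => [|[|[|[|[|[|n]]]]]] //= _; case: two.
case: (eqVneq (len (e d)) 3) => [e3|ne3].
  by rewrite orbT /=; case: (two (r d)); case: (len d == 5).
by case: (len d == 5); case: (len (e d) == 5); rewrite /=; do ?case: ifP.
Qed.

Lemma giftK_two d : src d \in K -> tgt d \in K -> #|K| = 2 -> giftK d <= 36 /\ giftK (r d) <= 36.
Proof.
move=> sK tK K2.
have KE g : src d \in fset g -> tgt d \in fset g -> two g.
  move=> sg tg; rewrite /two K2 eqxx /=.
  have /eqP <- : [set src d; tgt d] == K.
    rewrite eqEcard cards2 (src_neq_tgt (cr_irr Hc) d) K2 leqnn andbT.
    by apply/subsetP=> v; rewrite !inE => /orP[]/eqP->.
  by apply/subsetP=> v; rewrite !inE => /orP[]/eqP->.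
rewrite /giftK !KE /= ?(fset_src, fset_tgt) //; first by split; do ?case: ifP.
  by rewrite -c_src_r fset_src.
by rewrite -c_fe (fset_in (f_in (e d))) -c_src_e fset_src.
Qed.

Lemma vgift_K d : src d \in K -> \sum_(x in porbit r d) vgift x <= 48 * #|porbit r d|.
Proof.
move=> dK; rewrite (eq_bigr giftK) => [|x]; last first.
  by rewrite (porbit_rP (cr_map Hc)) => /eqP Ex; rewrite /vgift -Ex dK.
rewrite -leq_double -mul2n mulSn mul1n -{2}(sum_shift r giftK) -big_split /=.
apply: (@leq_trans (\sum_(x in porbit r d) 96)).
  by apply: leq_sum => x _; exact: giftK_pair.
by rewrite sum_nat_const mulnC; move: #|porbit r d| => n; lia.
Qed.

(** The slack that makes the count strict for two precoloured vertices: on both sides of the edge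
    joining them the gifts are at most 36, well below an average of 48. *)
Lemma vgift_K_two d : src d \in K -> tgt d \in K -> #|K| = 2 ->
  \sum_(x in porbit r d) vgift x < 48 * #|porbit r d|.
Proof.
move=> dK tK K2; rewrite (eq_bigr giftK) => [|x]; last first.
  by rewrite (porbit_rP (cr_map Hc)) => /eqP Ex; rewrite /vgift -Ex dK.
rewrite -ltn_double -mul2n mulSn mul1n -{2}(sum_shift r giftK) -big_split /=.
apply: (@leq_trans (\sum_(x in porbit r d) 96)); last first.
  by rewrite sum_nat_const mulnC; move: #|porbit r d| => n; lia.
rewrite (bigD1 d) ?porbit_id //= [X in _ < X](bigD1 d) ?porbit_id //=.
have [H1 H2] := giftK_two dK tK K2.
rewrite -addSn leq_add //; first by move: H1 H2; lia.
by apply: leq_sum => x _; exact: giftK_pair.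
Qed.

(** Transfers cancel in the sum over faces, and vertices give at most 48 deg - 144, or 48 deg on
    [K]. With Euler's formula, 288 times the number of components is at most 144 times #|K|, with
    strict inequality for #|K| = 2; as #|K| <= 2, this is absurd. *)
Theorem discharging : (forall d, \sum_(x in porbit f d) transfer x + 144 <=
    24 * len d + \sum_(x in porbit f d) vgift x + \sum_(x in porbit f d) transfer (e x)) -> False.
Proof.
move=> Hface; pose N := #|D|.
have const_sum (p : {perm D}) n : \sum_(A in porbits p) \sum_(x in A) n = n * N.
  by rewrite -sum_porbits sum_nat_const mulnC.
have const_sum2 (p : {perm D}) n : \sum_(A in porbits p) n = n * #|porbits p|.
  by rewrite sum_nat_const mulnC.
have Sf : 144 * #|porbits f| <= 24 * N + \sum_x vgift x.
  have : \sum_(A in porbits f) (\sum_(x in A) transfer x + 144) <=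
      \sum_(A in porbits f) (\sum_(x in A) 24 + \sum_(x in A) vgift x + \sum_(x in A) transfer (e x)).
    apply: leq_sum => _ /imsetP[d _ ->]; apply: leq_trans (Hface d) _.
    by rewrite sum_nat_const mulnC.
  rewrite !big_split /= (const_sum f 24) (const_sum2 f 144) -!sum_porbits.
  have -> : \sum_x transfer (e x) = \sum_x transfer x by rewrite [RHS](reindex_inj (@perm_inj _ e)).
  by move: (N) #|porbits f| (\sum_x transfer x) (\sum_x vgift x) => *; lia.
pose OK := [set A in porbits r | [exists x in A, src x \in K]].
(* Equality may fail, since a vertex of [K] without darts has no orbit. *)
have cOK : #|OK| <= #|K|.
  apply: leq_trans (leq_imset_card (fun v => [set x : D | src x == v]) _).
  apply/subset_leq_card/subsetP=> A; rewrite inE => /andP[/imsetP[d _ ->] /existsP[x /andP[xd xK]]].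
  apply/imsetP; exists (src x) => //; apply/setP=> y; rewrite inE.
  move: xd; rewrite !(porbit_rP (cr_map Hc)) => /eqP->; exact: eq_sym.
have HA A : A \in porbits r -> \sum_(x in A) vgift x + 144 <= \sum_(x in A) 48 + (A \in OK) * 144.
  move=> Ar; case/imsetP: (Ar) => d _ EA; rewrite sum_nat_const mulnC.
  case: (boolP (A \in OK)) => [|nOK].
    rewrite inE Ar => /existsP[x /andP[]]; rewrite EA (porbit_rP (cr_map Hc)) => /eqP sx xK.
    by rewrite mul1n leq_add2r; apply: vgift_K; rewrite sx.
  rewrite mul0n addn0 EA; apply: vgift_vertex; apply: contra nOK => dK; rewrite inE Ar.
  by apply/existsP; exists d; rewrite EA porbit_id.
have SOK : \sum_(A in porbits r) (A \in OK) * 144 = 144 * #|OK|.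
  rewrite -big_distrl /= mulnC -sum1_card; congr (_ * _).
  rewrite [RHS](eq_bigl (fun A => (A \in porbits r) && (A \in OK))); last first.
    by move=> A; rewrite inE andbA andbb.
  by rewrite [RHS]big_mkcondr.
have Sr : \sum_x vgift x + 144 * #|porbits r| + (#|K| == 2) <= 48 * N + 144 * #|K|.
  have Hsum : \sum_(A in porbits r) (\sum_(x in A) vgift x + 144) + (#|K| == 2) <=
     \sum_(A in porbits r) (\sum_(x in A) 48 + (A \in OK) * 144).
    case: (boolP (#|K| == 2)) => [/eqP K2|_]; last first.
      by rewrite addn0; apply: leq_sum => A; exact: HA.
    have [K0 _ Kc] := cr_clique Hc; have /card_gt0P[u uK] := K0.
    have : 0 < #|K :\ u| by have := cardsD1 u K; rewrite uK K2; lia.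
    case/card_gt0P=> v; rewrite !inE => /andP[vu vK].
    have uv : u != v by rewrite eq_sym.
    have [d [sd td]] := edge_dart (Kc u v uK vK uv).
    have rd : porbit r d \in porbits r by apply: imset_f.
    rewrite (bigD1 _ rd) /= [X in _ <= X](bigD1 _ rd) /=.
    have dOK : porbit r d \in OK.
      by rewrite inE rd; apply/existsP; exists d; rewrite porbit_id sd uK.
    have := vgift_K_two (d := d); rewrite sd td => /(_ uK vK K2).
    rewrite dOK sum_nat_const mulnC => H1.
    have : \sum_(A in porbits r | A != porbit r d) (\sum_(x in A) vgift x + 144) <=
      \sum_(A in porbits r | A != porbit r d) (\sum_(x in A) 48 + (A \in OK) * 144).
      by apply: leq_sum => A /andP[Ar _]; exact: HA.
    have key (a b c c' : nat) : a < b -> c <= c' -> (a + 144) + c + 1 <= (b + 144) + c'.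
      by clear; lia.
    exact: key H1.
  move: Hsum; rewrite !big_split /= SOK (const_sum r 48) (const_sum2 r 144) -!sum_porbits.
  by move: cOK; move: (N) #|porbits r| #|OK| (\sum_x vgift x) => *; lia.
have gen := plane_genus (cr_map Hc); rewrite /genus0 -/N in gen.
have ce := card_porbits_e (cr_irr Hc) (cr_map Hc); rewrite -/N in ce.
have [_ K2 _] := cr_clique Hc.
have c1 : 0 < ncomp e r.
  have [d0 _] := cr_big Hc; rewrite /ncomp /nclasses.
  by apply/card_gt0P; exists [set y | conn e r d0 y]; apply: imset_f.
rewrite -[(e * r)%g]/f in gen.
have final (n fe fr ff c k s : nat) : n + c.*2 <= fe + fr + ff -> fe.*2 = n -> 0 < c ->
    k <= 2 -> 144 * ff <= 24 * n + s -> s + 144 * fr + (k == 2) <= 48 * n + 144 * k -> False.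
  by clear; lia.
exact: final gen ce c1 K2 Sf Sr.
Qed.

(** * Balance of the short faces *)

Definition face_ok d := \sum_(x in porbit f d) transfer x + 144 <=
  24 * len d + \sum_(x in porbit f d) vgift x + \sum_(x in porbit f d) transfer (e x).

Lemma face_ok_in x d : x \in porbit f d -> face_ok x -> face_ok d.
Proof. by move=> xd; rewrite /face_ok (len_in xd) (porb_eq xd). Qed.

Lemma sum_ge1 (A : {set D}) (g : D -> nat) x : x \in A -> g x <= \sum_(y in A) g y.
Proof. by move=> xA; rewrite (bigD1 x) //= leq_addr. Qed.

Lemma sum_ge2 (A : {set D}) (g : D -> nat) x y : x \in A -> y \in A -> x != y ->
  g x + g y <= \sum_(z in A) g z.
Proof.
move=> xA yA xy; rewrite (bigD1 x) //= (bigD1 y) /=; last by rewrite yA eq_sym.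
by rewrite addnA leq_addr.
Qed.

Lemma sum_eq1 (A : {set D}) x : x \in A -> \sum_(y in A) (y == x : nat) = 1.
Proof.
move=> xA; rewrite (bigD1 x) //= eqxx big1 // => y /andP[_ /negPf->].
by [].
Qed.

(** Applied to sides both of whose ends are 3-vertices: any other vertex spoils the two sides at
    it. *)
Lemma sum_lt_len (g : pred D) d x : x \in porbit f d -> ~~ g x -> ~~ g (fV x) ->
  \sum_(y in porbit f d) (g y : nat) + 2 <= len d.
Proof.
move=> xd gx gV.
have Vd : fV x \in porbit f d by rewrite -eq_porbit_mem porbitSV eq_porbit_mem.
have nV : x != fV x.
  apply/eqP=> H; have := edge_neq (c_edge (fV x)).
  by rewrite fK4 -H eqxx.
have : \sum_(y in porbit f d) (g y + (y == x) + (y == fV x)) <= \sum_(y in porbit f d) 1.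
  apply: leq_sum => y _; case: (eqVneq y x) => [->|_].
    by rewrite (negPf gx) (negPf nV).
  by case: (eqVneq y (fV x)) => [->|_]; rewrite ?(negPf gV) //; case: (g y).
by rewrite !big_split /= (sum_eq1 xd) (sum_eq1 Vd) sum1_card -addnA.
Qed.

Lemma tO_len d : 5 < len d -> tO d.
Proof.
by move=> H; rewrite /tO /tT /t5 /tS; case: (len d) H => [|[|[|[|[|[|n]]]]]].
Qed.

Lemma tT_side d : tT (e d) -> (len d = 5 /\ m = 6) \/ 10 <= len d.
Proof. by move/tT_len/side3; rewrite c_eK. Qed.

Lemma t5_side d : t5 (e d) -> [\/ len d = 3 /\ m = 6, len d = 5 /\ m = 8,
  (len d = m /\ m != 6) | 10 <= len d].
Proof. by move/side_five; rewrite c_eK. Qed.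

Lemma P0_m d : P0 d -> m = 6.
Proof. by case/andP=> /t5_len l5 /tT_side; rewrite l5 => -[[]|]. Qed.

Lemma tP_P0 d : tP d -> exists2 x, x \in porbit f d & P0 x.
Proof.
case/andP=> d5 /existsP[x /andP[xd T]]; exists x => //.
by rewrite /P0 (t5_in xd) d5.
Qed.

Lemma tP_m d : tP d -> m = 6.
Proof. by case/tP_P0=> x _ /P0_m. Qed.

Lemma P0_tP d : P0 d -> tP d.
Proof. by case/andP=> d5 T; rewrite /tP d5; apply/existsP; exists d; rewrite porbit_id. Qed.

Lemma P0_only d i : P0 d -> 0 < i -> i < 5 -> tT (e (iter i f d)) = false.
Proof.
move=> /andP[d5 T] i0 i5; apply/negP=> T'.
exact: (five_two_triangles (t5_len d5) (tT_len T) i0 i5 (tT_len T')).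
Qed.

Lemma pent_eval d : P0 d -> [/\ pent (iter 1 f d) = pent1 d,
  pent (iter 2 f d) = pent2 d, pent (iter 3 f d) = pent3 d,
  pent (iter 4 f d) = pent4 d & pent d = 0].
Proof.
move=> dP; have T : tT (e d) by case/andP: dP.
have only i := P0_only dP (i := i).
have f5 : iter 5 f d = d.
  by case/andP: dP => /t5_len d5 _; rewrite -{1}d5 iter_len.
have V1 : fV d = iter 4 f d by apply: (@perm_inj _ f); rewrite fK4 -[LHS]f5.
have o1 := only 1 isT isT; have o2 := only 2 isT isT; have o3 := only 3 isT isT.
have o4 := only 4 isT isT.
have EV i : fV (iter i.+1 f d) = iter i f d by rewrite iterS fVf.
have V2 : iter 2 fV d = iter 3 f d by rewrite [LHS]/= V1 EV.
have V3 : iter 3 fV d = iter 2 f d by rewrite [LHS]iterS V2 EV.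
have V4 : iter 4 fV d = iter 1 f d by rewrite [LHS]iterS V3 EV.
have W i j : iter j fV (iter (i + j) f d) = iter i f d.
  elim: j i => [|j IHj] i; first by rewrite addn0.
  by rewrite addnS -addSn iterS IHj EV.
have W02 : iter 2 fV (iter 2 f d) = d := W 0 2.
have W12 : iter 2 fV (iter 3 f d) = iter 1 f d := W 1 2.
have W03 : iter 3 fV (iter 3 f d) = d := W 0 3.
have W22 : iter 2 fV (iter 4 f d) = iter 2 f d := W 2 2.
have W13 : iter 3 fV (iter 4 f d) = iter 1 f d := W 1 3.
have W04 : iter 4 fV (iter 4 f d) = d := W 0 4.
split; rewrite /pent.
- by rewrite (EV 0) T.
- by rewrite (EV 1) o1 W02 T.
- by rewrite (EV 2) o2 W12 o1 W03 T.
- by rewrite (EV 3) o3 W22 o2 W13 o1 W04 T.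
- by rewrite V1 V2 V3 V4 o4 o3 o2 o1.
Qed.

Lemma face_T d : tT d -> face_ok d.
Proof.
move=> T; have xT x : x \in porbit f d -> tT x by move=> xd; rewrite (tT_in xd).
have l3 := tT_len T.
rewrite /face_ok big1 => [|x xd]; last first.
  have T' := xT x xd; rewrite /transfer; case: ifP => [/tT_side|_].
    by rewrite (tT_len T') => -[[]|].
  by rewrite /tO T'.
rewrite add0n [X in _ <= _ + X](eq_bigr (fun=> 24)) => [|x xd].
  by rewrite sum_nat_const -/(len d) l3 -addnA addnCA leq_addl.
by rewrite /transfer c_eK xT.
Qed.

Lemma two_in d : two d -> exists x y, [/\ x \in porbit f d, y \in porbit f d, x != y,
  src x \in K & src y \in K].
Proof.
case/andP=> /eqP K2 KS; have [/card_gt0P[u uK] _ _] := cr_clique Hc.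
have : 0 < #|K :\ u| by have := cardsD1 u K; rewrite uK K2; lia.
case/card_gt0P=> v; rewrite !inE => /andP[vu vK].
have /imsetP[x xd Ex] := subsetP KS u uK; have /imsetP[y yd Ey] := subsetP KS v vK.
exists x, y; rewrite -Ex -Ey; split=> //.
by apply: contraNneq vu => xy; rewrite Ex xy Ey.
Qed.

Lemma two_eq x d : x \in porbit f d -> two x = two d.
Proof. by move=> xd; rewrite /two (fset_in xd). Qed.

Lemma noKN d : ~~ noK d -> exists2 x, x \in porbit f d & src x \in K.
Proof. by rewrite negb_forall_in => /exists_inP[x xd]; rewrite negbK; exists x. Qed.

Lemma face_S d : tS d -> face_ok d.
Proof.
move=> S; have /andP[/eqP l3 nK] := S.
rewrite /face_ok big1 => [|x xd]; last first.
  have lx : len x = 3 by rewrite (len_in xd).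
  rewrite /transfer; case: ifP => [/tT_side|_]; first by rewrite lx => -[[]|].
  have -> : tO x = tO d := tO_in xd.
  by rewrite /tO S !orbT.
rewrite l3 add0n; suff : 72 <= \sum_(x in porbit f d) vgift x.
  by move: (\sum_(x in _) vgift _) (\sum_(x in _) transfer _) => a b; lia.
have vK x : x \in porbit f d -> src x \in K -> vgift x = if two d then 36 else 72.
  by move=> xd xK; rewrite /vgift xK /giftK (len_in xd) l3 /= (two_eq xd).
case: (boolP (two d)) => [tw|ntw].
  have [x [y [xd yd xy xK yK]]] := two_in tw.
  by have := sum_ge2 vgift xd yd xy; rewrite !vK // tw.
have [x xd xK] := noKN nK.
by have := sum_ge1 vgift xd; rewrite vK // (negPf ntw).
Qed.

Lemma a3_e_shared d : is3 (src d) -> a3 (e d) -> a3 (e (fV d)) -> False.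
Proof.
move=> d3 A1 A2; apply: (a3_no_adj (d := r d)).
  by rewrite -c_fe (a3_in (f_in (e d))).
by rewrite -(a3_in (f_in _)) c_fe is3_rr.
Qed.

Lemma sum5 (g : D -> nat) d : len d = 5 -> \sum_(x in porbit f d) g x =
  g d + g (iter 1 f d) + g (iter 2 f d) + g (iter 3 f d) + g (iter 4 f d).
Proof. by move=> l5; rewrite sum_iter -/(len d) l5 !big_ord_recr big_ord0. Qed.

(** The pentagon lacks 24 and gives 24 to its triangle, so its other four sides must bring 48. They
    do whichever ends of [d] are 3-vertices: the exceptions [ex2] and [ex3] only move 12 units from
    one side to another. *)
Lemma face_P d : P0 d -> face_ok d.
Proof.
move=> dP; have /andP[d5 T] := dP; have l5 := t5_len d5; have m6 := P0_m dP.
have f5 : iter 5 f d = d by rewrite -{1}l5 iter_len.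
have inT x : x \in porbit f d -> tT x = false.
  by move=> xd; rewrite /tT (len_in xd) l5.
have pay i : 0 < i -> i < 5 -> transfer (iter i f d) = 0.
  move=> i0 i5; rewrite /transfer P0_only // /tO (t5_in (face_iter d i)) d5.
  by rewrite orbT.
have get i : 0 < i -> i < 5 -> transfer (e (iter i f d)) = pent (iter i f d).
  move=> i0 i5; have xd := face_iter d i.
  have x5 : t5 (e (e (iter i f d))) by rewrite c_eK (t5_in xd).
  have l10 : 10 <= len (e (iter i f d)).
    case: (t5_side x5) => [[H3 _]|[_ H8]|[_ H7]|//].
    - by have := five_two_triangles l5 (tT_len T) i0 i5 H3.
    - by rewrite m6 in H8.
    - by rewrite m6 in H7.
  by rewrite /transfer c_eK inT // tO_len ?(ltn_trans _ l10) //= (tP_in xd) P0_tP.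
have [p1 p2 p3 p4 _] := pent_eval dP.
rewrite /face_ok !sum5 // l5.
rewrite (pay 1) // (pay 2) // (pay 3) // (pay 4) // (get 1) // (get 2) // (get 3) // (get 4) //.
rewrite p1 p2 p3 p4 /= (_ : transfer d = 24); last by rewrite /transfer T.
suff : 48 <= pent1 d + pent2 d + pent3 d + pent4 d by clear; lia.
rewrite /pent1 /pent2 /pent3 /pent4 /ex3 /ex2 /Pok dP /=.
case: (is3 (src d)); case: (is3 (tgt d)) => //=.
- by do 2 case: ifP.
- by case: (a3 _).
- by case: (a3 _).
Qed.

Lemma ctype_F x : tF x -> ctype x = TypeF.
Proof.
move=> F; rewrite /ctype F; have /andP[/t5_len l5 nP] := F.
by rewrite /tT l5 (negPf nP).
Qed.

Lemma ctype_S x : tS x -> ctype x = TypeS.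
Proof.
move=> S; have /andP[/eqP l3 nK] := S.
by rewrite /ctype S /tF /tP /tT /t5 l3 (negPf nK).
Qed.

Lemma ctype_r x : ctype (r x) = ctype (e x).
Proof. by rewrite -c_fe (ctype_in (f_in (e x))). Qed.

Lemma ctype_rV x : ctype ((r^-1)%g x) = ctype (e (fV x)).
Proof. by rewrite c_rV. Qed.

Lemma tF_noT x : tF x -> tT (e x) = false.
Proof.
move=> /andP[x5 nP]; apply: contraNF nP => T; rewrite /tP x5.
by apply/existsP; exists x; rewrite porbit_id.
Qed.

Lemma tF_side x : tF x -> [\/ tO (e x), tF (e x) /\ m = 8 | tS (e x) /\ m = 6].
Proof.
move=> F; have noT := tF_noT F; have /andP[x5 _] := F.
case: (side_five x5) => [[l3 m6]|[l5 m8]|[lm m6]|l10].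
- constructor 3; split=> //; move: noT; rewrite /tS /tT l3 /=.
  by move=> ->.
- case: (boolP (t5 (e x))) => [y5|ny5].
    constructor 2; split=> //; rewrite /tF y5; apply/negP=> /tP_m m6.
    by rewrite m6 in m8.
  by constructor 1; rewrite /tO (negPf ny5) /tT /tS l5.
- constructor 1; apply: tO_len; rewrite lm; move: m678 m6; rewrite !inE.
  by case/or3P=> /eqP->.
- by constructor 1; apply: tO_len; rewrite (ltn_trans _ l10).
Qed.

Lemma F_receive x : tF x -> tO (e x) -> transfer (e x) =
  if a3 x then 8 else if is3 (tgt x) && is3 (src x) then if m == 8 then 6 else 0 else 12.
Proof.
move=> F O; have /andP[/t5_len l5 nP] := F.
rewrite /transfer c_eK /tT l5 O /= (negPf nP) F /costF c_eK.
by rewrite c_src_e c_tgt_e.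
Qed.

(** Regroups the gifts by sides: the part that the vertex [src x] gives to a pentagon on account of
    the face of [s], across one of the two sides at that vertex. *)
Definition share (x s : D) := if is3 (src x) then 0 else 6 * tF s + 12 * tS s.
Definition gain (x : D) := transfer (e x) + share x (e x) + share (f x) (e x).

Lemma gain_sum d : tF d ->
  \sum_(x in porbit f d) gain x =
  \sum_(x in porbit f d) vgift x + \sum_(x in porbit f d) transfer (e x).
Proof.
move=> F; rewrite /gain !big_split /=.
pose g y := share y (e (fV y)).
have -> : \sum_(x in porbit f d) share (f x) (e x) = \sum_(x in porbit f d) g x.
  by rewrite -[RHS](sum_shift f); apply: eq_bigr => x _; rewrite /g fVf.
rewrite -addnA addnC; congr (_ + _); rewrite -big_split /=; apply: eq_bigr => x xd.
have Fx : tF x by rewrite (tF_in xd).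
have /andP[x5 _] := Fx; have xK := t5_src x5 (porbit_id _ _).
rewrite /vgift (negPf xK) /g /share; case: (boolP (is3 _)) => // _.
rewrite (ctype_F Fx) ctype_r ctype_rV /gift.
have cF y : isF (ctype y) = tF y.
  case: (boolP (tF y)) => [/ctype_F->//|/negPf nF]; rewrite /ctype nF.
  by case: (_ || _) => //; case: (tS y).
have cS y : isS (ctype y) = tS y.
  case: (boolP (tS y)) => [/ctype_S->//|/negPf nS]; rewrite /ctype nS.
  by case: (_ || _) => //; case: (tF y).
by rewrite !cF !cS !mulnDr addnACA.
Qed.

Lemma three_tF x : is3 (src x) -> tF x -> tF (e x) -> tF (e (fV x)) -> False.
Proof.
move=> x3 /andP[A _] /andP[B _] /andP[C _].
exact: (three_five x3 A B C).
Qed.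

Lemma gain_O x : tF x -> tO (e x) -> ~~ a3 x ->
  (if is3 (tgt x) && is3 (src x) then if m == 8 then 6 else 0 else 12) <= gain x.
Proof. by move=> F O na; rewrite /gain F_receive // (negPf na) -addnA leq_addr. Qed.

Lemma gain_end x : tF x -> ~~ a3 x -> ~~ (is3 (tgt x) && is3 (src x)) -> ~~ tF (e x) ->
  12 <= gain x.
Proof.
move=> F na n3 nF; case: (tF_side F) => [O|[F' _]|[S _]].
- by have := gain_O F O na; rewrite (negPf n3).
- by rewrite F' in nF.
rewrite /gain /share c_src_f S; move: n3.
by case: (is3 (src x)); case: (is3 (tgt x)) => //= _; move: (transfer _) (tF _) => a c; lia.
Qed.

Lemma gain_F x : tF x -> tF (e x) -> 6 * (~~ is3 (src x) + ~~ is3 (tgt x)) <= gain x.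
Proof.
move=> F F'; rewrite /gain /share c_src_f F'.
by case: (is3 (src x)); case: (is3 (tgt x)) => //=; lia.
Qed.

(** The pentagon lacks 24. If all its vertices are 3-vertices, two consecutive sides never both lack
    a payer, so at least three sides bring 8. Otherwise, starting from a vertex [x] that is not a
    3-vertex, the first two sides in either direction bring 12 together. *)
Lemma face_F d : tF d -> face_ok d.
Proof.
move=> Fd; have /andP[d5 nP] := Fd; have l5 := t5_len d5.
have inF x : x \in porbit f d -> tF x by move=> xd; rewrite (tF_in xd).
rewrite /face_ok big1 => [|x xd]; last first.
  by rewrite /transfer (tF_noT (inF x xd)) /tO (t5_in xd) d5 orbT.
rewrite -addnA -gain_sum // l5.
suff : 24 <= \sum_(x in porbit f d) gain x by move: (\sum_(x in _) _) => a; lia.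
have inFi i : tF (iter i f d) by apply: inF; exact: face_iter.
case: (boolP (a3 d)) => [ad|nad].
  have ai i : a3 (iter i f d) by rewrite (a3_in (face_iter d i)).
  have gO i : tO (e (iter i f d)) -> 8 <= gain (iter i f d).
    by move=> O; rewrite /gain F_receive // ai -addnA leq_addr.
  pose b i := ~~ tO (e (iter i f d)).
  have bP i : b i -> (tF (e (iter i f d)) /\ m = 8) \/ (tS (e (iter i f d)) /\ m = 6).
    by rewrite /b; case: (tF_side (inFi i)) => [->//|H _|H _]; [left|right].
  have nb i : b i -> b i.+1 -> False.
    move=> /bP[[H1 m1]|[/andP[/eqP H1 _] m1]] /bP[[H2 m2]|[/andP[/eqP H2 _] m2]];
      try by rewrite m1 in m2.
      apply: (@three_tF (iter i.+1 f d)) => //; first exact: a3_src (ai _).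
      by rewrite iterS fVf.
    apply: (five_two_triangles (d := iter i f d) (i := 1) _ H1) => //.
    by rewrite (len_in (face_iter d i)).
  have f5 : iter 5 f d = d by rewrite -{1}l5 iter_len.
  have nb4 : b 4 -> b 0 -> False.
    by move=> H1 H2; apply: (nb 4) => //; rewrite /b f5.
  have G i : 8 * ~~ b i <= gain (iter i f d).
    by rewrite /b negbK; case: (boolP (tO _)) => // /gO.
  have := nb 0; have := nb 1; have := nb 2; have := nb 3; have := nb4.
  have G4 := G 4; have G3 := G 3; have G2 := G 2; have G1 := G 1; have G0 := G 0.
  rewrite sum5 // (_ : gain d = gain (iter 0 f d)) //.
  move: (leq_add (leq_add (leq_add (leq_add G0 G1) G2) G3) G4).
  case: (b 0); case: (b 1); case: (b 2); case: (b 3); case: (b 4); rewrite /= => H A0 A1 A2 A3 A4;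
   by [apply: leq_trans H | case: A0 | case: A1 | case: A2 | case: A3 | case: A4].
have [x xd x3] : exists2 x, x \in porbit f d & ~~ is3 (src x).
  by move: nad; rewrite negb_forall_in => /exists_inP.
have Fx := inF x xd; have nax : ~~ a3 x by rewrite (a3_in xd).
rewrite -(porb_eq xd).
have lx : len x = 5 by rewrite (len_in xd).
have inx i : tF (iter i f x) by rewrite (tF_in (face_iter x i)).
have nai i : ~~ a3 (iter i f x) by rewrite (a3_in (face_iter x i)).
have f5 : iter 5 f x = x by rewrite -{1}lx iter_len.
rewrite sum5 //.
have A : 12 <= gain x + gain (iter 1 f x).
  case: (boolP (tF (e x))) => [F'|nF']; last first.
    by apply: leq_trans (leq_addr _ _); apply: gain_end; rewrite ?(negPf x3) ?andbF.
  have H1 := gain_F Fx F'; rewrite x3 in H1.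
  case: (boolP (is3 (tgt x))) => [t3|t3]; last by rewrite t3 in H1; apply: leq_trans H1 (leq_addr _ _).
  suff H2 : 6 <= gain (iter 1 f x) by apply: leq_trans (leq_add H1 H2); rewrite t3.
  have m8 : m = 8 by have /andP[/t5_len l _] := F'; have /andP[x5 _] := Fx; exact: (t5_t5 x5 l).
  have nF : ~~ tF (e (iter 1 f x)).
    by apply/negP=> F2; apply: (@three_tF (f x)); rewrite ?c_src_f ?fVf ?(inx 1).
  case: (tF_side (inx 1)) => [O|[F2 _]|[_]]; rewrite ?F2 // in nF *; last by rewrite m8.
  by apply: leq_trans (gain_O (inx 1) O (nai 1)); rewrite m8; case: ifP.
have B : 12 <= gain (iter 4 f x) + gain (iter 3 f x).
  have t4 : tgt (iter 4 f x) = src x by rewrite -c_src_f -[f _]/(iter 5 f x) f5.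
  case: (boolP (tF (e (iter 4 f x)))) => [F'|nF']; last first.
    by apply: leq_trans (leq_addr _ _); apply: gain_end; rewrite ?t4 ?(negPf x3).
  have H1 := gain_F (inx 4) F'; rewrite t4 x3 in H1.
  case: (boolP (is3 (src (iter 4 f x)))) => [s3|s3]; last by rewrite s3 in H1; apply: leq_trans H1 (leq_addr _ _).
  suff H2 : 6 <= gain (iter 3 f x) by apply: leq_trans (leq_add H1 H2); rewrite s3.
  have m8 : m = 8.
    by have /andP[/t5_len l _] := F'; have /andP[x5 _] := inx 4; exact: (t5_t5 x5 l).
  have nF : ~~ tF (e (iter 3 f x)).
    by apply/negP=> F2; apply: (@three_tF (iter 4 f x)); rewrite ?[iter 4 f x]iterS ?fVf ?(inx 4).
  case: (tF_side (inx 3)) => [O|[F2 _]|[_]]; rewrite ?F2 // in nF *; last by rewrite m8.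
  by apply: leq_trans (gain_O (inx 3) O (nai 3)); rewrite m8; case: ifP.
by move: A B; clear; lia.
Qed.

Lemma ctype_O x : tO x -> ctype x = TypeO.
Proof.
rewrite /tO /ctype /tF /tP !negb_or => /and3P[/negPf-> /negPf-> /negPf->].
by [].
Qed.

Definition nt (x : D) : bool := nontriv (ctype (e x)).

Lemma nt_cases x : nt x -> [\/ tT (e x), tP (e x) | tF (e x)].
Proof.
rewrite /nt /ctype; case: (boolP (tT _)) => [|_] /=; first by constructor 1.
case: (boolP (tP _)) => [|_] /=; first by constructor 2.
case: (boolP (tF _)) => [|_]; first by constructor 3.
by case: (tS _).
Qed.

Lemma nt_noK x : nt x -> noK (e x).
Proof. by case/nt_cases=> [/andP[]|/andP[/andP[]]|/andP[/andP[]]]. Qed.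

Lemma nt_T x : tT (e x) -> nt x. Proof. by rewrite /nt /ctype => ->. Qed.
Lemma nt_P x : tP (e x) -> nt x. Proof. by rewrite /nt /ctype => ->; rewrite orbT. Qed.
Lemma nt_F x : tF (e x) -> nt x. Proof. by move=> F; rewrite /nt (ctype_F F). Qed.

Lemma nt_K x : nt x -> src x \notin K /\ tgt x \notin K.
Proof.
move/nt_noK=> nK; split.
  by rewrite -c_tgt_e -c_src_f; exact: noK_src nK (f_in _).
by rewrite -c_src_e; exact: noK_src nK (porbit_id _ _).
Qed.

(** For each side with a needy face across it, a paying face gets 12 from each end that is not a
    3-vertex. [nn] counts this by sides and [own] by vertices. *)
Definition nn (x : D) := 12 * (nt x && ~~ is3 (src x)) + 12 * (nt x && ~~ is3 (tgt x)).
Definition own (x : D) := if is3 (src x) then 0 else 12 * (nt x + nt (fV x)).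
Definition kgift (x : D) := if src x \in K then vgift x else 0.

Lemma sum_nn d : \sum_(x in porbit f d) nn x = \sum_(x in porbit f d) own x.
Proof.
rewrite big_split /=.
pose g x := 12 * (nt (fV x) && ~~ is3 (src x)).
have -> : \sum_(x in porbit f d) 12 * (nt x && ~~ is3 (tgt x)) = \sum_(x in porbit f d) g x.
  rewrite -[RHS](sum_shift f); apply: eq_bigr => x _.
  by rewrite /g fVf c_src_f.
rewrite -big_split; apply: eq_bigr => x _; rewrite /own /g.
by case: (is3 _); rewrite ?andbF //= !andbT mulnDr.
Qed.

Lemma own_vgift x : tO x -> own x + kgift x <= vgift x.
Proof.
move=> O; rewrite /own /kgift; case: (boolP (src x \in K)) => xK.
  have n1 : nt x = false by apply/negP=> /nt_K[]; rewrite xK.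
  have n2 : nt (fV x) = false.
    by apply/negP=> /nt_K[_]; rewrite -c_src_f fK4 xK.
  by rewrite n1 n2; case: ifP.
rewrite addn0 /vgift (negPf xK); case: (is3 _) => //.
rewrite (ctype_O O) ctype_r ctype_rV -/(nt x) /gift -/(nt x) -/(nt (fV x)).
rewrite /nt; case: (_ == 4); case: (ctype (e x)); case: (ctype (e (fV x))) => //.
Qed.

Lemma sum_own_vgift d : tO d ->
  \sum_(x in porbit f d) own x + \sum_(x in porbit f d) kgift x <= \sum_(x in porbit f d) vgift x.
Proof.
move=> O; rewrite -big_split /=; apply: leq_sum => x xd.
by apply: own_vgift; rewrite (tO_in xd).
Qed.

Definition F3 (x : D) := [&& tF (e x), is3 (src x) & is3 (tgt x)].

Lemma costF_le x : tF (e x) -> costF x <= nn x + 8 * F3 x.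
Proof.
move=> F; rewrite /costF /nn /F3 F nt_F //=; case: (boolP (a3 (e x))) => [a|_].
  have -> : is3 (src x) by rewrite -c_tgt_e; exact: a3_tgt _ a.
  by have -> : is3 (tgt x) by rewrite -c_src_e; exact: a3_src a.
by case: (is3 _); case: (is3 _) => //; case: (m == 8).
Qed.

(** For m other than 6, no needy triangle and no pentagon [tP] lies next to such a face. Beyond what
    the vertices give back it then spends at most 8 on each [F3] side. *)
Lemma mid_bound d : m != 6 -> tO d -> len d < 10 ->
  \sum_(x in porbit f d) transfer x + \sum_(x in porbit f d) kgift x <=
  \sum_(x in porbit f d) vgift x + 8 * \sum_(x in porbit f d) F3 x.
Proof.
move=> m6 O l10.
have noT x : x \in porbit f d -> tT (e x) = false.
  move=> xd; apply/negP=> /tT_side; rewrite (len_in xd) leqNgt l10 => -[[_ m6']|//].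
  by rewrite m6' in m6.
have : \sum_(x in porbit f d) transfer x <= \sum_(x in porbit f d) (nn x + 8 * F3 x).
  apply: leq_sum => x xd; rewrite /transfer noT // (tO_in xd) O /=.
  have -> : tP (e x) = false.
    by apply/negP=> /tP_m m6'; rewrite m6' in m6.
  case: ifP => [F|_]; first exact: costF_le.
  case: ifP => // /relatP [_ _ _ T _]; rewrite noT // in T.
  by rewrite -eq_porbit_mem porbitS eq_porbit_mem.
rewrite big_split /= sum_nn -big_distrr /= => H1.
have := sum_own_vgift O; move: H1.
move: (\sum_(x in porbit f d) transfer x) (\sum_(x in porbit f d) own x)
  (\sum_(x in porbit f d) kgift x) (\sum_(x in porbit f d) vgift x)
  (\sum_(x in porbit f d) F3 x) => a b c g h; clear; lia.
Qed.

Lemma kgift_K5 d : len d = 5 -> ~~ noK d ->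
  (forall x, x \in porbit f d -> src x \in K -> len (e x) != 3 /\ len (e (fV x)) != 3) ->
  48 <= \sum_(x in porbit f d) kgift x.
Proof.
move=> l5 nK n3.
have kE x : x \in porbit f d -> src x \in K -> kgift x = if two d then 24 else 48.
  move=> xd xK; have [h1 h2] := n3 x xd xK.
  rewrite /kgift xK /vgift xK /giftK (len_in xd) l5 (two_eq xd) /=.
  by rewrite -c_fe len_f c_rV (negPf h1) (negPf h2); case: (two _).
case: (boolP (two d)) => tw.
  have [x [y [xd yd xy xK yK]]] := two_in tw.
  by have := sum_ge2 kgift xd yd xy; rewrite !kE // tw.
have [x xd xK] := noKN nK.
by have := sum_ge1 kgift xd; rewrite kE // (negPf tw).
Qed.

Lemma F3_K d x : x \in porbit f d -> src x \in K -> ~~ F3 x /\ ~~ F3 (fV x).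
Proof.
move=> xd xK; split; apply/negP=> /and3P[_ /is3_notK H1 /is3_notK H2].
  by rewrite xK in H1.
by move: H2; rewrite -c_src_f fK4 xK.
Qed.

Lemma sum_kgift_le d : tO d -> \sum_(x in porbit f d) kgift x <= \sum_(x in porbit f d) vgift x.
Proof. by move=> O; apply: leq_trans (leq_addl _ _) (sum_own_vgift O). Qed.

(** The face lacks 24. For m other than 6 a vertex of [K] leaves at most three [F3] sides, which
    cost 24 more, and [K] gives 48. For m = 6 it pays at most one triangle; then no side at [K] is
    triangular, so [K] gives 48, and otherwise 24 is enough. *)
Lemma face_K5 d : len d = 5 -> ~~ noK d -> face_ok d.
Proof.
move=> l5 nK; have O : tO d by rewrite /tO /tT /t5 /tS l5 (negPf nK).
have [x0 x0d x0K] := noKN nK.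
have lx x : x \in porbit f d -> len x = 5 by move=> xd; rewrite (len_in xd).
have Vd x : x \in porbit f d -> fV x \in porbit f d.
  by move=> xd; rewrite -eq_porbit_mem porbitSV eq_porbit_mem.
have tri x y : x \in porbit f d -> y \in porbit f d -> x != y -> len (e x) = 3 -> len (e y) = 3 -> False.
  move=> xd yd xy H1 H2; have : y \in porbit f x by rewrite -eq_porbit_mem (porb_eq xd) eq_porbit_mem.
  case/in_face=> i; rewrite lx // => i5 Ey; rewrite Ey in H2.
  have i0 : 0 < i by case: i Ey {i5 H2} => // Ey; rewrite Ey eqxx in xy.
  exact: (five_two_triangles (lx _ xd) H1 i0 i5 H2).
rewrite /face_ok l5; case: (eqVneq m 6) => [m6|m6]; last first.
  have k48 : 48 <= \sum_(x in porbit f d) kgift x.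
    apply: kgift_K5 => // x xd xK; split; apply/eqP=> H3.
      by case: (side3 H3) m6; rewrite c_eK ?lx // => -[_ ->].
    by case: (side3 H3) m6; rewrite c_eK ?lx ?Vd // => -[_ ->].
  have := mid_bound m6 O; rewrite l5 => /(_ isT) H1.
  have [n1 n2] := F3_K x0d x0K; have H2 := sum_lt_len x0d n1 n2; rewrite l5 in H2.
  move: k48 H1 H2; move: (\sum_(x in _) F3 x) (\sum_(x in _) kgift x) (\sum_(x in _) vgift x)
     (\sum_(x in _) transfer x) (\sum_(x in _) transfer (e x)) => a b c g h; clear; lia.
have dE x : x \in porbit f d -> transfer x = if tT (e x) then 24 else 0.
  move=> xd; rewrite /transfer; case: ifP => // nT; rewrite (tO_in xd) O /=.
  have n5 : t5 (e x) = false.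
    apply/negP=> /t5_side; rewrite lx // => -[[]//|[_ m8]|[m5 _]|//].
      by rewrite m6 in m8.
    by rewrite m6 in m5.
  rewrite /tP /tF n5 /=; case: ifP => // /relatP [_ _ T1 T2 _].
  exfalso; apply: (tri (fV x) (f x)); rewrite ?Vd ?(tT_len T1) ?(tT_len T2) //.
    by rewrite -eq_porbit_mem porbitS eq_porbit_mem.
  have := @iter_lt (fV x) 2 isT; rewrite lx ?Vd //= fK4 eq_sym; exact.
case: (boolP [exists y in porbit f d, tT (e y)]) => [/existsP[y /andP[yd T]]|nT].
  have k48 : 48 <= \sum_(x in porbit f d) kgift x.
    apply: kgift_K5 => // x xd xK.
    have nKy := nt_K (nt_T T).
    split; apply/eqP=> H3; apply: (tri _ y _ yd _ H3 (tT_len T)) => //.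
    - by apply: contraTneq xK => ->; case: nKy.
    - exact: Vd.
    - by apply: contraTneq xK => E1; case: nKy => _; rewrite -E1 -c_src_f fK4.
  rewrite (bigD1 y) //= dE // T big1 => [|x /andP[xd xy]]; last first.
    rewrite dE //; case: ifP => // T'.
    by have := tri x y xd yd xy (tT_len T') (tT_len T).
  have := sum_kgift_le O; move: k48; move: (\sum_(x in _) kgift x) (\sum_(x in _) vgift x)
     (\sum_(x in _) transfer (e x)) => b c h; clear; lia.
rewrite big1 => [|x xd]; last first.
  rewrite dE //; case: ifP => // T; case/negP: nT; apply/existsP; exists x; rewrite xd.
  exact: T.
have : 24 <= vgift x0.
  by rewrite /vgift x0K /giftK lx //=; case: ifP.
have := sum_ge1 vgift x0d; move: (\sum_(x in _) vgift x) (\sum_(x in _) transfer (e x)) => b h.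
by move: (vgift x0) => a; clear; lia.
Qed.

Lemma face_6 d : len d = 6 -> m = 6 -> face_ok d.
Proof.
move=> l6 m6; rewrite /face_ok big1 => [|x xd]; first by rewrite l6 -addnA leq_addr.
have lx : len x = 6 by rewrite (len_in xd).
have nT y : y \in porbit f d -> tT (e y) = false.
  by move=> yd; apply/negP=> /tT_side; rewrite (len_in yd) l6 => -[[]|].
have n5 : t5 (e x) = false.
  by apply/negP=> H5; apply: (t5_6 H5); rewrite c_eK.
rewrite /transfer nT // tO_len ?lx //= /tP /tF n5 /=.
case: ifP => // /relatP [_ _ _ T _]; rewrite nT // in T.
by rewrite -eq_porbit_mem porbitS eq_porbit_mem.
Qed.

(** The pentagons across two consecutive sides would be adjacent, which forces m = 8. *)
Lemma F3_apart x : m != 8 -> F3 x -> F3 (f x) -> False.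
Proof.
move=> m8 /and3P[/andP[A _] _ t3] /and3P[/andP[B _] _ _].
have s3 : is3 (src (f x)) by rewrite c_src_f.
have : t5 (r (f x)) by rewrite -c_fe (t5_in (f_in _)).
move/t5_t5 => H; case/eqP: m8; apply: H.
have : f (e (r (f x))) = e x by rewrite c_fe is3_rr // fVf.
by move=> H; rewrite -len_f H (t5_len A).
Qed.

(** There are 24 units, and [F3] sides are never consecutive, so at most three of them cost 8. *)
Lemma face_7 d : len d = 7 -> m = 7 -> face_ok d.
Proof.
move=> l7 m7; have O : tO d by rewrite tO_len // l7.
have m6 : m != 6 by rewrite m7.
have := mid_bound m6 O; rewrite l7 => /(_ isT) H1.
have H2 : (\sum_(x in porbit f d) F3 x).*2 <= 7.
  have <- : \sum_(x in porbit f d) 1 = 7 by rewrite sum1_card.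
  rewrite -addnn -{2}(sum_shift f) -big_split /=.
  apply: leq_sum => x _; case: (boolP (F3 x)) => F1; case: (boolP (F3 (f x))) => F2 //.
  by case: (F3_apart _ F1 F2); rewrite m7.
rewrite /face_ok l7; move: H1 H2.
move: (\sum_(x in _) F3 x) (\sum_(x in _) kgift x) (\sum_(x in _) vgift x)
  (\sum_(x in _) transfer x) (\sum_(x in _) transfer (e x)) => a b c g h; clear; lia.
Qed.

(** There are 48 units: 6 for each side if all vertices are 3-vertices, and otherwise 8 for each of
    at most six [F3] sides. *)
Lemma face_8 d : len d = 8 -> m = 8 -> face_ok d.
Proof.
move=> l8 m8; have O : tO d by rewrite tO_len // l8.
case: (boolP (a3 d)) => [a|na]; last first.
  have [x xd x3] : exists2 x, x \in porbit f d & ~~ is3 (src x).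
    by move: na; rewrite negb_forall_in => /exists_inP.
  have m6 : m != 6 by rewrite m8.
  have := mid_bound m6 O; rewrite l8 => /(_ isT) H1.
  have n1 : ~~ F3 x by rewrite /F3 (negPf x3) andbF.
  have n2 : ~~ F3 (fV x) by rewrite /F3 -[tgt _](c_src_f) fK4 (negPf x3) !andbF.
  have H2 := sum_lt_len xd n1 n2.
  rewrite /face_ok l8; move: H1 H2; rewrite l8.
  move: (\sum_(x in _) F3 x) (\sum_(x in _) kgift x) (\sum_(x in _) vgift x)
    (\sum_(x in _) transfer x) (\sum_(x in _) transfer (e x)) => u b c g h; clear; lia.
rewrite /face_ok -addnA.
have : \sum_(x in porbit f d) transfer x <= \sum_(x in porbit f d) 6.
  apply: leq_sum => x xd; have ax : a3 x by rewrite (a3_in xd).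
  have nT y : y \in porbit f d -> tT (e y) = false.
    by move=> yd; apply/negP=> /tT_side; rewrite (len_in yd) l8 => -[[]|].
  rewrite /transfer nT // (tO_in xd) O /=.
  have -> : tP (e x) = false.
    by apply/negP=> /tP_m m6; rewrite m6 in m8.
  case: ifP => [F|_]; last by case: ifP.
  rewrite /costF; case: ifP => [ae|_]; first by case: (a3_no_adj ax ae).
  by rewrite (a3_src ax) (a3_tgt ax) m8.
rewrite sum_nat_const -/(len d) l8; move: (\sum_(x in _) transfer x) (\sum_(x in _) vgift x)
  (\sum_(x in _) transfer (e x)) => u b c; clear; lia.
Qed.

(** * Long faces of 3-vertices *)

Lemma fV_iter d : len d = 5 -> [/\ fV d = iter 4 f d, iter 2 fV d = iter 3 f d,
  iter 3 fV d = iter 2 f d & iter 4 fV d = iter 1 f d].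
Proof.
move=> l5; have f5 : iter 5 f d = d by rewrite -{1}l5 iter_len.
have V1 : fV d = iter 4 f d by apply: (@perm_inj _ f); rewrite fK4 -[LHS]f5.
have EV i : fV (iter i.+1 f d) = iter i f d by rewrite iterS fVf.
have V2 : iter 2 fV d = iter 3 f d by rewrite [LHS]/= V1 EV.
have V3 : iter 3 fV d = iter 2 f d by rewrite [LHS]iterS V2 EV.
by split=> //; rewrite iterS V3 EV.
Qed.

Lemma P0_back d i : P0 d -> 0 < i -> i < 5 -> P0 (iter i fV d) -> False.
Proof.
move=> dP i0 i5 /andP[_ T]; have /andP[/t5_len l5 _] := dP.
have [V1 V2 V3 V4] := fV_iter l5; have only j := P0_only dP (i := j).
case: i i0 i5 T => [|[|[|[|[|//]]]]] // _ _; rewrite ?[iter 1 fV d]/= ?V1 ?V2 ?V3 ?V4 only //.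
Qed.

(** The third edge at a 3-vertex separates the faces across the two sides meeting there. Hence these
    faces are adjacent, and the restrictions on adjacent short faces apply to consecutive sides. *)
Lemma face_turn y : is3 (src y) -> f (e (r y)) = e (fV y).
Proof. by move=> y3; rewrite c_fe (is3_rr y3). Qed.

Lemma adj_TT y : is3 (src y) -> tT (e y) -> tT (e (fV y)) -> False.
Proof.
move=> y3 T1; rewrite -face_turn // (tT_in (f_in _)) => /tT_side.
by rewrite -c_fe len_f (tT_len T1) => -[[]|].
Qed.

Lemma adj_55 y : is3 (src y) -> t5 (e y) -> t5 (e (fV y)) -> m = 8.
Proof.
move=> y3 A B; have rA : t5 (r y) by rewrite -c_fe (t5_in (f_in _)).
apply: (t5_t5 rA).
by rewrite -len_f face_turn // (t5_len B).
Qed.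

Lemma adj_T5 y : is3 (src y) -> tT (e y) -> t5 (e (fV y)) -> P0 (e (r y)).
Proof.
move=> y3 A B; rewrite /P0 -(t5_in (f_in _)) face_turn // B c_eK.
by rewrite -c_fe (tT_in (f_in _)).
Qed.

Lemma adj_5T y : is3 (src y) -> t5 (e y) -> tT (e (fV y)) -> P0 (r y).
Proof.
move=> y3 A B; rewrite /P0 -c_fe (t5_in (f_in _)) A.
by rewrite c_fe -(tT_in (f_in _)) face_turn // B.
Qed.

Lemma PB_P0 c : PB c -> P0 (iter 2 fV c) \/ P0 (iter 3 fV c).
Proof. by case/orP=> /and3P[]; [left|right]. Qed.

Lemma PB_t5 c : PB c -> t5 c.
Proof.
move/PB_P0=> [] /andP[]; first by rewrite -(t5_in (face_iter _ 2)) fiter_V.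
by rewrite -(t5_in (face_iter _ 3)) fiter_V.
Qed.

Lemma PB_m c : PB c -> m = 6.
Proof. by case/PB_P0=> /P0_m. Qed.

(** Two triangles are never adjacent, and two pentagons only for m = 8, while the pentagon of a slot
    forces m = 6. A triangle next to that pentagon would be a second one on it. *)
Lemma slot_apart y : is3 (src y) -> slot y -> slot (fV y) -> False.
Proof.
move=> y3 /orP[T1|P1] /orP[T2|P2].
- exact: adj_TT y3 T1 T2.
- have H := adj_T5 y3 T1 (PB_t5 P2).
  case: (PB_P0 P2); rewrite -face_turn // => H2.
    by apply: (P0_back H (i := 1)) => //; move: H2; rewrite /= fVf.
  by apply: (P0_back H (i := 2)) => //; move: H2; rewrite /= fVf.
- have H := adj_5T y3 (PB_t5 P1) T2.
  have Ee : e y = fV (r y) by rewrite -c_fe fVf.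
  by case: (PB_P0 P1); rewrite Ee => H2; [apply: (P0_back H (i := 3))|apply: (P0_back H (i := 4))].
- by have := adj_55 y3 (PB_t5 P1) (PB_t5 P2); rewrite (PB_m P1).
Qed.

Lemma slot_F y : is3 (src y) -> m = 8 -> (slot y && tF (e (fV y))) || (slot (fV y) && tF (e y)) -> False.
Proof.
move=> y3 m8; have n6 : m <> 6 by rewrite m8.
case/orP=> /andP[/orP[T|/PB_m //] /andP[F _]].
  exact: n6 (P0_m (adj_T5 y3 T F)).
exact: n6 (P0_m (adj_5T y3 F T)).
Qed.

Definition P3b x := Pok (iter 3 fV (e x)).
Definition P2b x := Pok (iter 2 fV (e x)).

(** The other sides of a pentagon [tP] cost nothing here: a payment would require a vertex of this
    face that is not a 3-vertex, or produce adjacent faces of 3-vertices. *)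
Lemma a3_transfer x : a3 x -> tO x -> [\/ tT (e x) /\ transfer x = 24,
  P3b x /\ transfer x = (if ex3 (iter 3 fV (e x)) then 12 else 24),
  P2b x /\ transfer x = (if ex2 (iter 2 fV (e x)) then 12 else 24) |
  transfer x <= 6 * (tF (e x) && (m == 8))].
Proof.
move=> a O; case: (boolP (tT (e x))) => T; first by constructor 1; rewrite /transfer T.
have trP : tP (e x) -> transfer x = pent (e x) by move=> P; rewrite /transfer (negPf T) O P.
have tPx d : P0 d -> e x \in porbit f d -> tP (e x).
  by move=> dP xd; rewrite (tP_in xd) P0_tP.
case: (boolP (P3b x)) => [P3|n3].
  constructor 2; split => //; have /and3P[dP X Y] := P3; set d := iter 3 fV (e x) in dP X Y *.
  have Ex : e x = iter 3 f d by rewrite fiter_V.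
  rewrite trP; last by apply: (tPx d dP); rewrite Ex face_iter.
  have [_ _ p3 _ _] := pent_eval dP.
  by rewrite Ex p3 /pent3 X Y.
case: (boolP (P2b x)) => [P2|n2].
  constructor 3; split => //; have /and3P[dP X Y] := P2; set d := iter 2 fV (e x) in dP X Y *.
  have Ex : e x = iter 2 f d by rewrite fiter_V.
  rewrite trP; last by apply: (tPx d dP); rewrite Ex face_iter.
  have [_ p2 _ _ _] := pent_eval dP.
  by rewrite Ex p2 /pent2 X Y.
constructor 4; have sx := a3_src a; have tx := a3_tgt a.
case: (boolP (tP (e x))) => [P|nP]; last first.
  rewrite /transfer (negPf T) O (negPf nP) /=; case: ifP => [F|_].
    rewrite /costF; case: ifP => [ae|_]; first by case: (a3_no_adj a ae).
    by rewrite sx tx /=; case: (m == 8).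
  case: ifP => // /relatP [_ _ _ _ [H _ _ _]].
  by case/negP: H; apply: a3P a (fV_in _).
rewrite trP //; have [d0 d0x dP] := tP_P0 P.
have /andP[/t5_len l5 _] := dP.
have xd0 : e x \in porbit f d0 by rewrite porbit_sym.
have nall : ~ (forall j, j < 5 -> is3 (src (iter j f d0))).
  move=> all3; apply: (a3_no_adj a); rewrite (a3_in xd0).
  by apply/forallP=> y; apply/implyP=> /in_face[j]; rewrite l5 => j5 ->; exact: all3.
have [p1 p2 p3 p4 p0] := pent_eval dP.
have tg i : tgt (iter i f d0) = src (iter i.+1 f d0) by rewrite iterS c_src_f.
case/in_face: xd0 => i; rewrite l5; case: i => [|[|[|[|[|//]]]]] _ Ex.
- by rewrite Ex p0.
- rewrite Ex p1 /pent1 (tg 0) -Ex c_src_e tx /=.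
  case: ifP => // /and4P[/and3P[_ X Y] B3 _ _]; exfalso; apply: nall => j.
  case: j => [|[|[|[|[|//]]]]] _ //.
  + by rewrite -(tg 0).
  + by rewrite -(tg 1) -Ex c_tgt_e.
  + by rewrite -c_tgt_e; exact: (a3_tgt B3).
  + by rewrite -(tg 3) -c_src_e; exact: (a3_src B3).
- rewrite Ex p2 /pent2; case: ifP => [XY|_].
    by case/negP: n2; rewrite /P2b Ex /= !fVf /Pok dP.
  case: ifP => // /andP[_ B3]; exfalso.
  have q3 : is3 (src (iter 3 f d0)) by rewrite -c_tgt_e; exact: (a3_tgt B3).
  apply: (a3_e_shared q3 B3); rewrite iterS fVf -Ex c_eK; exact: a.
- rewrite Ex p3 /pent3; case: ifP => [XY|_].
    by case/negP: n3; rewrite /P3b Ex /= !fVf /Pok dP.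
  by rewrite -Ex c_eK a andbF.
- rewrite Ex p4 /pent4; case: ifP => [/negP X|_].
    exfalso; apply: X.
    have f5 : iter 5 f d0 = d0 by rewrite -{1}l5 iter_len.
    by rewrite -f5 -(tg 4) -Ex c_tgt_e.
  case: ifP => // /and4P[/and3P[_ X Y] B3 _ _]; exfalso; apply: nall => j.
  case: j => [|[|[|[|[|//]]]]] _ //.
  + by rewrite -(tg 0).
  + by rewrite -c_tgt_e; exact: (a3_tgt B3).
  + by rewrite -(tg 2) -c_src_e; exact: (a3_src B3).
  + by rewrite -Ex c_src_e.
Qed.

(* Reads off the words of Section Words around a face. *)
Definition letter x : nat := if tT (e x) then 2 else if P3b x then 3 else if P2b x then 4
  else if tF (e x) && (m == 8) then 1 else 0.

Lemma heavy_letter x : heavy (letter x) = slot x.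
Proof.
rewrite /letter /heavy /slot /PB -/(P3b x) -/(P2b x).
by case: (tT (e x)) => //=; case: (P3b x); case: (P2b x) => //=; case: (tF (e x) && (m == 8)).
Qed.

Lemma letter_F x : ~~ slot x -> letter x = (tF (e x) && (m == 8)).
Proof.
rewrite /letter /slot /PB -/(P3b x) -/(P2b x) !negb_or => /and3P[/negPf-> /negPf-> /negPf->].
by case: (_ && _).
Qed.

Lemma letter_pos x : 0 < letter x -> slot x \/ (tF (e x) /\ m = 8).
Proof.
case: (boolP (slot x)) => [|/letter_F->]; first by left.
by case: (boolP (_ && _)) => // /andP[F /eqP]; right.
Qed.

Lemma compat_face x : is3 (src (f x)) -> compat (letter x) (letter (f x)).
Proof.
move=> y3; rewrite /compat !heavy_letter; apply/andP; split; apply/negP=> /andP[H /letter_pos].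
  case=> [H2|[F m8]]; first by apply: (slot_apart y3 H2); rewrite fVf.
  by apply: (slot_F y3 m8); rewrite fVf H F orbT.
case=> [H2|[F m8]]; first by apply: (slot_apart y3 H); rewrite fVf.
by apply: (slot_F y3 m8); rewrite fVf H F.
Qed.

Lemma a3_transfer_le x : a3 x -> tO x ->
  transfer x <= (if heavy (letter x) then 24 else 6 * letter x).
Proof.
move=> a O; rewrite heavy_letter.
case: (a3_transfer a O) => [[T ->]|[P ->]|[P ->]|H].
- by rewrite /slot T.
- by rewrite /slot /PB -/(P3b x) P !orbT; case: ifP.
- by rewrite /slot /PB -/(P2b x) P !orbT; case: ifP.
- case: (boolP (slot x)) => [_|/letter_F-> //].
  by apply: leq_trans H _; case: (_ && _).
Qed.

Lemma sum_face (g : D -> nat) d n : len d = n ->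
  \sum_(x in porbit f d) g x = sumn [seq g (iter i f d) | i <- iota 0 n].
Proof.
move=> l; rewrite sum_iter -/(len d) l sumnE big_map.
by rewrite -(big_mkord xpredT (fun i => g (iter i f d))) /index_iota subn0.
Qed.

Lemma sumn_le (g h : nat -> nat) n : (forall i, i < n -> g i <= h i) ->
  sumn [seq g i | i <- iota 0 n] <= sumn [seq h i | i <- iota 0 n].
Proof.
move=> gh; rewrite !sumnE !big_map big_seq [X in _ <= X]big_seq.
by apply: leq_sum => i; rewrite mem_iota add0n => /andP[_]; exact: gh.
Qed.

(** Slots are never consecutive, so counting each at both its ends bounds the cost by 12 per side,
    and 12 k <= 24 k - 144 for k >= 12. *)
Lemma face_a3_12 d : a3 d -> 12 <= len d -> face_ok d.
Proof.
move=> a l12; have O : tO d by rewrite tO_len // (leq_trans _ l12).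
have ax x : x \in porbit f d -> a3 x by move=> xd; rewrite (a3_in xd).
pose F x := tF (e x) && (m == 8).
have H1 : \sum_(x in porbit f d) transfer x <= \sum_(x in porbit f d) (slot x * 24 + F x * 6).
  apply: leq_sum => x xd; have Ox : tO x by rewrite (tO_in xd).
  apply: leq_trans (a3_transfer_le (ax x xd) Ox) _; rewrite heavy_letter.
  case: (boolP (slot x)) => [_|/letter_F->]; first by rewrite mul1n leq_addr.
  by rewrite mulnC leq_addl.
have H2 : \sum_(x in porbit f d) (F x + slot x + slot (f x)) <= \sum_(x in porbit f d) 1.
  apply: leq_sum => x xd; have y3 : is3 (src (f x)).
    by apply: a3_src; apply: ax; rewrite -eq_porbit_mem porbitS eq_porbit_mem.
  have := compat_face y3; rewrite /compat !heavy_letter.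
  case: (boolP (slot x)) => s1; case: (boolP (slot (f x))) => s2; rewrite /=.
  - have pos : 0 < letter (f x) by apply: ltnW; have := s2; rewrite -heavy_letter.
    by rewrite pos.
  - move=> _; rewrite addn0; suff -> : F x = false by [].
    apply/negP=> /andP[Fx /eqP m8]; case/orP: s1 => [T|/PB_m m6].
      by have /andP[/t5_len l5 _] := Fx; move: (tT_len T); rewrite l5.
    by rewrite m6 in m8.
  - by rewrite (letter_F s1) -/(F x); case: (F x).
  - by case: (F x).
move: H1 H2; rewrite !big_split /= -!big_distrl /= sum1_card -/(len d) (sum_shift f (fun x => slot x : nat)).
rewrite /face_ok; move: l12.
move: (\sum_(x in _) transfer x) (\sum_(x in _) slot x) (\sum_(x in _) F x) (len d)
  (\sum_(x in _) vgift x) (\sum_(x in _) transfer (e x)) => *; lia.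
Qed.

Lemma word_mem d n : a3 d -> len d = n -> 0 < n ->
  let w := [seq letter (iter i f d) | i <- iota 0 n] in
  w \in words n /\ compat (last 0 w) (head 0 w).
Proof.
move=> a l n0 w; have sw : size w = n by rewrite size_map size_iota.
have y3 i : is3 (src (iter i f d)) by exact: a3P a (face_iter _ _).
have cmp i : compat (letter (iter i f d)) (letter (iter i.+1 f d)).
  by apply: compat_face; exact: (y3 i.+1).
split.
  rewrite -sw; apply: words_mem.
    apply/allP=> _ /mapP[i _ ->]; rewrite /letter /=.
    by do ?case: ifP.
  rewrite /w; case: (n) => // k /=.
  rewrite -[letter d]/(letter (iter 0 f d)); elim: k {1 2}0 => //= k IHk i.
  by have := IHk i.+1; rewrite /= => ->; rewrite andbT; exact: cmp.
rewrite /w -nth_last -nth0 sw !(nth_map 0) ?size_iota //; last by rewrite prednK.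
rewrite !nth_iota //; last by rewrite prednK.
by have := cmp n.-1; rewrite !add0n prednK // -{2}l iter_len.
Qed.

Lemma face_a3_11 d : a3 d -> len d = 11 -> face_ok d.
Proof.
move=> a l; have O : tO d by rewrite tO_len // l.
have [w1 w2] := word_mem a l isT.
have := allP check11_all _ w1; rewrite /check11 w2 implyTb -map_comp => H.
rewrite /face_ok l -addnA; apply: leq_trans (leq_addr _ _).
have -> : 24 * 11 = 120 + 144 by [].
rewrite leq_add2r (sum_face transfer l); apply: leq_trans H; apply: sumn_le => i _.
by apply: a3_transfer_le; rewrite ?(a3_in (face_iter d i)) ?(tO_in (face_iter d i)).
Qed.

(** The side [e x] is [relat]. The two triangles beside it also lie on the face of [e x], which is
    therefore not a pentagon but a long face, able to pay. *)
Lemma relat_gain x : a3 x -> len x = 10 -> tO x -> tT (e (f x)) -> tT (e (fV x)) ->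
  tT (e (iter 3 fV x)) -> 6 <= transfer (e x).
Proof.
move=> a l O T1 T2 T3; have sx := a3_src a; have tx := a3_tgt a.
have R : relat (e x) by rewrite /relat c_eK l a T1 T2 T3.
have [nT n5 nS] : [/\ ~~ tT x, ~~ t5 x & ~~ tS x] by move: O; rewrite /tO !negb_or => /and3P.
have A1 : tT (e (fV (e x))).
  have := face_turn (y := f x); rewrite c_src_f fVf => /(_ tx) Ef.
  by rewrite -Ef fVf c_eK -c_fe (tT_in (f_in _)).
have A2 : tT (e (f (e x))).
  rewrite c_fe; have := face_turn sx => Ef.
  by rewrite -(tT_in (f_in (e (r x)))) Ef.
have l10 : 10 <= len (e x).
  have := tT_side A2; rewrite len_f => -[[l5 _]|//].
  exfalso; apply: (five_two_triangles (d := fV (e x)) (i := 2)); rewrite ?(len_in (fV_in _)) //.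
  - exact: (tT_len A1).
  - by rewrite /= fK4; exact: (tT_len A2).
have Oe : tO (e x) by rewrite tO_len // (leq_trans _ l10).
by rewrite /transfer c_eK (negPf nT) Oe /= /tP /tF (negPf n5) /= R.
Qed.

Lemma face_a3_10 d : a3 d -> len d = 10 -> face_ok d.
Proof.
move=> a l; have O : tO d by rewrite tO_len // l.
have [w1 w2] := word_mem a l isT.
have := allP check10_all _ w1; rewrite /check10 w2 andTb; set w := [seq _ | i <- _] in w1 w2 *.
have f10 : iter 10 f d = d by rewrite -l iter_len.
have nthw i : nth 0 w (i %% 10) = letter (iter i f d).
  rewrite (nth_map 0) ?size_iota ?ltn_mod // nth_iota ?ltn_mod // add0n.
  rewrite {2}(divn_eq i 10) addnC iterD; congr letter; congr (iter _ _ _).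
  elim: (i %/ 10) => // q IHq; rewrite mulSn addnC iterD f10; exact: IHq.
have ->: ~~ (has (leq 3) w && (1 \in w)).
  apply/negP=> /andP[/hasP[b /mapP[i _ ->] b3] /mapP[j _ Ej]].
  have m6 : m = 6.
    move: b3; rewrite /letter; case: ifP => // _; case: ifP => [P _|_].
      by apply: (PB_m (c := e (iter i f d))); rewrite /PB -/(P3b _) P orbT.
    case: ifP => [P _|_]; last by case: ifP.
    by apply: (PB_m (c := e (iter i f d))); rewrite /PB -/(P2b _) P.
  move: Ej; rewrite /letter m6 andbF; by do ?case: ifP.
rewrite implyTb => H.
have ai i : a3 (iter i f d) by rewrite (a3_in (face_iter d i)).
have Oi i : tO (iter i f d) by rewrite (tO_in (face_iter d i)).
have li i : len (iter i f d) = 10 by rewrite (len_in (face_iter d i)).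
have nthi i : i < 10 -> nth 0 w i = letter (iter i f d).
  by move=> i10; rewrite -{1}(modn_small i10) nthw.
have H1 : \sum_(x in porbit f d) transfer x <= sumn [seq cost w i | i <- iota 0 10].
  rewrite (sum_face transfer l); apply: sumn_le => i i10.
  set x := iter i f d; rewrite /cost nthi // !nthw addnC iterD -/x.
  have V8 : iter 8 f x = fV (fV x).
    have x10 : iter 10 f x = x by rewrite -(li i) iter_len.
    by rewrite -{2}x10 !iterS !fVf.
  rewrite (addnC i 8) iterD -/x V8 !heavy_letter.
  have S3 : slot (f (f x)) -> P3b x -> ex3 (iter 3 fV (e x)).
    by move=> S P; rewrite /ex3 fiter_V /= c_eK -/(P3b x) P (ai i) (li i) S.
  have S2 : slot (fV (fV x)) -> P2b x -> ex2 (iter 2 fV (e x)).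
    by move=> S P; rewrite /ex2 fiter_V /= c_eK -/(P2b x) P (ai i) (li i) S.
  have n32 : P3b x -> P2b x -> False.
    move=> /and3P[P3 _ _] /and3P[P2 _ _]; apply: (P0_back P2 (i := 1)) => //.
  case: (a3_transfer (ai i) (Oi i)) => [[T ->]|[P tr]|[P tr]|H1].
  - by rewrite /letter T.
  - rewrite /letter; case: ifP => [T|_]; first by rewrite /transfer T.
    rewrite -/x in P tr *; rewrite P tr.
    by case: (boolP (slot (f (f x)))) => [/S3/(_ P) ->|_] //=; case: ifP.
  - rewrite /letter; case: ifP => [T|_]; first by rewrite /transfer T.
    rewrite -/x in P tr *; case: ifP => [P3|_]; first by case: (n32 P3 P).
    rewrite P tr.
    by case: (boolP (slot (fV (fV x)))) => [/S2/(_ P) ->|_] //=; case: ifP.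
  - rewrite -/x in H1 *; rewrite /letter; case: ifP => [T|_]; first by rewrite /transfer T.
    have le24 : transfer x <= 6 by apply: leq_trans H1 _; case: (_ && _).
    case: ifP => _; first by apply: leq_trans le24 _; case: ifP.
    case: ifP => _; first by apply: leq_trans le24 _; case: ifP.
    by apply: leq_trans H1 _; case: (_ && _).
have H2 : sumn [seq bonus w i | i <- iota 0 10] <= \sum_(x in porbit f d) transfer (e x).
  rewrite (sum_face (fun x => transfer (e x)) l); apply: sumn_le => i i10.
  set x := iter i f d; rewrite /bonus !nthw.
  have x10 : iter 10 f x = x by rewrite -(li i) iter_len.
  rewrite (addnC i 1) (addnC i 9) (addnC i 7) !iterD -/x.
  have -> : iter 9 f x = fV x by rewrite -{2}x10 iterS fVf.
  have -> : iter 7 f x = iter 3 fV x by rewrite -{2}x10 !iterS !fVf.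
  have L2 y : letter y = 2 -> tT (e y).
    by rewrite /letter; case: ifP => // _; do ?case: ifP.
  case: ifP => // /and3P[/eqP/L2 T1 /eqP/L2 T2 /eqP/L2 T3].
  exact: (relat_gain (ai i) (li i) (Oi i)).
rewrite /face_ok l; move: H H1 H2.
move: (sumn _) (sumn _) (\sum_(x in _) transfer x) (\sum_(x in _) vgift x)
  (\sum_(x in _) transfer (e x)) => *; lia.
Qed.

(** * Long faces with vertices other than 3-vertices *)

Lemma P_side d i : P0 d -> 0 < i -> i < 5 -> 10 <= len (e (iter i f d)).
Proof.
move=> dP i0 i5; have /andP[d5 T] := dP; have m6 := P0_m dP.
have x5 : t5 (e (e (iter i f d))) by rewrite c_eK (t5_in (face_iter d i)).
case: (t5_side x5) => [[H3 _]|[_ H8]|[_ H7]|//].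
- by have := five_two_triangles (t5_len d5) (tT_len T) i0 i5 H3.
- by rewrite m6 in H8.
- by rewrite m6 in H7.
Qed.

Lemma pent_cases x : ~~ a3 x -> tO x -> tP (e x) ->
  [\/ transfer x = 24, transfer x = 0,
    transfer x = 12 /\ (exists d0, [/\ P0 d0, e x = iter 1 f d0 & ex3 d0]) |
    transfer x = 12 /\ (exists d0, [/\ P0 d0, e x = iter 4 f d0 & ex2 d0])].
Proof.
move=> na O P; case: (boolP (tT (e x))) => [T|T].
  by constructor 1; rewrite /transfer T.
have -> : transfer x = pent (e x) by rewrite /transfer (negPf T) O P.
have [d0 d0x dP] := tP_P0 P; have /andP[/t5_len l5 _] := dP.
have xd0 : e x \in porbit f d0 by rewrite porbit_sym.
have [p1 p2 p3 p4 p0] := pent_eval dP.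
case/in_face: xd0 => i; rewrite l5; case: i => [|[|[|[|[|//]]]]] _ Ex.
- by constructor 2; rewrite Ex p0.
- rewrite Ex p1 /pent1; case: ifP => _; first by constructor 1.
  case: ifP => X; last by constructor 2.
  by constructor 3; split=> //; exists d0.
- rewrite Ex p2 /pent2; have n2 : ex2 d0 = false.
    by apply/negP=> /and4P[_ B _ _]; case/negP: na; rewrite -(c_eK x) Ex.
  rewrite n2; case: ifP => _; first by constructor 1.
  by case: ifP => _; [constructor 1|constructor 2].
- rewrite Ex p3 /pent3; have n2 : ex3 d0 = false.
    by apply/negP=> /and4P[_ B _ _]; case/negP: na; rewrite -(c_eK x) Ex.
  rewrite n2; case: ifP => _; first by constructor 1.
  by case: ifP => _; [constructor 1|constructor 2].
- rewrite Ex p4 /pent4; case: ifP => _; first by constructor 1.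
  case: ifP => X; last by constructor 2.
  by constructor 4; split=> //; exists d0.
Qed.

(** Otherwise the pentagon and the face across its side 3 would contradict [a3_no_adj]. The side
    paying 12 in this exception thus has an end that gives them back. *)
Lemma ex3_end d0 : P0 d0 -> ex3 d0 -> ~~ is3 (src (iter 2 f d0)).
Proof.
move=> dP /and4P[/and3P[_ X Y] B _ _]; apply/negP=> p3; apply: (a3_no_adj (d := iter 3 f d0)) => //.
have /andP[/t5_len l5 _] := dP.
have tg i : tgt (iter i f d0) = src (iter i.+1 f d0) by rewrite iterS c_src_f.
rewrite (a3_in (face_iter d0 3)); apply/forallP=> y; apply/implyP=> /in_face[j].
rewrite l5 => j5 ->; case: j j5 => [|[|[|[|[|//]]]]] _ //.
- by rewrite -(tg 0).
- by rewrite -c_tgt_e; exact: (a3_tgt B).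
- by rewrite -(tg 3) -c_src_e; exact: (a3_src B).
Qed.

Lemma ex2_end d0 : P0 d0 -> ex2 d0 -> ~~ is3 (src (iter 4 f d0)).
Proof.
move=> dP /and4P[/and3P[_ X Y] B _ _]; apply/negP=> p3; apply: (a3_no_adj (d := iter 2 f d0)) => //.
have /andP[/t5_len l5 _] := dP.
have tg i : tgt (iter i f d0) = src (iter i.+1 f d0) by rewrite iterS c_src_f.
rewrite (a3_in (face_iter d0 2)); apply/forallP=> y; apply/implyP=> /in_face[j].
rewrite l5 => j5 ->; case: j j5 => [|[|[|[|[|//]]]]] _ //.
- by rewrite -(tg 0).
- by rewrite -c_tgt_e; exact: (a3_tgt B).
- by rewrite -(tg 2) -c_src_e; exact: (a3_src B).
Qed.

Definition hv x := transfer x == 24.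

Lemma hv_type x : tO x -> hv x -> tT (e x) \/ tP (e x).
Proof.
move=> O; rewrite /hv /transfer O /=; case: ifP => [_|_]; first by left.
case: ifP => [_|_]; first by right.
case: ifP => [_|_]; last by case: ifP.
by rewrite /costF; do ?case: ifP.
Qed.

Lemma hv_nt x : tO x -> hv x -> nt x.
Proof. by move=> O /(hv_type O) [/nt_T|/nt_P]. Qed.

(** A cost of 24 is split into 12 for each end: an end that is not a 3-vertex gives it back through
    [nn], and the 3-vertices are counted apart. *)
Lemma transfer_le x : ~~ a3 x -> tO x ->
  transfer x <= nn x + 12 * (hv x && is3 (src x)) + 12 * (hv x && is3 (tgt x)) + 8 * F3 x + 6 * relat x.
Proof.
move=> na O; case: (boolP (hv x)) => [H|nH].
  rewrite (eqP H) /nn (hv_nt O H) /=.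
  by case: (is3 (src x)); case: (is3 (tgt x)); case: (F3 x); case: (relat x).
rewrite !addn0; case: (boolP (tP (e x))) => [P|nP].
  have ntx := nt_P P; have := nH; rewrite /hv.
  case: (pent_cases na O P) => [->|->|[-> [d0 [dP Ex X]]]|[-> [d0 [dP Ex X]]]] // _.
    have := ex3_end dP X; rewrite iterS c_src_f -Ex c_tgt_e => h.
    apply: (leq_trans _ (leq_addr _ _)); apply: (leq_trans _ (leq_addr _ _)).
    by rewrite /nn ntx h leq_addr.
  have := ex2_end dP X; rewrite -Ex c_src_e => h.
  apply: (leq_trans _ (leq_addr _ _)); apply: (leq_trans _ (leq_addr _ _)).
  by rewrite /nn ntx h leq_addl.
move: nH; rewrite /hv /transfer (negPf nP) O /=; case: ifP => // _.
case: ifP => [F _|nF]; first by apply: leq_trans (costF_le F) (leq_addr _ _).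
by case: ifP => // _ _; rewrite leq_addl.
Qed.

(** If a triangle and a pentagon meet there, they are adjacent, and the side of the pentagon is next
    to its triangle; with a 3-vertex between, [pent1] and [pent4] are at most 12. *)
Lemma hv_apart y : tO y -> is3 (src y) -> hv y -> hv (fV y) -> False.
Proof.
move=> O y3 H1 H2; have OV : tO (fV y) by rewrite (tO_in (fV_in y)).
have nT c : tO c -> tP (e c) -> transfer c = (if tT (e c) then 24 else pent (e c)).
  by move=> Oc P; rewrite /transfer Oc P.
have excl c : tP (e c) -> tT (e c) = false.
  by case/andP=> /t5_len l5 _; rewrite /tT l5.
case: (hv_type O H1) => [T1|P1]; case: (hv_type OV H2) => [T2|P2].
- exact: (adj_TT y3 T1 T2).
- have /andP[B5 _] := P2; have dP := adj_T5 y3 T1 B5.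
  have [p1 _ _ _ _] := pent_eval dP.
  move: H2; rewrite /hv nT // excl // -(face_turn y3) -[f _]/(iter 1 f _) p1 /pent1.
  by rewrite c_tgt_e c_src_r y3 /=; case: ifP.
- have /andP[B5 _] := P1; have dP := adj_5T y3 B5 T2.
  have [_ _ _ p4 _] := pent_eval dP.
  have /andP[/t5_len l5 _] := dP; have [V1 _ _ _] := fV_iter l5.
  have Ee : e y = iter 4 f (r y) by rewrite -V1 -c_fe fVf.
  move: H1; rewrite /hv nT // excl // Ee p4 /pent4.
  by rewrite c_src_r y3 /=; case: ifP.
- have /andP[A _] := P1; have /andP[B _] := P2.
  by have := adj_55 y3 A B; rewrite (tP_m P1).
Qed.

Lemma hv_F y : tO y -> is3 (src y) -> (hv y && tF (e (fV y))) || (hv (fV y) && tF (e y)) -> False.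
Proof.
move=> O y3; have OV : tO (fV y) by rewrite (tO_in (fV_in y)).
have noT c x : tF c -> x \in porbit f c -> P0 x -> False.
  by move=> /andP[_ /negP nP] xc dP; apply: nP; rewrite -(tP_in xc) P0_tP.
case/orP=> /andP[H F]; have /andP[F5 _] := F.
  case: (hv_type O H) => [T|/[dup] P /andP[P5 _]].
    apply: (noT _ (e (r y)) F); last exact: (adj_T5 y3 T F5).
    by rewrite -(face_turn y3) porbit_sym f_in.
  by have := adj_55 y3 P5 F5; rewrite (tP_m P).
case: (hv_type OV H) => [T|/[dup] P /andP[P5 _]].
  apply: (noT _ (r y) F); last exact: (adj_5T y3 F5 T).
  by rewrite -c_fe f_in.
by have := adj_55 y3 F5 P5; rewrite (tP_m P).
Qed.

Lemma orbit_closed (P : pred D) d x : x \in porbit f d -> P x ->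
  (forall y, y \in porbit f d -> P y -> P (f y)) -> forall y, y \in porbit f d -> P y.
Proof.
move=> xd Px step y; rewrite -(porb_eq xd) => /in_face[i _ ->]; elim: i => //= i IHi.
by apply: step; rewrite // -(porb_eq xd) face_iter.
Qed.

Lemma own_big v : tO v -> src v \notin K -> ~~ is3 (src v) -> #|porbit r v| != 4 ->
  nt v || nt (fV v) -> own v + 12 <= vgift v.
Proof.
move=> O vK v3 v4 n1; rewrite /own /vgift (negPf vK) (negPf v3) (negPf v4) (ctype_O O).
rewrite ctype_r ctype_rV /gift -/(nt v) -/(nt (fV v)) n1.
by rewrite mulnS addnC.
Qed.

Lemma own_extra d v : tO d -> v \in porbit f d -> own v + 12 <= vgift v ->
  \sum_(x in porbit f d) own x + 12 <= \sum_(x in porbit f d) vgift x.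
Proof.
move=> O vd H; rewrite (bigD1 v) //= [X in _ <= X](bigD1 v) //= addnAC leq_add //.
apply: leq_sum => x /andP[xd _]; apply: leq_trans (leq_addr _ _) (own_vgift _).
by rewrite (tO_in xd).
Qed.

Section LongFace.
Variable d : D.
Hypotheses (nad : ~~ a3 d) (l10 : 10 <= len d).

Let O : tO d. Proof. by rewrite tO_len // (leq_trans _ l10). Qed.
Let Ox x : x \in porbit f d -> tO x. Proof. by move=> xd; rewrite (tO_in xd). Qed.
Let nax x : x \in porbit f d -> ~~ a3 x. Proof. by move=> xd; rewrite (a3_in xd). Qed.
Let fx x : x \in porbit f d -> f x \in porbit f d.
Proof. by rewrite -!eq_porbit_mem porbitS. Qed.
Let fVx x : x \in porbit f d -> fV x \in porbit f d.
Proof. by rewrite -!eq_porbit_mem porbitSV. Qed.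

(* J counts the vertices that are not 3-vertices, T the 3-vertices with a side
   costing 24 and S the other ones. A face of length k affords its gifts as soon
   as 12 T + 8 (S - 1) + 6 Rho <= 24 k - 144; the exceptions have k = 10. *)
Let n3 (x : D) : bool := ~~ is3 (src x).
Let t (x : D) : bool := is3 (src x) && (hv x || hv (fV x)).
Let s (x : D) : bool := is3 (src x) && ~~ (hv x || hv (fV x)).
Let J := \sum_(x in porbit f d) n3 x.
Let T := \sum_(x in porbit f d) t x.
Let S := \sum_(x in porbit f d) s x.
Let Phi := \sum_(x in porbit f d) F3 x.
Let Rho := \sum_(x in porbit f d) relat x.
Let tr := \sum_(x in porbit f d) transfer x.
Let ow := \sum_(x in porbit f d) own x.
Let vg := \sum_(x in porbit f d) vgift x.

Lemma long_count : J + T + S = len d.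
Proof.
rewrite /J /T /S -!big_split /= -[len d]/(#|porbit f d|) -sum1_card; apply: eq_bigr => x _.
by rewrite /n3 /t /s; case: (is3 _) => //=; case: (_ || _).
Qed.

Lemma long_J : exists2 v, v \in porbit f d & n3 v.
Proof. by move: nad; rewrite negb_forall_in => /exists_inP. Qed.

Lemma long_J1 : 0 < J.
Proof. by have [v vd nv] := long_J; have := sum_ge1 (fun x => n3 x : nat) vd; rewrite /= nv. Qed.

Lemma long_F3 x : x \in porbit f d -> F3 x -> s x && s (f x).
Proof.
move=> xd F; have /and3P[Fx sx tx] := F; have Of := Ox (fx xd).
have nh : hv x = false.
  apply/negP=> /(hv_type (Ox xd)) [Tx|Px]; have /andP[/t5_len l5 nP] := Fx.
    by move: (tT_len Tx); rewrite l5.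
  by rewrite Px in nP.
rewrite /s sx c_src_f tx fVf nh orbF /=; apply/andP; split; apply/negP=> H.
  by apply: (hv_F (Ox xd) sx); rewrite H Fx orbT.
have tx' : is3 (src (f x)) by rewrite c_src_f.
by apply: (hv_F Of tx'); rewrite H fVf Fx.
Qed.

(** Both ends of an [F3] side are counted in [S], and these sides do not close up around the face,
    since some vertex is not a 3-vertex. *)
Lemma long_Phi : Phi <= S - 1.
Proof.
case: (boolP [exists x in porbit f d, s x && ~~ F3 x]) => [/existsP[x /andP[xd /andP[sx nF]]]|].
  rewrite /Phi /S (bigD1 x) //= (negPf nF) add0n [X in X - 1](bigD1 x) //= sx addnC addnK.
  apply: leq_sum => y /andP[yd _]; case: (boolP (F3 y)) => // /(long_F3 yd) /andP[-> _].
  by [].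
rewrite negb_exists => /forallP H.
rewrite /Phi big1 => [|x xd]; first by rewrite leq0n.
case: (boolP (F3 x)) => // F; exfalso.
have [v vd nv] := long_J.
have sP y : y \in porbit f d -> s y -> s (f y).
  move=> yd sy; have := H y; rewrite yd sy /= negbK => Fy.
  by case/andP: (long_F3 yd Fy).
have sx : s x by case/andP: (long_F3 xd F).
by have := orbit_closed xd sx sP vd; rewrite /s; move: nv; rewrite /n3 => /negPf->.
Qed.

Let w x := nn x + (hv x && is3 (src x)) * 12 + (hv x && is3 (tgt x)) * 12 + F3 x * 8 + relat x * 6.

Lemma transfer_w x : x \in porbit f d -> transfer x <= w x.
Proof.
move=> xd; apply: leq_trans (transfer_le (nax xd) (Ox xd)) _.
by rewrite /w !(mulnC _ 12) (mulnC _ 8) (mulnC _ 6).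
Qed.

Lemma long_w : \sum_(x in porbit f d) w x <= ow + 12 * T + 8 * Phi + 6 * Rho.
Proof.
rewrite 4!big_split /= -!big_distrl /= (sum_nn d).
rewrite -/ow -/Phi -/Rho (mulnC Phi) (mulnC Rho) !leq_add2r -addnA leq_add2l -mulnDl mulnC leq_mul2l /=.
have -> : \sum_(x in porbit f d) (hv x && is3 (tgt x)) =
    \sum_(x in porbit f d) (hv (fV x) && is3 (src x)).
  rewrite -[RHS](sum_shift f); apply: eq_bigr => x _.
  by rewrite fVf c_src_f.
rewrite -big_split; apply: leq_sum => x xd; rewrite /t.
case: (boolP (is3 (src x))) => x3; rewrite ?andbF //= !andbT.
case: (boolP (hv x)) => h1; case: (boolP (hv (fV x))) => h2 //.
by case: (hv_apart (Ox xd) x3 h1 h2).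
Qed.

Lemma long_transfer : tr <= ow + 12 * T + 8 * Phi + 6 * Rho.
Proof. by apply: leq_trans long_w; apply: leq_sum => x /transfer_w. Qed.

Lemma long_own : ow <= vg.
Proof. by apply: leq_trans (leq_addr _ _) (sum_own_vgift O). Qed.

Lemma relat_ends x : x \in porbit f d -> relat x -> [/\ n3 (fV x), n3 (f (f x)) & is3 (src x)].
Proof. by move=> xd /relatP [x3 _ _ _ [H1 _ H2 _]]. Qed.

Lemma sum_n3V : \sum_(x in porbit f d) n3 (fV x) = J.
Proof. exact: (sum_shiftV f (fun x => n3 x : nat) d). Qed.

Lemma long_Rho : Rho <= J.
Proof.
rewrite -sum_n3V; apply: leq_sum => x xd.
by case: (boolP (relat x)) => // /(relat_ends xd) [-> _ _].
Qed.

Lemma relat_neq x : x \in porbit f d -> fV x != f (f x).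
Proof.
move=> xd; have l3 : 3 < len (fV x) by rewrite (len_in (fVx xd)) (leq_trans _ l10).
by have := iter_lt (isT : 0 < 3) l3; rewrite /= fK4 eq_sym.
Qed.

Lemma long_Rho2 : 0 < Rho -> 1 < J.
Proof.
move=> R0; have [x xd Rx] : exists2 x, x \in porbit f d & relat x.
  apply/exists_inP; apply: contraTT R0; rewrite negb_exists_in => /forall_inP H.
  rewrite -leqNgt leqn0 /Rho big1 // => x /H /negPf->.
  by [].
have [h1 h2 _] := relat_ends xd Rx.
have := sum_ge2 (fun x => n3 x : nat) (fVx xd) (fx (fx xd)) (relat_neq xd).
by rewrite /= h1 h2.
Qed.

(** With equality, every vertex that is not a 3-vertex would have another one three steps further.
    As 7 * 3 is 1 modulo 10, two of them would be consecutive; but the first is followed by a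
    [relat] side, which starts at a 3-vertex. *)
Lemma long_Rho10 : len d = 10 -> Rho < J.
Proof.
move=> l; rewrite ltn_neqAle long_Rho andbT; apply/eqP=> RJ.
have all x : x \in porbit f d -> n3 (fV x) -> relat x.
  move=> xd nx; apply: contraT => nR; have : Rho < J.
    rewrite -sum_n3V /Rho (bigD1 x) //= [X in _ < X](bigD1 x) //= (negPf nR) nx add0n add1n ltnS.
    apply: leq_sum => y /andP[yd _]; case: (boolP (relat y)) => // /(relat_ends yd) [-> _ _].
    by [].
  by rewrite RJ ltnn.
have step y : y \in porbit f d -> n3 y -> n3 (iter 3 f y).
  move=> yd ny; have := all (f y) (fx yd); rewrite fVf => /(_ ny) R.
  by have [_ H _] := relat_ends (fx yd) R.
have [v vd nv] := long_J.
have n21 : n3 (iter 21 f v).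
  have E7 i : iter i f v \in porbit f d by rewrite -(porb_eq vd) face_iter.
  have st i : n3 (iter i f v) -> n3 (iter (3 + i) f v) by rewrite iterD; exact: step (E7 i).
  exact: (st 18 (st 15 (st 12 (st 9 (st 6 (st 3 (st 0 nv))))))).
have v10 : iter 10 f v = v by rewrite -{1}l -(len_in vd) iter_len.
have E21 : iter 21 f v = f v.
  by rewrite (iterD 11 10) v10 (iterD 1 10) v10.
rewrite E21 in n21.
have R := all (f v) (fx vd); rewrite fVf in R.
by have [_ _] := relat_ends (fx vd) (R nv); rewrite (negPf n21).
Qed.

(** The two vertices counted by [J] are those just before and after a [relat] side. By
    [relat_reducible] they do not both have degree 4, and a larger degree brings 12 more. *)
Lemma long_red : J = 2 -> 0 < Rho -> ow + 12 <= vg.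
Proof.
move=> J2 R0; have [x xd Rx] : exists2 x, x \in porbit f d & relat x.
  apply/exists_inP; apply: contraTT R0; rewrite negb_exists_in => /forall_inP H.
  rewrite -leqNgt leqn0 /Rho big1 // => x /H /negPf->.
  by [].
have [_ _ T1 T2 [n1 k1 n2 k2]] := relatP Rx.
have ud := fVx xd; have u'd := fx (fx xd); have uu' := relat_neq xd.
have fin v : v \in porbit f d -> n3 v -> nt v || nt (fV v) -> src v \notin K -> #|porbit r v| != 4 -> ow + 12 <= vg.
  move=> vd nv ntv vK v4; apply: (own_extra O vd).
  exact: (own_big (Ox vd) vK nv v4 ntv).
case: (eqVneq #|porbit r (fV x)| 4) => [u4|u4]; last first.
  by apply: (fin _ ud n1) => //; rewrite nt_T.
case: (eqVneq #|porbit r (f (f x))| 4) => [u'4|u'4]; last first.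
  by apply: (fin _ u'd n2) => //; rewrite fVf (nt_T T2) orbT.
exfalso; apply: (relat_reducible Rx).
- by rewrite (len_in xd) (leq_trans _ l10).
- move=> v; rewrite (fset_in xd) => /imsetP[y yd ->] yu yu'; apply: contraT => ny.
  have y1 : y != fV x by apply: contraNneq yu => ->.
  have y2 : y != f (f x) by apply: contraNneq yu' => ->.
  have : 3 <= J; last by rewrite J2.
  rewrite /J (bigD1 y) //= (bigD1 (fV x)) /=; last by rewrite ud eq_sym.
  rewrite (bigD1 (f (f x))) /=; last by rewrite u'd eq_sym y2 eq_sym.
  by rewrite /n3 ny n1 n2.
- by rewrite -deg_card.
- by rewrite -deg_card.
Qed.

(** Nine 3-vertices at 12 each cost 108, while the face has 96. The missing 12 come from the
    remaining vertex [v], or from a side at [v] that costs less than expected; what is left is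
    excluded by [slot_reducible2] and [slot_reducible3]. *)
Lemma long_single : len d = 10 -> J = 1 -> S = 0 -> tr + 12 <= vg + 12 * T.
Proof.
move=> l J1 S0; have [v vd nv] := long_J.
have R0 : Rho = 0.
  by apply/eqP; rewrite -leqn0 leqNgt; apply/negP=> /long_Rho2; rewrite J1.
have Phi0 : Phi = 0 by apply/eqP; rewrite -leqn0; apply: leq_trans long_Phi _; rewrite S0.
have bound : \sum_(x in porbit f d) w x <= ow + 12 * T.
  by apply: leq_trans long_w _; rewrite R0 Phi0 !muln0 !addn0.
have tt y : y \in porbit f d -> y != v -> t y.
  move=> yd yv; have ny : ~~ n3 y.
    apply/negP=> ny; have := sum_ge2 (fun x => n3 x : nat) yd vd yv.
    by rewrite -/J J1 /= ny nv.
  move: (sum_ge1 (fun x => s x : nat) yd); rewrite -/S S0 leqn0 eqb0 /s /t.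
  by move: ny; rewrite /n3 negbK => ->; rewrite /= negbK.
have extra : ow + 12 <= vg -> tr + 12 <= vg + 12 * T.
  move=> H; apply: leq_trans (_ : ow + 12 * T + 12 <= _); last by rewrite addnAC leq_add2r.
  rewrite leq_add2r; apply: leq_trans bound; apply: leq_sum => x; exact: transfer_w.
(* Each of the nine 3-vertices is on exactly one side costing 24. Such sides have an even number of
   ends in all, so exactly one of them ends at [v]. *)
have odd1 : hv v (+) hv (fV v).
  have H : 2 * (\sum_(x in porbit f d) hv x) = hv v + hv (fV v) + 9.
    rewrite mul2n -addnn -{2}(sum_shiftV f (fun x => hv x : nat) d) -big_split /= (bigD1 v) //=.
    congr (_ + _); rewrite (eq_bigr (fun _ => 1)) => [|y /andP[yd yv]]; last first.
      have /andP[y3] := tt y yd yv.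
      case: (boolP (hv y)) => h1; case: (boolP (hv (fV y))) => h2 //.
      by case: (hv_apart (Ox yd) y3 h1 h2).
    rewrite sum1_card; have := cardD1 v (mem (porbit f d)); rewrite vd -[#|_|]/(len d) l => -[->].
    by apply: eq_card => y; rewrite !inE andbC.
  by have := congr1 odd H; rewrite oddM /= !oddD !oddb; do 2!case: hv.
have vV := fVx vd; have tV : tgt (fV v) = src v by rewrite -c_src_f fK4.
have [ntv vK] : nt v || nt (fV v) /\ src v \notin K.
  move: odd1; case: (boolP (hv v)) => [/(hv_nt (Ox vd)) n _|_ /= /(hv_nt (Ox vV)) n].
    by rewrite n; split=> //; case: (nt_K n).
  by rewrite n orbT; split=> //; case: (nt_K n) => _; rewrite tV.
case: (eqVneq #|porbit r v| 4) => [v4|v4]; last first.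
  by apply/extra/(own_extra O vd)/own_big => //; exact: Ox.
have vE4 : #|[set y | E (src v) y]| = 4 by rewrite -deg_card.
have v3 : ~~ is3 (src v) := nv.
(* With only one needy side at [v], the rule for degree 4 gives 24, where [own] counts 12. *)
case: (boolP (nt v && nt (fV v))) => [/andP[na nb]|nab]; last first.
  apply/extra/(own_extra O vd); rewrite /own /vgift (negPf vK) (negPf v3) v4 eqxx (ctype_O (Ox vd)).
  rewrite ctype_r ctype_rV /gift.
  have hT x : x \in porbit f d -> hv x -> isH (ctype (e x)).
    by move=> xd /(hv_type (Ox xd)) [H|H]; rewrite /ctype H ?orbT.
  have -> : isH (ctype (e v)) || isH (ctype (e (fV v))).
    by move: odd1; case: (boolP (hv v)) => [/(hT _ vd) -> //|_ /= /(hT _ vV) ->]; rewrite orbT.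
  by move: nab; case: (nt v); case: (nt (fV v)).
(* [g] is the other needy side at [v]. If it costs nothing, the 12 units that [v] gives for it are
   the ones sought. *)
have lone g : g \in porbit f d -> nt g -> ~~ hv g -> ~~ is3 (src g) \/ ~~ is3 (tgt g) ->
    (tF (e g) -> False) ->
    (forall d0, P0 d0 -> e g = iter 1 f d0 -> ex3 d0 -> False) ->
    (forall d0, P0 d0 -> e g = iter 4 f d0 -> ex2 d0 -> False) -> tr + 12 <= vg + 12 * T.
  move=> gd ng hg end3 nF n33 n22; case/nt_cases: ng => [Tg|P|/nF//].
    by case/negP: hg; rewrite /hv /transfer Tg.
  have [t24|t0|[_ [d0 [dP Ed X]]]|[_ [d0 [dP Ed X]]]] := pent_cases (nax gd) (Ox gd) P.
  - by case/negP: hg; rewrite /hv t24.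
  - apply: leq_trans (_ : ow + 12 * T <= _); last by rewrite leq_add2r long_own.
    apply: leq_trans bound; rewrite /tr (bigD1 g) //= t0 add0n addnC [X in _ <= X](bigD1 g) //=.
    apply: leq_add; last by apply: leq_sum => x /andP[xd _]; exact: transfer_w.
    have n12 : 12 <= nn g by rewrite /nn (nt_P P); case: end3 => ->; rewrite [_ * true]muln1 ?leq_addr ?leq_addl.
    by apply: leq_trans n12 _; do 3!apply: leq_trans (leq_addr _ _) _; exact: leq_addr.
  - by case: (n33 d0).
  - by case: (n22 d0).
have l5 x : x \in porbit f d -> 5 < len x by move=> xd; rewrite (len_in xd) l.
have fin3 g : g \in porbit f d -> forall u, u \in fset g -> u != src v -> is3 u.
  move=> gd u; rewrite (fset_in gd) => /imsetP[y yd ->] yv.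
  by have /andP[] : t y by apply: tt => //; apply: contraNneq yv => ->.
case: (boolP (hv v)) odd1 => [hvv /= hVn|hvn /= hV].
  have Vv : fV v != v.
    have l1 : 1 < len (fV v) by apply: leq_trans (l5 _ vV).
    by have := iter_lt (isT : 0 < 1) l1; rewrite /= fK4 eq_sym.
  have /andP[V3 tVv] := tt _ vV Vv.
  apply: (lone _ vV nb hVn); first by right; rewrite tV.
  - move=> F; apply: (hv_F (Ox vV) V3).
    by move: tVv; rewrite (negPf hVn) /= => ->; rewrite F.
  - move=> d0 dP Ed /and4P[/and3P[_ _ X] _ _ _]; case/negP: v3.
    by rewrite -tV -c_src_e Ed /= c_src_f.
  - move=> d0 dP Ed /and4P[X B /eqP lB sl].
    have Eg : e (iter 4 f d0) = fV v by rewrite -Ed c_eK.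
    have Es : src (iter 4 f d0) = src v by rewrite -Ed c_src_e tV.
    apply: (slot_reducible2 X B sl); rewrite ?lB ?Es ?Eg //; try exact: l5.
    + by apply: leq_trans (P_side (i := 3) dP isT isT).
    + exact: fin3.
have fv : f v != v.
  have l1 : 1 < len v by apply: leq_trans (l5 _ vd).
  by have := iter_lt (isT : 0 < 1) l1; rewrite /= eq_sym.
have /andP[f3 tfv] := tt _ (fx vd) fv.
apply: (lone _ vd na hvn); first by left.
- move=> F; apply: (hv_F (Ox (fx vd)) f3).
  by move: tfv; rewrite fVf (negPf hvn) orbF => ->; rewrite F.
- move=> d0 dP Ed /and4P[X B /eqP lB sl].
  have Eg : e (f d0) = v by rewrite -[f d0]/(iter 1 f d0) -Ed c_eK.
  have Es : src (iter 2 f d0) = src v by rewrite iterS c_src_f -Ed c_tgt_e.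
  apply: (slot_reducible3 X B sl); rewrite ?lB ?Es ?Eg //; try exact: l5.
  + by apply: leq_trans (P_side (i := 2) dP isT isT).
  + exact: fin3.
- move=> d0 dP Ed /and4P[/and3P[_ X _] _ _ _]; case/negP: v3.
  rewrite -c_tgt_e Ed -c_src_f -iterS.
  have /andP[/t5_len d5 _] := dP; by rewrite -d5 iter_len.
Qed.

Lemma long_ok : tr + 144 <= 24 * len d + vg.
Proof.
have cnt := long_count; have H1 := long_J1; have HP := long_Phi; have HT := long_transfer.
have HO := long_own; have HR := long_Rho; have HR2 := long_Rho2; have HR10 := long_Rho10.
have Hred := long_red; have Hs := long_single.
case: (ltnP (len d) 12) => l12; last first.
  by move: cnt H1 HP HT HO HR l12; clear; move: (len d) => k; lia.
case: (eqVneq (len d) 10) => [l0|n0]; last first.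
  have l11 : len d = 11 by move: l10 l12 n0; clear; move: (len d) => k; lia.
  case: (ltnP 1 J) => J2.
    by move: cnt H1 HP HT HO HR l11 J2; clear; move: (len d) => k; lia.
  have R0 : Rho = 0 by move: HR2 J2; clear; lia.
  by move: cnt H1 HP HT HO R0 l11; clear; move: (len d) => k; lia.
have {}HR10 := HR10 l0; have {}Hs := Hs l0.
case: (eqVneq S 0) => [S0|S0]; case: (eqVneq J 1) => [J1|J1].
- by have := Hs J1 S0; move: cnt l0 J1 S0; clear; move: (len d) => k; lia.
- have [J2|J2] := eqVneq J 2.
    case: (posnP Rho) => [R0|R0].
      by move: cnt HP HT HO R0 l0 J2; clear; move: (len d) => k; lia.
    by have := Hred J2 R0; move: cnt HP HT HR10 l0 J2; clear; move: (len d) => k; lia.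
  by move: cnt H1 HP HT HO HR10 l0 J1 J2; clear; move: (len d) => k; lia.
- have R0 : Rho = 0 by move: HR10 J1; clear; lia.
  by move: cnt HP HT HO R0 l0 J1 S0; clear; move: (len d) => k; lia.
have [J2|J2] := eqVneq J 2.
  case: (posnP Rho) => [R0|R0].
    by move: cnt HP HT HO R0 l0 J2; clear; move: (len d) => k; lia.
  by have := Hred J2 R0; move: cnt HP HT HR10 l0 J2; clear; move: (len d) => k; lia.
by move: cnt H1 HP HT HO HR10 l0 J1 J2; clear; move: (len d) => k; lia.
Qed.

End LongFace.

Lemma face_all d : face_ok d.
Proof.
have [l3|l5|lm|l10] := len_cases d.
- case: (boolP (noK d)) => nK; first by apply: face_T; rewrite /tT l3 nK.
  by apply: face_S; rewrite /tS l3 nK.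
- case: (boolP (noK d)) => nK; last exact: (face_K5 l5 nK).
  have d5 : t5 d by rewrite /t5 l5 nK.
  case: (boolP (tP d)) => [P|nP]; last by apply: face_F; rewrite /tF d5 nP.
  by have [x xd xP] := tP_P0 P; apply: (face_ok_in xd); exact: face_P.
- move: (m678); rewrite !inE => /or3P[] /eqP mk.
  + by apply: (face_6 _ mk); rewrite lm.
  + by apply: (face_7 _ mk); rewrite lm.
  + by apply: (face_8 _ mk); rewrite lm.
case: (boolP (a3 d)) => [a|na].
  case: (ltnP (len d) 12) => [|l12]; last exact: (face_a3_12 a l12).
  rewrite ltnS leq_eqVlt => /orP[/eqP l11|l11]; first exact: (face_a3_11 a l11).
  by apply: (face_a3_10 a); apply/eqP; rewrite eqn_leq l10 andbT -ltnS.
by apply: leq_trans (long_ok na l10) (leq_addr _ _).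
Qed.

Lemma critical_false : False.
Proof. exact: (discharging face_all). Qed.

End Critical.

From mathcomp Require Import all_algebra.
From mathcomp Require Import all_classical all_reals all_analysis.
From mathcomp Require Import ring lra.

(** * From drawings to grid minors *)

Section Compactness.
Import Order.TTheory GRing.Theory Num.Theory numFieldNormedType.Exports.
Local Open Scope classical_set_scope.
Local Open Scope ring_scope.
Variable R : realType.
Implicit Types (a b x y eta rho : R) (gam : R -> R * R).

(** Compactness as a near-covering property, for the filter of [z] tending to 0 from above:
    thresholds that work near each point yield one that works everywhere. *)
Lemma segment_uniform a b (Q : R -> R -> Prop) :
  (forall x, x \in `[a, b] -> exists rho eta, [/\ 0 < rho, 0 < eta &
     forall y z, y \in `[a, b] -> `|x - y| < rho -> 0 < z < eta -> Q z y]) ->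
  exists2 eta, 0 < eta & forall x, x \in `[a, b] -> Q eta x.
Proof.
move=> H; have /compact_near_coveringP cov := @segment_compact R a b.
have FF : Filter (0 : R)^'+ by typeclasses eauto.
have {}cov := cov R (0 : R)^'+ (fun z y => y \in `[a, b] -> Q z y) FF.
have : \forall z \near (0 : R)^'+, `[a, b]%classic `<=` (fun y => y \in `[a, b] -> Q z y).
  apply: cov => x /= xab; have [rho [eta [rho0 eta0 Hx]]] := H x xab.
  exists (ball x rho, [set z | 0 < z < eta]) => /=.
    split; first exact: nbhsx_ballx.
    near=> z; apply/andP; split; first by near: z; exact: nbhs_right_gt.
    by near: z; exact: nbhs_right_lt.
  by move=> [y z] /= [xy zeta] yab; apply: Hx.
move=> {}cov; have [z [z0 Hz]] : exists z : R, 0 < z /\ forall x, x \in `[a, b] -> Q z x.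
  near (0 : R)^'+ => z; exists z; split; first by near: z; exact: nbhs_right_gt.
  have : `[a, b]%classic `<=` (fun y => y \in `[a, b] -> Q z y) by near: z.
  by move=> Hz x xab; apply: Hz.
by exists z.
Unshelve. all: end_near. Qed.

Lemma within_eps gam x e : {within `[0, 1], continuous gam} -> x \in `[0 : R, 1] -> 0 < e ->
  exists2 rho, 0 < rho & forall y, y \in `[0 : R, 1] -> `|x - y| < rho -> `|gam x - gam y| < e.
Proof.
move=> /subspace_continuousP cg x01 e0; have /cvgrPdist_lt /(_ e e0) := cg x x01.
case=> rho /= rho0 Hrho; exists rho => // y y01 xy.
exact: (Hrho y xy y01).
Qed.

Lemma uniform_eps gam e : {within `[0, 1], continuous gam} -> 0 < e ->
  exists2 eta, 0 < eta & forall x y, x \in `[0 : R, 1] -> y \in `[0 : R, 1] ->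
    `|x - y| < eta -> `|gam x - gam y| < e.
Proof.
move=> cg e0.
have [|eta eta0 H] := @segment_uniform 0 1 (fun eta x => forall y, y \in `[0 : R, 1] ->
    `|x - y| < eta -> `|gam x - gam y| < e).
  move=> x x01; have e2 : 0 < e / 2 by lra.
  have [rho rho0 Hr] := within_eps cg x01 e2.
  exists (rho / 2), (rho / 2); split; [lra|lra|move=> y z y01 xy zr t t01 yt].
  rewrite (_ : gam y - gam t = - (gam x - gam y) + (gam x - gam t)); last by rewrite opprB addrA subrK.
  rewrite (le_lt_trans (ler_normD _ _)) // normrN.
  have H1 : `|gam x - gam y| < e / 2 by apply: Hr => //; lra.
  have H2 : `|gam x - gam t| < e / 2.
    apply: Hr => //; rewrite (_ : x - t = (x - y) + (y - t)); last by ring.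
    by rewrite (le_lt_trans (ler_normD _ _)) //; lra.
  lra.
by exists eta => // x y x01; apply: H.
Qed.

(** Compactness is used twice: in [t] for each fixed [s], then in [s]. *)
Lemma separation gam gam' a b c d : {within `[0, 1], continuous gam} ->
  {within `[0, 1], continuous gam'} -> 0 <= a -> b <= 1 -> 0 <= c -> d <= 1 ->
  (forall s t, s \in `[a, b] -> t \in `[c, d] -> gam s <> gam' t) ->
  exists2 e, 0 < e & forall s t, s \in `[a, b] -> t \in `[c, d] -> e <= `|gam s - gam' t|.
Proof.
move=> cg cg' a0 b1 c0 d1 ne.
have sub s : s \in `[a, b] -> s \in `[0, 1] by rewrite !in_itv /= => /andP[]; lra.
have sub' s : s \in `[c, d] -> s \in `[0, 1] by rewrite !in_itv /= => /andP[]; lra.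
have step s : s \in `[a, b] -> exists2 e, 0 < e & forall t, t \in `[c, d] -> e <= `|gam s - gam' t|.
  move=> sab; apply: (@segment_uniform c d (fun e t => e <= `|gam s - gam' t|)) => t tcd.
  have e0 : 0 < `|gam s - gam' t| / 2.
    by rewrite divr_gt0 // normr_gt0 subr_eq0; apply/eqP; apply: ne.
  have [rho rho0 Hr] := within_eps cg' (sub' _ tcd) e0.
  exists rho, (`|gam s - gam' t| / 2); split=> // t' z t'cd tt' /andP[_ zlt].
  have := Hr t' (sub' _ t'cd) tt'.
  have : `|gam s - gam' t| <= `|gam s - gam' t'| + `|gam' t - gam' t'|.
    rewrite (_ : gam s - gam' t = (gam s - gam' t') - (gam' t - gam' t')).
      by rewrite (le_trans (ler_normB _ _)).
    by rewrite opprB addrA subrK.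
  lra.
have [|e e0 H] := @segment_uniform a b (fun e s => forall t, t \in `[c, d] -> e <= `|gam s - gam' t|).
  move=> s sab; have [e e0 He] := step s sab; have e20 : 0 < e / 2 by lra.
  have [rho rho0 Hr] := within_eps cg (sub _ sab) e20.
  exists rho, (e / 2); split=> // s' z s'ab ss' /andP[_ zlt] t tcd.
  have := Hr s' (sub _ s'ab) ss'; have := He t tcd.
  have : `|gam s - gam' t| <= `|gam s - gam s'| + `|gam s' - gam' t|.
    rewrite (_ : gam s - gam' t = (gam s - gam s') + (gam s' - gam' t)).
      by rewrite ler_normD.
    by rewrite addrA subrK.
  lra.
by exists e => // s t sab; apply: H.
Qed.

Lemma finite_eps (T : finType) (Q : T -> R -> Prop) :
  (forall i e e', Q i e -> 0 < e' -> e' <= e -> Q i e') ->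
  (forall i, exists2 e, 0 < e & Q i e) -> exists2 e, 0 < e & forall i, Q i e.
Proof.
move=> mon HQ; have /choice[f Hf] : forall i, exists e, 0 < e /\ Q i e.
  by move=> i; have [e] := HQ i; exists e.
have pos : 0 < \big[Num.min/1]_i f i.
  by apply: (big_ind (fun x : R => 0 < x)) => [|x y x0 y0|i _]; rewrite ?ltr01 ?lt_min ?x0 //; case: (Hf i).
exists (\big[Num.min/1]_i f i) => // i; have [fi0 Qi] := Hf i.
by apply: mon Qi pos _; rewrite (bigD1 i) //= ge_min lexx.
Qed.

End Compactness.

Section Discretize.
Import Order.TTheory GRing.Theory Num.Theory numFieldNormedType.Exports.
Local Open Scope classical_set_scope.
Local Open Scope ring_scope.
Variables (R : realType) (V : finType) (E : rel V) (pos : V -> R * R) (arc : V -> V -> R -> R * R).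
Hypotheses (E_sym : symmetric E) (E_irr : irreflexive E) (drawing : plane_drawing E pos arc).

(** The delicate case is that of a single edge seen from both ends: a common point would have
    parameters with [s = 1 - t], impossible within the first thirds. *)
Lemma arc_neq_KK u v u' v' s t : E u v -> E u' v' -> u != u' ->
  s \in `[0, 1 / 3] -> t \in `[0, 1 / 3] -> arc u v s <> arc u' v' t.
Proof.
case: drawing => pinj _ ainj a0 a1 arev avoid cross uv u'v' uu'.
rewrite !in_itv /= => /andP[s0 s3] /andP[t0 t3] Est.
have [Es|s_neq0] := eqVneq s 0; have [Et|t_neq0] := eqVneq t 0.
- by move: Est; rewrite Es Et !a0 // => /pinj /eqP; rewrite (negPf uu').
- move: Est; rewrite Es a0 // => /esym; apply: (avoid _ _ _ u'v'); rewrite in_itv /=; lra.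
- move: Est; rewrite Et a0 //; apply: (avoid _ _ _ uv); rewrite in_itv /=; lra.
have [Euv|nuv] := eqVneq [set u; v]%SET [set u'; v']%SET; last first.
  by apply: (cross _ _ _ _ uv u'v' nuv _ _ _ _ Est); rewrite in_itv /=; lra.
have : u \in [set u'; v']%SET by rewrite -Euv set21.
rewrite !inE (negPf uu') /= => /eqP Euv'; subst v'.
have : v \in [set u'; u]%SET by rewrite -Euv set22.
rewrite !inE => /orP[/eqP Evu'|/eqP Evu]; last by rewrite Evu E_irr in uv.
subst v; move: Est; rewrite (arev _ _ uv); last by rewrite in_itv /=; lra.
move/(ainj _ _ uv); rewrite !in_itv /= => H; have : s = 1 - t by apply: H; lra.
lra.
Qed.

Lemma arc_neq_JK u v w z s t : E u v -> E w z -> w != u -> w != v ->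
  s \in `[1 / 3, 2 / 3] -> t \in `[0, 1 / 3] -> arc u v s <> arc w z t.
Proof.
case: drawing => pinj _ ainj a0 a1 arev avoid cross uv wz wu wv.
rewrite !in_itv /= => /andP[s0 s3] /andP[t0 t3] Est.
have [Et|t_neq0] := eqVneq t 0.
  by move: Est; rewrite Et a0 //; apply: (avoid _ _ _ uv); rewrite in_itv /=; lra.
apply: (cross _ _ _ _ uv wz _ _ _ _ _ Est); rewrite ?in_itv /=; try lra.
apply/eqP => Euv; have : w \in [set u; v]%SET by rewrite Euv set21.
by rewrite !inE (negPf wu) (negPf wv).
Qed.

Lemma arc_neq_JJ u v u' v' s t : E u v -> E u' v' -> [set u; v]%SET != [set u'; v']%SET ->
  s \in `[1 / 3, 2 / 3] -> t \in `[1 / 3, 2 / 3] -> arc u v s <> arc u' v' t.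
Proof.
case: drawing => _ _ _ _ _ _ _ cross uv u'v' ne.
rewrite !in_itv /= => s3 t3 Est.
by apply: (cross _ _ _ _ uv u'v' ne _ _ _ _ Est); rewrite in_itv /=; lra.
Qed.

(* The cell of a point at scale s, and the corner cell used to join the cells
   of two nearby points by grid steps. *)
Definition cell (s : R) (p : R * R) : int * int := (Num.floor (s * p.1), Num.floor (s * p.2)).
Definition turn (s : R) (p q : R * R) : int * int := (Num.floor (s * q.1), Num.floor (s * p.2)).

Lemma floor_close (x y : R) : `|x - y| < 1 -> (`|Num.floor x - Num.floor y| <= 1)%R.
Proof.
rewrite ltr_norml => /andP[xy1 xy2].
have /andP[x1 x2] := floor_itv x; have /andP[y1 y2] := floor_itv y.
rewrite !intrD /= in x2 y2.
have H1 : Num.floor x - Num.floor y < 2.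
  by rewrite -(ltr_int R) intrD mulrNz (_ : 2%:~R = 2 :> R) //; lra.
have H2 : -2 < Num.floor x - Num.floor y.
  by rewrite -(ltr_int R) intrD !mulrNz (_ : 2%:~R = 2 :> R) //; lra.
lia.
Qed.

(** The tolerance 2 covers both [cell] and [turn]. Two points near the same cell are then at
    distance at most 4 / s. *)
Definition near_cell (s : R) (p : R * R) (c : int * int) :=
  `|s * p.1 - c.1%:~R| <= 2 /\ `|s * p.2 - c.2%:~R| <= 2.

Lemma near_cell_cell s p : near_cell s p (cell s p).
Proof.
by split; rewrite ler_norml; [have := floor_itv (s * p.1)|have := floor_itv (s * p.2)]; rewrite intrD /=; lra.
Qed.

Lemma near_cell_turn s p q : `|s * p.1 - s * q.1| < 1 -> near_cell s p (turn s p q).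
Proof.
rewrite ltr_norml => pq.
by split; rewrite ler_norml; [have := floor_itv (s * q.1)|have := floor_itv (s * p.2)]; rewrite intrD /=; lra.
Qed.

Lemma near_cell_close s e p q c : 0 < s -> 4 / s < e -> near_cell s p c -> near_cell s q c ->
  `|p - q| < e.
Proof.
move=> s0 se [p1 p2] [q1 q2]; apply: le_lt_trans se.
have H x y z : `|s * x - z| <= 2 -> `|s * y - z| <= 2 -> `|x - y| <= 4 / s.
  move=> xz yz; rewrite ler_pdivlMr //.
  have -> : `|x - y| * s = `|s * x - s * y| by rewrite -mulrBr normrM gtr0_norm // mulrC.
  by move: xz yz; rewrite !ler_norml; lra.
by rewrite /Num.norm /= ge_max /= (H _ _ _ p1 q1) (H _ _ _ p2 q2).
Qed.

(** Equality is included, since consecutive sample points may share a cell. *)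
Definition iadj (c c' : int * int) : bool :=
  ((c.1 == c'.1) && (`|c.2 - c'.2| <= 1) || (c.2 == c'.2) && (`|c.1 - c'.1| <= 1))%R.

Lemma emb_cell (B : nat) : exists f : int * int -> 'I_(B.*2).+1 * 'I_(B.*2).+1,
  let inB c := (`|c.1| <= B%:Z) && (`|c.2| <= B%:Z) in
  (forall c c', inB c -> inB c' -> f c = f c' -> c = c') /\
  (forall c c', inB c -> inB c' -> iadj c c' -> (f c == f c') || cadj (f c) (f c')).
Proof.
pose g (z : int) : 'I_(B.*2).+1 := inord (absz (z + B%:Z)).
have gE z : `|z| <= B%:Z -> (g z : nat)%:Z = z + B%:Z.
  by move=> zB; rewrite /g inordK; lia.
exists (fun c => (g c.1, g c.2)) => inB; split=> [[a b] [a' b']|[a b] [a' b']].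
  rewrite /inB /= => /andP[/gE Ea /gE Eb] /andP[/gE Ea' /gE Eb'] [ga gb].
  by congr pair; [move: Ea; rewrite ga Ea' | move: Eb; rewrite gb Eb']; lia.
rewrite /inB /iadj /cadj /= => /andP[/gE Ea /gE Eb] /andP[/gE Ea' /gE Eb'].
case/orP=> /andP[/eqP E1 H].
  rewrite -E1 eqxx xpair_eqE eqxx /= -val_eqE /=; lia.
rewrite -E1 eqxx xpair_eqE eqxx /= andbT -val_eqE /=; lia.
Qed.

Lemma path_iota (X : eqType) (g : rel X) (w : nat -> X) i n :
  (forall l, (i <= l < i + n)%N -> g (w l) (w l.+1)) ->
  path g (w i) [seq w l | l <- iota i.+1 n] /\ last (w i) [seq w l | l <- iota i.+1 n] = w (i + n)%N.
Proof.
elim: n i => [|n IHn] i H /=; first by rewrite addn0.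
rewrite H; last by lia.
have [|H1 H2] := IHn i.+1; first by move=> l Hl; apply: H; lia.
by split=> //; rewrite H2 addSnnS.
Qed.

(** The piece [K u] collects the cells met by the first thirds of the arcs at [u], and [J u v] those
    met by the middle third of the arc. Disjoint pieces of arcs are at distance at least [e] by
    compactness, and the grid is too fine for them to share a cell. *)
Lemma drawing_minor : exists M (b : 'I_M.+1 * 'I_M.+1 -> option V), minor E (@cadj M) b.
Proof.
have cont := drawing_arc_continuous drawing.
have one0 : (0 : R) < 1 by [].
have [e1 e10 He1] : exists2 e : R, 0 < e & forall i : V * V * (V * V), E i.1.1 i.1.2 ->
    E i.2.1 i.2.2 -> i.1.1 != i.2.1 -> forall s t, s \in `[0, 1 / 3] -> t \in `[0, 1 / 3] ->
    e <= `|arc i.1.1 i.1.2 s - arc i.2.1 i.2.2 t|.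
  apply: finite_eps => [i e e' H e'0 e'e h1 h2 h3 s t hs ht|[[u v] [u' v']] /=].
    by apply: le_trans e'e _; apply: H.
  case: (boolP [&& E u v, E u' v' & u != u']) => [/and3P[uv u'v' ne]|H].
    have [||||e e0 He] := separation (cont _ _ uv) (cont _ _ u'v') _ _ _ _ (fun s t => @arc_neq_KK _ _ _ _ s t uv u'v' ne);
      try lra.
    by exists e.
  by exists 1 => // h1 h2 h3; rewrite h1 h2 h3 in H.
have [e2 e20 He2] : exists2 e : R, 0 < e & forall i : V * V * (V * V), E i.1.1 i.1.2 ->
    E i.2.1 i.2.2 -> i.2.1 != i.1.1 -> i.2.1 != i.1.2 ->
    forall s t, s \in `[1 / 3, 2 / 3] -> t \in `[0, 1 / 3] ->
    e <= `|arc i.1.1 i.1.2 s - arc i.2.1 i.2.2 t|.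
  apply: finite_eps => [i e e' H e'0 e'e h1 h2 h3 h4 s t hs ht|[[u v] [u' v']] /=].
    by apply: le_trans e'e _; apply: H.
  case: (boolP [&& E u v, E u' v', u' != u & u' != v]) => [/and4P[uv u'v' ne ne']|H].
    have [||||e e0 He] := separation (cont _ _ uv) (cont _ _ u'v') _ _ _ _ (fun s t => @arc_neq_JK _ _ _ _ s t uv u'v' ne ne');
      try lra.
    by exists e.
  by exists 1 => // h1 h2 h3 h4; rewrite h1 h2 h3 h4 in H.
have [e3 e30 He3] : exists2 e : R, 0 < e & forall i : V * V * (V * V), E i.1.1 i.1.2 ->
    E i.2.1 i.2.2 -> [set i.1.1; i.1.2]%SET != [set i.2.1; i.2.2]%SET ->
    forall s t, s \in `[1 / 3, 2 / 3] -> t \in `[1 / 3, 2 / 3] ->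
    e <= `|arc i.1.1 i.1.2 s - arc i.2.1 i.2.2 t|.
  apply: finite_eps => [i e e' H e'0 e'e h1 h2 h3 s t hs ht|[[u v] [u' v']] /=].
    by apply: le_trans e'e _; apply: H.
  case: (boolP [&& E u v, E u' v' & [set u; v]%SET != [set u'; v']%SET]) => [/and3P[uv u'v' ne]|H].
    have [||||e e0 He] := separation (cont _ _ uv) (cont _ _ u'v') _ _ _ _ (fun s t => @arc_neq_JJ _ _ _ _ s t uv u'v' ne);
      try lra.
    by exists e.
  by exists 1 => // h1 h2 h3; rewrite h1 h2 h3 in H.
pose e := Num.min e1 (Num.min e2 e3).
have e0 : 0 < e by rewrite !lt_min e10 e20.
(* Any numerator above 4 would do, by [near_cell_close]. *)
pose s := 5 / e; have s0 : 0 < s by rewrite divr_gt0.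
have se : 4 / s < e by rewrite /s invf_div mulrA ltr_pdivrMr //; lra.
have is0 : 0 < 1 / s by rewrite divr_gt0.
have [eta eta0 Heta] : exists2 eta : R, 0 < eta & forall i : V * V, E i.1 i.2 ->
    forall x y, x \in `[0 : R, 1] -> y \in `[0 : R, 1] -> `|x - y| < eta ->
    `|arc i.1 i.2 x - arc i.1 i.2 y| < 1 / s.
  apply: finite_eps => [i z z' H z'0 z'z h1 x y hx hy xy|[u v] /=].
    by apply: H => //; apply: lt_le_trans xy z'z.
  case: (boolP (E u v)) => [uv|_]; last by exists 1.
  by have [z z0 Hz] := uniform_eps (cont _ _ uv) is0; exists z.
have [m m0 m_eta] : exists2 m : nat, (0 : R) < m%:R & 1 / m%:R < eta.
  exists (Num.bound (1 / eta)).+1; first by rewrite ltr0n.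
  rewrite ltr_pdivrMr ?ltr0n // mulrC -ltr_pdivrMr //.
  apply: lt_le_trans (archi_boundP _) _; first by rewrite divr_ge0 // ltW.
  by rewrite ler_nat.
(* The arc is sampled at [3 * m] steps, so its thirds end at multiples of [m]. *)
pose tk (k : nat) : R := k%:R / m%:R / 3.
have tk0 k : 0 <= tk k by rewrite /tk !divr_ge0.
have tk_le k i : (tk k <= i%:R / 3) = (k <= i * m)%N.
  by rewrite /tk ler_pM2r ?invr_gt0 // ler_pdivrMr // -natrM ler_nat.
have tk_ge k i : (i%:R / 3 <= tk k) = (i * m <= k)%N.
  by rewrite /tk ler_pM2r ?invr_gt0 // ler_pdivlMr // -natrM ler_nat.
have tk01 k : (k <= 3 * m)%N -> tk k \in `[0 : R, 1].
  move=> km; rewrite in_itv /= tk0 /=.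
  have H3 : 3%:R / 3 = 1 :> R by lra.
  by rewrite -[X in _ <= X]H3 tk_le.
have tk13 k : (k <= m)%N -> tk k \in `[0 : R, 1 / 3].
  by move=> km; rewrite in_itv /= tk0 /=; have H := tk_le k 1; rewrite mul1n km in H; exact: H.
have tk23 k : (m <= k <= 2 * m)%N -> tk k \in `[1 / 3 : R, 2 / 3].
  move=> /andP[mk km]; rewrite in_itv /=; apply/andP; split.
    by have H := tk_ge k 1; rewrite mul1n mk in H; exact: H.
  by have H := tk_le k 2; rewrite km in H; exact: H.
have tkS k : `|tk k - tk k.+1| < eta.
  rewrite /tk -natr1 (_ : _ - _ = - (1 / m%:R / 3)); last by field; lra.
  rewrite normrN gtr0_norm ?divr_gt0 //.
  apply: le_lt_trans m_eta. have h : 0 < 1 / m%:R :> R by rewrite divr_gt0. lra.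
pose P u v k := arc u v (tk k).
(* Even indices are the cells of the samples and odd ones the corners between them, so the thirds of
   the arc end at the indices [2 * m] and [4 * m]. *)
pose w u v l := if odd l then turn s (P u v l./2) (P u v l./2.+1) else cell s (P u v l./2).
have Pclose u v k : E u v -> (k < 3 * m)%N ->
    `|s * (P u v k).1 - s * (P u v k.+1).1| < 1 /\ `|s * (P u v k).2 - s * (P u v k.+1).2| < 1.
  move=> uv km; have := Heta (u, v) uv _ _ (tk01 k _) (tk01 k.+1 _) (tkS k).
  move=> /(_ _ _)/=; rewrite -/(P u v k) -/(P u v k.+1) => H.
  have {}H : `|P u v k - P u v k.+1| < 1 / s by apply: H; move: km; clear; lia.
  move: H; rewrite {1}/Num.norm /= gt_max /= => /andP[].
  have sc (x y : R) : `|x - y| < 1 / s -> `|s * x - s * y| < 1.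
    by rewrite ltr_pdivlMr // -mulrBr normrM (gtr0_norm s0) mulrC.
  by move=> /sc H1 /sc H2.
have wstep u v l : E u v -> (l < 6 * m)%N -> iadj (w u v l) (w u v l.+1).
  move=> uv lm; have km : (l./2 < 3 * m)%N by move: lm; clear; lia.
  have [H1 H2] := Pclose u v l./2 uv km.
  rewrite /w /= uphalf_half; case: (boolP (odd l)) => ol /=.
    by rewrite /iadj /turn /cell /= add1n eqxx /= floor_close.
  by rewrite /iadj /turn /cell /= add0n eqxx /= (floor_close H1) orbT.
have wnear u v l : E u v -> (l < 6 * m)%N -> near_cell s (P u v l./2) (w u v l).
  move=> uv lm; have km : (l./2 < 3 * m)%N by move: lm; clear; lia.
  have [H1 H2] := Pclose u v l./2 uv km.
  by rewrite /w; case: ifP => _; [apply: near_cell_turn | apply: near_cell_cell].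
pose L := (6 * m)%N.
pose B := \max_(i : V * V * 'I_L) maxn (absz (w i.1.1 i.1.2 i.2).1) (absz (w i.1.1 i.1.2 i.2).2).
have [f /= [f_inj f_adj]] := emb_cell B.
have inB u v l : (l < 6 * m)%N -> (`|(w u v l).1| <= B%:Z) && (`|(w u v l).2| <= B%:Z).
  move=> lm; have : (maxn (absz (w u v l).1) (absz (w u v l).2) <= B)%N.
    exact: (leq_bigmax (F := fun i : V * V * 'I_L => maxn (absz (w i.1.1 i.1.2 i.2).1) (absz (w i.1.1 i.1.2 i.2).2)) (u, v, Ordinal lm)).
  rewrite geq_max; move: (w u v l) => [x y] /=; clear; lia.
exists B.*2.
(* Steps that stay in place are allowed here and discarded at the end. *)
pose g c c' := (c == c') || @cadj B.*2 c c'.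
pose F u v l := f (w u v l).
have F_adj u v l : E u v -> (l.+1 < 6 * m)%N -> g (F u v l) (F u v l.+1).
  move=> uv lm; have lm' : (l < 6 * m)%N by move: lm; clear; lia.
  by rewrite /g /F f_adj ?inB //; apply: wstep.
have F_near u v l u' v' l' : E u v -> E u' v' -> (l < 6 * m)%N -> (l' < 6 * m)%N ->
    F u v l = F u' v' l' -> `|P u v l./2 - P u' v' l'./2| < e.
  move=> uv u'v' lm l'm Eff; apply: (near_cell_close s0 se (wnear _ _ _ uv lm)).
  by rewrite (f_inj _ _ (inB u v l lm) (inB u' v' l' l'm) Eff); apply: wnear.
pose K u : {set _} := [set c | [exists v, [exists l : 'I_(2 * m).+1, E u v && (c == F u v l)]]]%SET.
have KP u c : reflect (exists v l, [/\ E u v, (l <= 2 * m)%N & c = F u v l]) (c \in K u).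
  rewrite inE; apply: (iffP existsP) => [[v /existsP[l /andP[uv /eqP->]]]|[v [l [uv lm ->]]]].
    by exists v, l; split=> //; have := ltn_ord l; rewrite ltnS.
  by exists v; apply/existsP; exists (Ordinal (lm : (l < (2 * m).+1)%N)); rewrite uv /=.
pose J u v := [seq F u v l | l <- iota (2 * m)%N (2 * m).+1].
have JP u v c : c \in J u v -> exists2 l, (2 * m <= l <= 4 * m)%N & c = F u v l.
  by case/mapP=> l; rewrite mem_iota => Hl ->; exists l => //; move: Hl; clear; lia.
have m1 : (0 < m)%N by rewrite ltr0n in m0.
have halfm (a : nat) : ((2 * a)./2 = a)%N by clear; lia.
have small l : (l <= 4 * m)%N -> (l < 6 * m)%N by move: m1; clear; lia.
have small2 l : (l <= 2 * m)%N -> (l < 6 * m)%N by move: m1; clear; lia.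
have h13 l : (l <= 2 * m)%N -> (l./2 <= m)%N by clear; lia.
have h23 l : (2 * m <= l <= 4 * m)%N -> (m <= l./2 <= 2 * m)%N by clear; lia.
have [b [bconn badj]] : exists b, minor E g b.
  apply: (@minor_of_pieces _ _ (ord0, ord0) E g _ E_sym E_irr K J).
  - by move=> x y; rewrite /g eq_sym cadj_sym.
  - have start u v : E u v -> F u v 0 = f (cell s (pos u)).
      move=> uv; rewrite /F /w /= /P; congr (f (cell s _)).
      by rewrite /tk !mul0r (drawing_arc0 drawing).
    have csym u : connect_sym [rel x y | [&& g x y, x \in K u & y \in K u]].
      apply: sym_connect_sym => x y /=; rewrite /g eq_sym cadj_sym.
      by rewrite [(x \in _) && _]andbC.
    have toS u c : c \in K u -> connect [rel x y | [&& g x y, x \in K u & y \in K u]] (f (cell s (pos u))) c.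
      case/KP=> v [l [uv lm ->]]; elim: l lm => [|l IHl] lm; first by rewrite start ?connect0.
      apply: connect_trans (IHl (ltnW lm)) (connect1 _).
      rewrite /= F_adj //=; last by apply: small2.
      apply/andP; split; apply/KP; first by exists v, l; split=> //; exact: ltnW.
      by exists v, l.+1.
    by move=> u x y /toS ux /toS uy; rewrite csym in ux; exact: connect_trans ux uy.
  - move=> u u' c /KP[v [l [uv lm ->]]] /KP[v' [l' [u'v' l'm Eff]]].
    apply: contraTeq (F_near _ _ _ _ _ _ uv u'v' (small2 _ lm) (small2 _ l'm) Eff).
    move=> uu'; rewrite -leNgt; apply: le_trans (He1 (u, v, (u', v')) uv u'v' uu' _ _ _ _).
    + by rewrite ge_min lexx.
    + exact/tk13/h13.
    + exact/tk13/h13.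
  - move=> u v uv; have [|H1 H2] := @path_iota _ g (F u v) (2 * m)%N (2 * m)%N.
      by move=> l Hl; apply: F_adj => //; apply: small; move: Hl; clear; lia.
    exists (F u v (2 * m)%N), [seq F u v l | l <- iota (2 * m).+1 (2 * m)]; split=> //.
      by apply/KP; exists v, (2 * m)%N.
    rewrite H2; have vu : E v u by rewrite E_sym.
    apply/KP; exists u, (2 * m)%N; split=> //.
    have o1 : odd (2 * m) = false by clear; lia.
    have o2 : odd (2 * m + 2 * m) = false by clear; lia.
    rewrite /F /w o1 o2; congr (f (cell s _)).
    rewrite /P (drawing_arc_rev drawing uv); last by apply: tk01; rewrite halfm; move: m1; clear; lia.
    congr (arc u v _); rewrite (_ : (2 * m + 2 * m)./2 = 2 * m)%N; last by clear; lia.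
    by rewrite halfm /tk natrM; field; lra.
  - move=> u v u' c uv /JP[l Hl ->] /KP[v' [l' [u'v' l'm Eff]]].
    case: (eqVneq u' u) => [|nu]; first by left.
    case: (eqVneq u' v) => [|nv]; first by right.
    have /andP[_ Hl4] := Hl.
    exfalso; have := F_near _ _ _ _ _ _ uv u'v' (small _ Hl4) (small2 _ l'm) Eff.
    rewrite ltNge => /negP; apply.
    apply: le_trans (He2 (u, v, (u', v')) uv u'v' nu nv _ _ _ _).
    + by rewrite !ge_min lexx orbT.
    + exact/tk23/h23.
    + exact/tk13/h13.
  move=> u v u' v' c uv u'v' /JP[l Hl ->] /JP[l' Hl' Eff].
  have [Es|ne] := eqVneq [set u; v]%SET [set u'; v']%SET.
    have : u \in [set u'; v']%SET by rewrite -Es set21.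
    have : v \in [set u'; v']%SET by rewrite -Es set22.
    rewrite !inE => /orP[]/eqP Ev /orP[]/eqP Eu; try (by left); try (by right).
      by rewrite Eu Ev E_irr in uv.
    by rewrite Eu Ev E_irr in uv.
  have /andP[_ Hl4] := Hl; have /andP[_ Hl4'] := Hl'.
  exfalso; have := F_near _ _ _ _ _ _ uv u'v' (small _ Hl4) (small _ Hl4') Eff.
  rewrite ltNge => /negP; apply.
  apply: le_trans (He3 (u, v, (u', v')) uv u'v' ne _ _ _ _).
  + by rewrite !ge_min lexx !orbT.
  + exact/tk23/h23.
  + exact/tk23/h23.
exists b; split=> [x y bxy bx|u v uv].
  move: (bconn x y bxy bx); apply: connect_sub => {bxy bx} {}x {}y /= /andP[/orP[/eqP->|xy] bxy].
    exact: connect0.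
  by apply: connect1; rewrite /= xy.
have [x [y [/orP[/eqP xy|xy] bx by_]]] := badj u v uv; last by exists x, y.
by move: by_; rewrite -xy bx => -[Euv]; rewrite Euv E_irr in uv.
Qed.

End Discretize.

Section PlanarMap.
Import Order.TTheory GRing.Theory Num.Theory numFieldNormedType.Exports.
Local Open Scope classical_set_scope.
Local Open Scope ring_scope.

Theorem planar_map (R : realType) (V : finType) (E : rel V) :
  symmetric E -> irreflexive E -> planar R E -> exists e r, @plane_map V E e r.
Proof.
move=> E_sym E_irr [pos [arc drawing]].
have [M [b bminor]] := drawing_minor E_sym E_irr drawing.
exact: plane_map_of_minor bminor.
Qed.

End PlanarMap.

(** * Passage to subgraphs and conclusion *)

Lemma planar_subrel (R : realType) (V : finType) (E' E : rel V) :
  subrel E' E -> planar R E -> planar R E'.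
Proof.
move=> sE [pos [arc []]] H1 H2 H3 H4 H5 H6 H7 H8; exists pos, arc.
split=> //.
- by move=> u v /sE; exact: H2.
- by move=> u v /sE; exact: H3.
- by move=> u v /sE; exact: H4.
- by move=> u v /sE; exact: H5.
- by move=> u v /sE; exact: H6.
- by move=> u v w /sE; exact: H7.
- by move=> u v x y /sE uv /sE xy; exact: H8.
Qed.

Lemma cyc_subrel (V : finType) (E' E : rel V) k : subrel E' E -> cyc E' k -> cyc E k.
Proof.
move=> sE [c ck /andP[cE uc]]; exists c => //; apply/andP; split=> //.
by case: c {ck uc} cE => //= x c; exact: sub_path.
Qed.

Lemma coloring_M_colorable (V C : finType) (E : rel V) (L : V -> {set C}) M psi :
  coloring E L M [set: V]%SET psi -> M_colorable E L M.
Proof.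
move=> [col1 col2]; exists [set (v, psi v) | v in V]%SET; split.
- by apply/fintype.subsetP => p /imsetP[v _ ->]; rewrite inE col1.
- by rewrite card_imset // => u v [].
move=> p q /imsetP[u _ ->] /imsetP[v _ ->]; rewrite /cover_adj /=.
case: eqP => [->|_]; first by rewrite eqxx.
by apply/negP=> /andP[uv]; apply/negP/col2.
Qed.

Theorem theorem2 (R : realType) (V : finType) (E : rel V)
    (E_sym : symmetric E) (E_irr : irreflexive E)
    (a b : nat) (ha : a \in [:: 6; 7; 8]) (hb : b \in [:: 6; 7; 8])
    (hab : a <> b)
    (E_planar : planar R E)
    (no_4 : ~ has_cycle E 4) (no_a : ~ has_cycle E a)
    (no_b : ~ has_cycle E b) (no_9 : ~ has_cycle E 9) :
  DP_colorable E 3.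
Proof.
have [m m678 nocyc] : exists2 m, m \in [:: 6; 7; 8] &
    forall k, k \in [:: 4; 6; 7; 8; 9] -> k != m -> ~ cyc E k.
  have n k : ~ has_cycle E k -> 2 < k -> ~ cyc E k by move=> nk k2 ck; apply: nk.
  have n4 := n 4 no_4 isT; have n9 := n 9 no_9 isT.
  move: ha hb; rewrite !inE => /or3P[] /eqP Ea /or3P[] /eqP Eb; subst a b => //;
    have na := n _ no_a isT; have nb := n _ no_b isT.
  - by exists 8 => // k; rewrite !inE => /or4P[|||/orP[]] /eqP->.
  - by exists 7 => // k; rewrite !inE => /or4P[|||/orP[]] /eqP->.
  - by exists 8 => // k; rewrite !inE => /or4P[|||/orP[]] /eqP->.
  - by exists 6 => // k; rewrite !inE => /or4P[|||/orP[]] /eqP->.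
  - by exists 7 => // k; rewrite !inE => /or4P[|||/orP[]] /eqP->.
  - by exists 6 => // k; rewrite !inE => /or4P[|||/orP[]] /eqP->.
move=> C L M L3 HM.
(* The empty graph has no vertex to precolour. *)
case: (pickP (mem V)) => [v0 _|V0]; last first.
  exists finset.set0; split; first exact: finset.sub0set.
    by rewrite cards0 eq_card0.
  by move=> p q; rewrite inE.
have colour v : exists c, c \in L v by apply/finset.set0Pn; rewrite -card_gt0 L3.
have [phi phiL] := choice colour.
(* One vertex with an arbitrary colour of its list starts the induction. *)
have ext : extendable E L M [set: V]%SET [set v0]%SET.
  apply: (all_extendable E_sym E_irr L3); last exact: finset.subsetT.
  - exact: matching_sym HM.
  - exact: matching_functional HM.
  - by move=> E' sE symE irrE; exact: planar_map symE irrE (planar_subrel sE E_planar).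
  - move=> E' K e r sE Hc; apply: (critical_false Hc m678) => k kin km ck.
    exact: nocyc kin km (cyc_subrel sE ck).
  split; rewrite ?cards1 // => x y; rewrite !inE => /eqP-> /eqP->.
  by rewrite eqxx.
have [|psi col _] := ext phi; last exact: coloring_M_colorable col.
split=> [x _|x y]; first exact: phiL.
by rewrite !inE => /eqP-> /eqP->; rewrite E_irr.
Qed.
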